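(* Let $P(\lambda)=x_n\Delta-(2\lambda-n-2)\partial_n$ for $\lambda\in\mathbb{C}$. The operator $P(\lambda)$ is a spectral shift operator for the distribution kernels $K^\pm_{\lambda,\nu}(x',x_n)$, i.e. $$P(\lambda)K^\pm_{\lambda,\nu}(x',x_n)=(\lambda+\nu-n)(\nu-\lambda+1)\,K^\mp_{\lambda-1,\nu}(x',x_n),$$ and $$P\Big(\frac{\lambda+\nu+1}{2}\Big)K^\pm_{\lambda,\nu}(x',x_n)=2\nu(\nu-\lambda+1)\,K^\mp_{\lambda,\nu+1}(x',x_n).$$
   Context: Let $n\ge 2$, $\lambda,\nu\in\mathbb{C}$, and write $x=(x',x_n)\in\mathbb{R}^n$ with $x'\in\mathbb{R}^{n-1}$. The kernels are $$K^+_{\lambda,\nu}(x',x_n)=|x_n|^{\lambda+\nu-n}(|x'|^2+x_n^2)^{-\nu},\qquad K^-_{\lambda,\nu}(x',x_n)=\mathrm{sgn}(x_n)|x_n|^{\lambda+\nu-n}(|x'|^2+x_n^2)^{-\nu}.$$ They are locally integrable (and define tempered distributions) for $\Re(\lambda+\nu)>n-1$ and $\Re(\lambda-\nu)>0$, and are understood as distributions depending meromorphically on $(\lambda,\nu)\in\mathbb{C}^2$; identities between them are identities of such meromorphic families. $\Delta=\sum_{k=1}^n\partial_k^2$; $P(\lambda)$ acts on tempered distributions on $\mathbb{R}^n$, and equivalently $P(\lambda)f=\Delta(x_nf)+(n-2\lambda)\partial_nf$. The upper (respectively lower) signs in $\pm,\mp$ correspond. *)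

(* Defs.v *)
From HB Require Import structures.
From mathcomp Require Import all_boot all_order all_algebra.
From mathcomp Require Import complex.
From mathcomp Require Import all_classical all_reals all_analysis.

Set Implicit Arguments.
Unset Strict Implicit.
Unset Printing Implicit Defensive.

Import Order.TTheory GRing.Theory Num.Theory numFieldNormedType.Exports.

Local Open Scope classical_set_scope.
Local Open Scope ring_scope.
Local Open Scope complex_scope.

(* The library has Lebesgue measure on R and binary products only; on the
   n-tuples it is the image of the iterated product R x (R x ( ... )).
   [lebesgue_tuple_box] checks it on boxes, which characterises it. *)
Lemma sigma_finite_product_measure d1 d2 (T1 : measurableType d1)
  (T2 : measurableType d2) (R : realType)
  (m1 : {sigma_finite_measure set T1 -> \bar R})
  (m2 : {sigma_finite_measure set T2 -> \bar R}) :
  sigma_finite setT (m1 \x m2)%E.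
Proof.
have /sigma_finiteP[F [TF ndF Foo]] := sigma_finiteT m1.
have /sigma_finiteP[G [TG ndG Goo]] := sigma_finiteT m2.
exists (fun n => F n `*` G n).
  rewrite -setXTT TF TG predeqE => -[x y]; split.
    move=> [/= [n _ Fnx] [k _ Gky]]; exists (maxn n k) => //; split.
    - by move: x Fnx; exact/subsetPset/ndF/leq_maxl.
    - by move: y Gky; exact/subsetPset/ndG/leq_maxr.
  by move=> [n _ []/= ? ?]; split; exists n.
move=> k; have [? ?] := Foo k; have [? ?] := Goo k.
split; first exact: measurableX.
by rewrite product_measure1E// lte_mul_pinfty// ge0_fin_numE.
Qed.

Section LebesgueTuple.
Variable R : realType.

Let consT n (p : measurableTypeR R * n.-tuple (measurableTypeR R)) :
  n.+1.-tuple (measurableTypeR R) := [tuple of p.1 :: p.2].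

Let measurable_consT n : measurable_fun [set: _] (@consT n).
Proof. exact: measurable_cons measurable_fst measurable_snd. Qed.

Section Step.
Variables (n : nat)
  (mu : {sigma_finite_measure set (n.-tuple (measurableTypeR R)) -> \bar R}).

Definition lebesgue_cons : set (n.+1.-tuple (measurableTypeR R)) -> \bar R :=
  pushforward (lebesgue_measure \x mu)%E
    (fun p : measurableTypeR R * n.-tuple (measurableTypeR R) =>
       [tuple of p.1 :: p.2]).

Let cons0 : lebesgue_cons set0 = 0%E.
Proof. by rewrite /lebesgue_cons /pushforward preimage_set0 measure0. Qed.

Let cons_ge0 A : (0 <= lebesgue_cons A)%E.
Proof. by rewrite /lebesgue_cons /pushforward; exact: measure_ge0. Qed.

Let cons_sigma_additive : semi_sigma_additive lebesgue_cons.
Proof.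
move=> F mF tF mUF; rewrite /lebesgue_cons /pushforward preimage_bigcup.
apply: measure_semi_sigma_additive.
- by move=> k; rewrite -[X in measurable X]setTI; exact: measurable_consT.
- apply/trivIsetP => /= i j _ _ ij; rewrite -preimage_setI.
  by move/trivIsetP : tF => /(_ _ _ _ _ ij) ->//; rewrite preimage_set0.
- rewrite -preimage_bigcup -[X in measurable X]setTI.
  exact: measurable_consT.
Qed.

HB.instance Definition _ := isMeasure.Build _ _ _ lebesgue_cons
  cons0 cons_ge0 cons_sigma_additive.

Let unconsT (t : n.+1.-tuple (measurableTypeR R)) :
  measurableTypeR R * n.-tuple (measurableTypeR R) :=
  (tnth t ord0, [tuple of behead t]).

Let measurable_unconsT : measurable_fun [set: _] unconsT.
Proof.
by apply/measurable_fun_pairP; split;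
  [exact: measurable_tnth|exact: measurable_behead].
Qed.

Let cons_sigma_finite : sigma_finite setT lebesgue_cons.
Proof.
have [F FT Foo] : sigma_finite setT (lebesgue_measure \x mu)%E.
  exact: sigma_finite_product_measure.
exists (fun k => unconsT @^-1` F k).
  by rewrite -preimage_bigcup -FT preimage_setT.
move=> k; have [mF Fk] := Foo k; split.
  by rewrite -[X in measurable X]setTI; exact: measurable_unconsT.
rewrite /lebesgue_cons /pushforward -comp_preimage.
rewrite (_ : unconsT \o _ = id) ?preimage_id//.
apply/funext => -[x t]; rewrite /unconsT /=; congr pair.
by apply/val_inj.
Qed.

HB.instance Definition _ := Measure_isSigmaFinite.Build _ _ _ lebesgue_cons
  cons_sigma_finite.
End Step.

Fixpoint lebesgue_tuple (n : nat) :
    {sigma_finite_measure set (n.-tuple (measurableTypeR R)) -> \bar R} :=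
  match n with
  | 0 => dirac ([tuple] : 0.-tuple (measurableTypeR R))
  | n.+1 => lebesgue_cons (lebesgue_tuple n)
  end.

Lemma lebesgue_tuple_box n (A : 'I_n -> set (measurableTypeR R)) :
  (forall i, measurable (A i)) ->
  lebesgue_tuple n [set t | forall i, A i (tnth t i)]
  = (\prod_(i < n) lebesgue_measure (A i))%E.
Proof.
elim: n A => [|n IH] A mA.
  by rewrite big_ord0 /= diracE mem_set//= => -[].
rewrite big_ord_recl -IH//= /lebesgue_cons /pushforward.
rewrite [X in product_measure1 _ _ X](_ : _ = A ord0 `*`
    [set t : n.-tuple (measurableTypeR R) |
       forall i, A (lift ord0 i) (tnth t i)]); last first.
  apply/seteqP; split=> [[x t] /= h|[x t] /= [h0 h] i].
    by split=> [|i]; [have := h ord0|have := h (lift ord0 i); rewrite tnthS].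
  by case: (unliftP ord0 i) => [j ->|->//]; rewrite tnthS.
rewrite product_measure1E//.
rewrite [X in measurable X](_ : _ = \bigcap_(i in [set: 'I_n])
  ((fun t : n.-tuple (measurableTypeR R) => tnth t i) @^-1` A (lift ord0 i))).
  apply: fin_bigcap_measurable => // i _.
  by rewrite -[X in measurable X]setTI; exact: measurable_tnth.
by apply/seteqP; split=> t /= h i; [move=> _|]; exact: h.
Qed.
End LebesgueTuple.

Section Schwartz.
Variables (R : realType) (n : nat).
Implicit Types (f : 'rV[R]_n -> R[i]) (T : ('rV[R]_n -> R[i]) -> R[i]).

Definition cintegral f : R[i] :=
  (\int[lebesgue_tuple R n]_t complex.Re (f (\row_i tnth t i)))%R +i*
  (\int[lebesgue_tuple R n]_t complex.Im (f (\row_i tnth t i)))%R.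

Definition partial (k : 'I_n) f : 'rV[R]_n -> R[i] := fun x =>
  ('D_(delta_mx 0 k) (fun y => complex.Re (f y)) x) +i*
  ('D_(delta_mx 0 k) (fun y => complex.Im (f y)) x).

Definition partials (s : seq 'I_n) f : 'rV[R]_n -> R[i] := foldr partial f s.

Definition smooth f := forall (s : seq 'I_n) (x : 'rV[R]_n),
  differentiable (fun y => complex.Re (partials s f y)) x /\
  differentiable (fun y => complex.Im (partials s f y)) x.

(* [M] bounds the [N]-th Schwartz seminorm of [f] *)
Definition seminorm_le (N : nat) f (M : R) :=
  forall s : seq 'I_n, (size s <= N)%N -> forall x : 'rV[R]_n,
    ((1 + `|x|) ^+ N)%:C * `|partials s f x| <= M%:C.

Definition schwartz f := smooth f /\ forall N, exists M, seminorm_le N f M.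

(* Distributions are functionals on all functions, of which only the values at
   Schwartz functions are meaningful. *)
Definition distr := ('rV[R]_n -> R[i]) -> R[i].

Definition eq_distr (T1 T2 : distr) := forall f, schwartz f -> T1 f = T2 f.

Definition tempered (T : distr) :=
  (forall (a : R[i]) f g, schwartz f -> schwartz g ->
     T (fun x => a * f x + g x) = a * T f + T g) /\
  (exists (N : nat) (c : R), forall f M,
     schwartz f -> seminorm_le N f M -> `|T f| <= (c * M)%:C).

Definition distr_fun (u : 'rV[R]_n -> R[i]) : distr :=
  fun f => cintegral (fun x => u x * f x).

Definition distr_add (T1 T2 : distr) : distr := fun f => T1 f + T2 f.
Definition distr_scale (a : R[i]) (T : distr) : distr := fun f => a * T f.
Definition distr_partial (k : 'I_n) (T : distr) : distr :=
  fun f => - T (partial k f).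
Definition distr_mulx (k : 'I_n) (T : distr) : distr :=
  fun f => T (fun x => (x ord0 k)%:C * f x).
Definition distr_laplacian (T : distr) : distr :=
  fun f => \sum_(k < n) distr_partial k (distr_partial k T) f.

End Schwartz.

(* Functions and families on C^2; [differentiable] is over the scalars R[i],
   that is, complex Frechet differentiability. *)
Section Meromorphic.
Variables (R : realType) (n : nat).
Implicit Types (U : set (R[i]^o * R[i]^o)).

Definition holomorphic U (h : R[i]^o * R[i]^o -> R[i]^o) :=
  forall p, U p -> differentiable h p.

Definition holomorphic_family U (T : R[i] -> R[i] -> distr R n) :=
  (forall p, U p -> tempered (T p.1 p.2)) /\
  (forall f, schwartz f -> holomorphic U (fun p => T p.1 p.2 f)).

(* holomorphic and not identically zero on any nonempty open subset *)
Definition denominator U (h : R[i]^o * R[i]^o -> R[i]^o) :=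
  holomorphic U h /\ U `<=` closure (U `&` [set p | h p != 0]).

(* Locally a quotient of a holomorphic family by a scalar denominator; the
   values of [T] on the zero set of the denominator are irrelevant. *)
Definition meromorphic_family (T : R[i] -> R[i] -> distr R n) :=
  forall p0 : R[i]^o * R[i]^o, exists U h (G : R[i] -> R[i] -> distr R n),
    [/\ open_nbhs p0 U, denominator U h, holomorphic_family U G &
     forall p, U p -> h p != 0 ->
       eq_distr (T p.1 p.2) (distr_scale (h p)^-1 (G p.1 p.2))].

(* Equality as meromorphic families: locally, off the zero set of some
   denominator. *)
Definition eq_meromorphic (T1 T2 : R[i] -> R[i] -> distr R n) :=
  forall p0 : R[i]^o * R[i]^o, exists U h,
    [/\ open_nbhs p0 U, denominator U h &
     forall p, U p -> h p != 0 -> eq_distr (T1 p.1 p.2) (T2 p.1 p.2)].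

End Meromorphic.

Section Kernels.
(* The dimension is n = d.+1, and the last coordinate x_n is [x ord0 ord_max]. *)
Variables (R : realType) (d : nat).

(* principal power of t > 0; at t = 0, reached below only on a null set, the
   value is junk *)
Definition cpow (t : R) (z : R[i]) : R[i] :=
  (expR (complex.Re z * ln t))%:C *
  (cos (complex.Im z * ln t) +i* sin (complex.Im z * ln t)).

(* [true] stands for K^+ and [false] for K^- *)
Definition kernel (s : bool) (lam nu : R[i]) (x : 'rV[R]_d.+1) : R[i] :=
  (if s then 1 else (Num.sg (x ord0 ord_max))%:C) *
  cpow `|x ord0 ord_max| (lam + nu - d.+1%:R) *
  cpow (\sum_(i < d.+1) x ord0 i ^+ 2) (- nu).

Definition kernel_family (s : bool) (T : R[i] -> R[i] -> distr R d.+1) :=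
  meromorphic_family T /\
  forall lam nu : R[i],
    d%:R < complex.Re (lam + nu) -> 0 < complex.Re (lam - nu) ->
    eq_distr (T lam nu) (distr_fun (kernel s lam nu)).

Definition shiftP (lam : R[i]) (T : distr R d.+1) : distr R d.+1 :=
  distr_add (distr_mulx ord_max (distr_laplacian T))
    (distr_scale (- (2 * lam - d.+1%:R - 2)) (distr_partial ord_max T)).

End Kernels.

(* Main.v *)
(** Write [a = lam + nu - n] and [b = - nu]. When [Re a] and [Re b] are large, the
    kernels [sgn^e(x_n) |x_n|^a |x|^(2b)] are C^2 functions of polynomial growth.
    There the Leibniz rule gives, pointwise,
      [P(mu) K^+-_{lam,nu} = a (lam + nu - 2 mu + 1) K^-+_{lam-1,nu}
                             + 2 nu (2 mu - 2 lam) K^-+_{lam,nu+1}],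
    and integration by parts against Schwartz functions turns this into an
    identity of distributions; both claims are the cases where one of the two
    terms vanishes. Both sides are meromorphic in [(lam, nu)], so the identity
    propagates to C^2 along complex lines.

    The identity theorem used for this has to start from complex
    differentiability at every point. Goursat's bisection yields a primitive,
    which is twice complex differentiable, so that its real part obeys the weak
    maximum principle by the second derivative test. If a function vanishes near
    [0], so does its primitive [G], and the maximum principle for [G / z^k], for
    all [k], forces [G = 0]. *)

Require Import Defs.
From HB Require Import structures.
From mathcomp Require Import all_boot all_order all_algebra.
From mathcomp Require Import complex.
From mathcomp Require Import all_classical all_reals all_analysis.
From mathcomp Require Import measurable_realfun ring lra zify.

Set Implicit Arguments.
Unset Strict Implicit.
Unset Printing Implicit Defensive.

Import Order.TTheory GRing.Theory Num.Theory numFieldNormedType.Exports.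

Local Open Scope classical_set_scope.
Local Open Scope ring_scope.

(** The continuation needs a radius of uniqueness that depends only on where a function is
    holomorphic, never on how small the set is where it is known to vanish. Otherwise the good
    points of a segment would form an open set that need not be closed. Hence the fixed ratios
    [r / 4] and [r / 5] below. Since [P] acts on test functions by transposition, a family is
    continued one Schwartz function at a time, with denominators common to all of them. Both
    identities are treated together by keeping the parameter [mu] of [P(mu)] independent of [lam]
    until the very end. The starting region is Re(lam + nu) >= n + 4 and Re(- nu) >= 4. It lies
    inside the domain of convergence, and there the first two derivatives of the kernel are
    continuous even across x_n = 0, so that integration by parts produces no singular
    contribution. *)

Section DerivativeEpsilonDelta.
Context {K : numFieldType}.

(** Stated over any [numFieldType] so as to serve the real and the complex derivative alike. The
    point [h = 0] may be included because the remainder vanishes there. *)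
Lemma is_derive1_epsP (f : K^o -> K^o) (x l : K^o) :
  is_derive x 1 f l <->
  (forall e : K, 0 < e -> exists2 d : K, 0 < d & forall h : K, `|h| < d ->
     `|f (x + h) - f x - l * h| <= e * `|h|).
Proof.
split=> [fx e e0|H].
  have [fd fl] := fx.
  have : (fun h => h^-1 *: ((f \o shift x) (h *: (1 : K^o)) - f x)) h @[h --> 0^'] --> l.
    by rewrite -fl; exact: fd.
  move/cvgrPdist_le => /(_ _ e0).
  move/nbhs_ballP => [d /= d0 Hd]; exists d => // h hd.
  have [->|h0] := eqVneq h 0.
    by rewrite addr0 subrr mulr0 subrr normr0 mulr0.
  have := Hd h; rewrite /ball /= sub0r normrN => /(_ hd h0).
  rewrite /shift /= /GRing.scale /= mulr1 (addrC h x) => Hh.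
  have -> : f (x + h) - f x - l * h = - (h * (l - h^-1 * (f (x + h) - f x))).
    by rewrite mulrBr mulrA divff// mul1r opprB (mulrC h).
  by rewrite normrN normrM mulrC ler_pM2r ?normr_gt0.
suff fl : (fun h => h^-1 *: ((f \o shift x) (h *: (1 : K^o)) - f x)) h @[h --> 0^'] --> l.
  split; first by apply/cvg_ex; exists l.
  by apply: cvg_lim.
apply/cvgrPdist_le => e e0.
have [d d0 Hd] := H _ e0.
apply/nbhs_ballP; exists d => //= h; rewrite /ball /= sub0r normrN => hd h0.
have := Hd h hd.
rewrite /shift /= /GRing.scale /= mulr1 (addrC h x).
have -> : f (x + h) - f x - l * h = - (h * (l - h^-1 * (f (x + h) - f x))).
  by rewrite mulrBr mulrA divff// mul1r opprB (mulrC h).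
by rewrite normrN normrM mulrC ler_pM2r ?normr_gt0.
Qed.

Lemma is_derive1_inv (x : K^o) : x != 0 ->
  is_derive x 1 (fun z : K^o => z^-1 : K^o) (- x^-1 ^+ 2 : K^o).
Proof.
move=> x0; apply/is_derive1_epsP => e e0.
have nx0 : 0 < `|x| by rewrite normr_gt0.
(* The first bound keeps [|x + h|] at least [|x| / 2]; the second then makes the remainder
   [h ^+ 2 / (x ^+ 2 * (x + h))] at most [e * |h|] in norm. The order of [K] is partial, so the two
   bounds have to be shown comparable. *)
pose d := Num.min (`|x| / 2) (e * `|x| ^+ 3 / 2).
have cmp : (`|x| / 2) >=< (e * `|x| ^+ 3 / 2).
  by apply: real_comparable; apply: gtr0_real; rewrite ?divr_gt0 ?mulr_gt0 ?exprn_gt0.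
exists d; first by rewrite /d comparable_lt_min// !divr_gt0 ?mulr_gt0 ?exprn_gt0.
move=> h; rewrite /d comparable_lt_min// => /andP[h1 h2].
have xh : `|x| / 2 <= `|x + h|.
  have := lerB_dist x (- h); rewrite opprK normrN; apply: le_trans.
  rewrite lerBrDl addrC -lerBrDl.
  by apply: le_trans (ltW h1) _; rewrite {2}(splitr `|x|) addrK.
have xh0 : x + h != 0.
  by rewrite -normr_gt0; apply: lt_le_trans xh; rewrite divr_gt0.
have -> : (x + h)^-1 - x^-1 - - x^-1 ^+ 2 * h = h * (h / (x ^+ 2 * (x + h))).
  by field; rewrite x0 xh0.
rewrite normrM [leRHS]mulrC ler_wpM2l// normrM normfV normrM normrX.
rewrite ler_pdivrMr ?mulr_gt0 ?exprn_gt0 ?normr_gt0//.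
apply: le_trans (ltW h2) _.
rewrite [leLHS](_ : _ = e * (`|x| ^+ 2 * (`|x| / 2))).
  by rewrite !ler_wpM2l// ?exprn_ge0 // ltW.
by rewrite exprSr -!mulrA.
Qed.

End DerivativeEpsilonDelta.

(** * Closed forms with pointwise differentiable coefficients are exact *)

Section ClosedForms.
Context {R : realType}.

Lemma nested_segments (a b : nat -> R) :
  (forall n, a n <= a n.+1) -> (forall n, b n.+1 <= b n) ->
  (forall n, a n <= b n) -> exists x, forall n, a n <= x <= b n.
Proof.
move=> a_nd b_ni ab.
have a_mono m n : (m <= n)%N -> a m <= a n.
  by move/subnK <-; elim: (n - m)%N => // k IH; apply: le_trans IH _; rewrite addSn.
have b_mono m n : (m <= n)%N -> b n <= b m.
  by move/subnK <-; elim: (n - m)%N => // k IH; rewrite addSn; apply: le_trans (b_ni _) IH.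
have amb m n : a m <= b n.
  have [mn|/ltnW nm] := leqP m n; first exact: le_trans (a_mono _ _ mn) (ab n).
  exact: le_trans (ab m) (b_mono _ _ nm).
have bnd n : ubound (range a) (b n) by move=> _ [m _ <-].
exists (sup (range a)) => n; apply/andP; split.
  by apply: ub_le_sup; [exists (b 0%N)|exists n].
by apply: ge_sup => //; exists (a 0%N); exists 0%N.
Qed.

Lemma continuous_primitive (f : R -> R) (a b : R) :
  (forall x, a <= x <= b -> {for x, continuous f}) ->
  exists F : R -> R, forall x, a < x < b -> is_derive x 1 F (f x).
Proof.
move=> cf; exists (fun x => \int[lebesgue_measure]_(t in `[a, x]) f t)%R => x /andP[ax xb].
have int : lebesgue_measure.-integrable `[a, b] (EFin \o f).
  apply: continuous_compact_integrable; first exact: segment_compact.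
  apply: continuous_in_subspaceT => y; rewrite inE /= in_itv /=; exact: cf.
have cx : {for x, continuous f} by apply: cf; rewrite !ltW.
have [? <-] := continuous_FTC1_closed xb int ax cx.
by rewrite derive1E; split.
Qed.

Lemma derive_increment_le (F f : R -> R) (a b k : R) : a <= b ->
  (forall x, a <= x <= b -> is_derive x 1 F (f x)) ->
  (forall x, a <= x <= b -> `|f x| <= k) ->
  `|F b - F a| <= k * (b - a).
Proof.
move=> ab dF fk.
have [||x] := @MVT_segment R F f a b ab.
- by move=> x; rewrite in_itv /= => /andP[ax xb]; apply: dF; rewrite !ltW.
- apply: continuous_in_subspaceT => y; rewrite inE /= in_itv /= => /dF [Fy _].
  by apply: differentiable_continuous; apply/derivable1_diffP.
rewrite in_itv /= => xab ->.
by rewrite normrM (ger0_norm (_ : 0 <= b - a)) ?subr_ge0// ler_wpM2r ?subr_ge0 ?fk.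
Qed.

(** Total differentiability at [(x0, y0)] with gradient [(p1, p2)], in a curried form that lets each
    variable be frozen separately. *)
Definition affine_approx (P : R -> R -> R) (x0 y0 p1 p2 : R) :=
  forall e : R, 0 < e -> exists2 d : R, 0 < d & forall x y, `|x - x0| < d -> `|y - y0| < d ->
    `|P x y - P x0 y0 - p1 * (x - x0) - p2 * (y - y0)| <= e * (`|x - x0| + `|y - y0|).

Lemma affine_approx_cont P x0 y0 p1 p2 e : affine_approx P x0 y0 p1 p2 -> 0 < e ->
  exists2 d, 0 < d & forall x y, `|x - x0| < d -> `|y - y0| < d ->
    `|P x y - P x0 y0| <= e.
Proof.
move=> H e0; have [d d0 Hd] := H 1 ltr01.
(* The [2] pays for the remainder, bounded by [|x - x0| + |y - y0|] for the choice [e = 1]; the rest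
   pays for the linear part. *)
pose M := 2 + `|p1| + `|p2|.
have M0 : 0 < M by rewrite /M -addrA ltr_pwDl // addr_ge0.
exists (Num.min d (e / M)); first by rewrite lt_min d0 divr_gt0.
move=> x y; rewrite !lt_min => /andP[xd xe] /andP[yd ye].
have := Hd x y xd yd; rewrite mul1r => H1.
have -> : P x y - P x0 y0 = (P x y - P x0 y0 - p1 * (x - x0) - p2 * (y - y0))
   + p1 * (x - x0) + p2 * (y - y0) by ring.
apply: le_trans (ler_normD _ _) _; rewrite normrM.
apply: le_trans (lerD (ler_normD _ _) (lexx _)) _; rewrite normrM.
apply: (@le_trans _ _ (M * (e / M))); last by rewrite mulrC divfK ?gt_eqF.
have -> : M * (e / M) = (e / M + e / M) + `|p1| * (e / M) + `|p2| * (e / M).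
  by rewrite /M; ring.
apply: lerD; last by rewrite ler_wpM2l// ltW.
apply: lerD; last by rewrite ler_wpM2l// ltW.
by apply: le_trans H1 _; rewrite lerD// ltW.
Qed.

Section Circulation.
Variables (P Q Phi Psi : R -> R -> R) (s : R).
(** The integral of P dx + Q dy along the boundary of [a, b] x [c, d], each edge integral being
    written as the increment of an antiderivative in one variable. *)
Let circ a b c d := (Phi b c - Phi a c) + (Psi b d - Psi b c)
  - (Phi b d - Phi a d) - (Psi a d - Psi a c).
Hypothesis dPhi : forall x y, `|x| <= s -> `|y| <= s ->
  is_derive (x : R) (1 : R) (Phi ^~ y : R -> R) (P x y).
Hypothesis dPsi : forall x y, `|x| <= s -> `|y| <= s -> is_derive (y : R) (1 : R)
  (Psi x : R -> R) (Q x y).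

(* The circulation of the affine part vanishes because the form is closed at
   [(x0, y0)], so only the error term contributes. *)
Lemma circulation_local x0 y0 p1 p2 q2 e :
  affine_approx P x0 y0 p1 p2 -> affine_approx Q x0 y0 p2 q2 -> 0 < e ->
  exists2 dl, 0 < dl & forall a b c d,
    - s <= a -> a <= x0 <= b -> b <= s -> - s <= c -> c <= y0 <= d -> d <= s ->
    b - a < dl -> d - c < dl ->
    `|circ a b c d| <= e * ((b - a) + (d - c)) ^+ 2.
Proof.
move=> aP aQ e0; have e20 : 0 < e / 2 by rewrite divr_gt0.
have [d1 d10 H1] := aP _ e20; have [d2 d20 H2] := aQ _ e20.
exists (Num.min d1 d2); first by rewrite lt_min d10.
move=> a b c d sa /andP[ax xb] bs sc /andP[cy yd] ds.
rewrite !lt_min => /andP[ba1 ba2] /andP[dc1 dc2].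
have ab : a <= b := le_trans ax xb.
have cd : c <= d := le_trans cy yd.
pose L := (b - a) + (d - c).
(* Subtracting an antiderivative of the affine part leaves a function whose derivative is the
   remainder of [P], to which the mean value inequality applies. *)
have hor y : c <= y <= d -> `|(Phi b y - Phi a y) - (P x0 y0 * (b - a)
    + p1 / 2 * ((b - x0) ^+ 2 - (a - x0) ^+ 2) + p2 * (y - y0) * (b - a))|
    <= e / 2 * L * (b - a).
  move=> /andP[cy' yd'].
  pose G x := Phi x y - (P x0 y0 * x + p1 / 2 * (x - x0) ^+ 2 + p2 * (y - y0) * x).
  have -> : (Phi b y - Phi a y) - (P x0 y0 * (b - a)
    + p1 / 2 * ((b - x0) ^+ 2 - (a - x0) ^+ 2) + p2 * (y - y0) * (b - a)) = G b - G a.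
    by rewrite /G; ring.
  apply: (derive_increment_le (f := fun x =>
     P x y - P x0 y0 - p1 * (x - x0) - p2 * (y - y0))) => // x /andP[ax' xb'].
    have /dPhi dx : `|x| <= s by clear -sa bs ax' xb'; rewrite ler_norml; lra.
    have {}dx := dx y ltac:(clear -sc ds cy' yd'; rewrite ler_norml; lra).
    by rewrite /G; apply: is_derive_eq; rewrite /GRing.scale /=; field.
  have nx : `|x - x0| <= b - a by clear -ax xb ax' xb'; rewrite ler_norml; lra.
  have ny : `|y - y0| <= d - c by clear -cy yd cy' yd'; rewrite ler_norml; lra.
  apply: le_trans (H1 _ _ (le_lt_trans nx ba1) (le_lt_trans ny dc1)) _.
  by rewrite ler_wpM2l ?lerD// ltW.
have ver x : a <= x <= b -> `|(Psi x d - Psi x c) - (Q x0 y0 * (d - c)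
    + q2 / 2 * ((d - y0) ^+ 2 - (c - y0) ^+ 2) + p2 * (x - x0) * (d - c))|
    <= e / 2 * L * (d - c).
  move=> /andP[ax' xb'].
  pose G y := Psi x y - (Q x0 y0 * y + q2 / 2 * (y - y0) ^+ 2 + p2 * (x - x0) * y).
  have -> : (Psi x d - Psi x c) - (Q x0 y0 * (d - c)
    + q2 / 2 * ((d - y0) ^+ 2 - (c - y0) ^+ 2) + p2 * (x - x0) * (d - c)) = G d - G c.
    by rewrite /G; ring.
  apply: (derive_increment_le (f := fun y =>
     Q x y - Q x0 y0 - p2 * (x - x0) - q2 * (y - y0))) => // y /andP[cy' yd'].
    have /dPsi dx : `|x| <= s by clear -sa bs ax' xb'; rewrite ler_norml; lra.
    have {}dx := dx y ltac:(clear -sc ds cy' yd'; rewrite ler_norml; lra).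
    by rewrite /G; apply: is_derive_eq; rewrite /GRing.scale /=; field.
  have nx : `|x - x0| <= b - a by clear -ax xb ax' xb'; rewrite ler_norml; lra.
  have ny : `|y - y0| <= d - c by clear -cy yd cy' yd'; rewrite ler_norml; lra.
  apply: le_trans (H2 _ _ (le_lt_trans nx ba2) (le_lt_trans ny dc2)) _.
  by rewrite ler_wpM2l ?lerD// ltW.
have cI : c <= c <= d by rewrite lexx.
have dI : c <= d <= d by rewrite lexx andbT.
have aI : a <= a <= b by rewrite lexx.
have bI : a <= b <= b by rewrite lexx andbT.
have := hor c cI; have := hor d dI; have := ver a aI; have := ver b bI.
rewrite /circ; move: (Phi b c - Phi a c) (Phi b d - Phi a d) (Psi b d - Psi b c)
  (Psi a d - Psi a c) => u1 u2 u3 u4.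
have -> : e * ((b - a) + (d - c)) ^+ 2 = 2 * (e / 2 * L * (b - a)) + 2 * (e / 2 * L * (d - c)).
  by rewrite /L; field.
move: (e / 2 * L * (b - a)) (e / 2 * L * (d - c)) => w1 w2.
set A := P x0 y0 * _; set B := p1 / 2 * _; set A' := Q x0 y0 * _; set B' := q2 / 2 * _.
(* The mixed terms of opposite edges differ by [p2] times the area of the rectangle, with opposite
   signs for the horizontal and the vertical pair. This is where the shared coefficient [p2]
   enters. *)
have e1 : p2 * (c - y0) * (b - a) = p2 * (d - y0) * (b - a) - p2 * ((d - c) * (b - a)) by ring.
have e2 : p2 * (b - x0) * (d - c) = p2 * (a - x0) * (d - c) + p2 * ((d - c) * (b - a)) by ring.
rewrite e1 e2; move: (p2 * (d - y0) * _) (p2 * (a - x0) * _) (p2 * (_ * _)) => t1 t2 t3.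
clear; rewrite !ler_norml; lra.
Qed.

Hypothesis closed_form : forall x0 y0, `|x0| <= s -> `|y0| <= s -> exists p1 p2 q2,
  affine_approx P x0 y0 p1 p2 /\ affine_approx Q x0 y0 p2 q2.

(** Goursat's bisection: halving both sides divides the squared half perimeter by four, so if the
    bound fails on a rectangle it fails on one of its quarters. The quarters shrink to a point,
    where [circulation_local] gives the contradiction. *)
Lemma circulation_bound e a b c d : 0 < e ->
  - s <= a -> a <= b -> b <= s -> - s <= c -> c <= d -> d <= s ->
  `|circ a b c d| <= e * ((b - a) + (d - c)) ^+ 2.
Proof.
move=> e0 sa0 ab0 bs0 sc0 cd0 ds0; rewrite leNgt; apply/negP => bad0.
pose T := (R * R * (R * R))%type.
pose bad (t : T) := [/\ - s <= t.1.1, t.1.1 <= t.1.2, t.1.2 <= s &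
  [/\ - s <= t.2.1, t.2.1 <= t.2.2, t.2.2 <= s &
  e * ((t.1.2 - t.1.1) + (t.2.2 - t.2.1)) ^+ 2 < `|circ t.1.1 t.1.2 t.2.1 t.2.2| ]].
pose half (u v : R * R) := [/\ u.1 <= v.1, v.2 <= u.2 & v.2 - v.1 = (u.2 - u.1) / 2].
(* The assumption [bad t] sits inside the existential so that choice yields a total function, which
   can be iterated. *)
have step (t : T) : exists t' : T, bad t -> [/\ bad t', half t.1 t'.1 & half t.2 t'.2].
  have [bt|nbt] := pselect (bad t); last by exists t.
  move: t bt => [[a1 b1] [c1 d1]] [/= sa ab bs [sc cd ds H]].
  pose m := (a1 + b1) / 2; pose n := (c1 + d1) / 2.
  have split4 : circ a1 b1 c1 d1 =
    circ a1 m c1 n + circ m b1 c1 n + circ a1 m n d1 + circ m b1 n d1.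
    by rewrite /circ; ring.
  have [h|h1] := ltP (e * ((m - a1) + (n - c1)) ^+ 2) `|circ a1 m c1 n|.
    exists ((a1, m), (c1, n)) => _; rewrite /m /n in h *.
    by split; rewrite /bad /half /=; (do ?split) => //; clear -sa ab bs sc cd ds; lra.
  have [h|h2] := ltP (e * ((b1 - m) + (n - c1)) ^+ 2) `|circ m b1 c1 n|.
    exists ((m, b1), (c1, n)) => _; rewrite /m /n in h *.
    by split; rewrite /bad /half /=; (do ?split) => //; clear -sa ab bs sc cd ds; lra.
  have [h|h3] := ltP (e * ((m - a1) + (d1 - n)) ^+ 2) `|circ a1 m n d1|.
    exists ((a1, m), (n, d1)) => _; rewrite /m /n in h *.
    by split; rewrite /bad /half /=; (do ?split) => //; clear -sa ab bs sc cd ds; lra.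
  have [h|h4] := ltP (e * ((b1 - m) + (d1 - n)) ^+ 2) `|circ m b1 n d1|.
    exists ((m, b1), (n, d1)) => _; rewrite /m /n in h *.
    by split; rewrite /bad /half /=; (do ?split) => //; clear -sa ab bs sc cd ds; lra.
  exfalso; move: H; rewrite ltNge => /negP; apply.
  rewrite split4; apply: le_trans (ler_normD _ _) _.
  apply: le_trans (lerD (ler_normD _ _) (lexx _)) _.
  apply: le_trans (lerD (lerD (ler_normD _ _) (lexx _)) (lexx _)) _.
  apply: le_trans (lerD (lerD (lerD h1 h2) h3) h4) _.
  rewrite -!mulrDr ler_pM2l// /m /n.
  by rewrite le_eqVlt; apply/orP; left; apply/eqP; field.
have [next Hnext] := boolp.choice step.
pose t n := iter n next ((a, b), (c, d)).
have bt n : bad (t n).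
  elim: n => [|n IH]; first by rewrite /bad /=; (do ?split).
  by have [] := Hnext _ IH.
have ht n : half (t n).1 (t n.+1).1 /\ half (t n).2 (t n.+1).2.
  by have [] := Hnext _ (bt n).
have [x0 Hx] : exists x, forall n, (t n).1.1 <= x <= (t n).1.2.
  by apply: nested_segments => n; case: (ht n) => [[]] //; case: (bt n).
have [y0 Hy] : exists x, forall n, (t n).2.1 <= x <= (t n).2.2.
  by apply: nested_segments => n; case: (ht n) => [_ []] //; case: (bt n) => _ _ _ [].
have x0s : `|x0| <= s by rewrite ler_norml; have := Hx 0%N; rewrite /=; lra.
have y0s : `|y0| <= s by rewrite ler_norml; have := Hy 0%N; rewrite /=; lra.
have [p1 [p2 [q2 [aP aQ]]]] := closed_form x0s y0s.
have [dl dl0 Hdl] := circulation_local aP aQ e0.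
have len1 n : (t n).1.2 - (t n).1.1 = (b - a) / 2 ^+ n.
  elim: n => [|n IH]; first by rewrite /= expr0 divr1.
  by have [[_ _ ->] _] := ht n; rewrite IH exprSr invfM mulrA.
have len2 n : (t n).2.2 - (t n).2.1 = (d - c) / 2 ^+ n.
  elim: n => [|n IH]; first by rewrite /= expr0 divr1.
  by have [_ [_ _ ->]] := ht n; rewrite IH exprSr invfM mulrA.
have [n Hn] : exists n, ((b - a) + (d - c)) / 2 ^+ n < dl.
  (* [N.+1] exceeds the ratio to be beaten, and [2 ^ N.+1] exceeds [N.+1]. *)
  pose N := Num.truncn (((b - a) + (d - c)) / dl).
  exists N.+1; rewrite ltr_pdivrMr ?exprn_gt0// mulrC -ltr_pdivrMr//.
  apply: lt_le_trans (truncnS_gt _) _.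
  by rewrite -natrX ler_nat ltnW// ltn_expl.
have [sa ab bs [sc cd ds]] := bt n; rewrite ltNge => /negP; apply.
apply: Hdl => //; rewrite ?len1 ?len2; apply: le_lt_trans Hn;
  rewrite ler_pM2r ?invr_gt0 ?exprn_gt0 //.
  by rewrite lerDl subr_ge0.
by rewrite lerDr subr_ge0.
Qed.

Lemma circulation0 a b c d : `|a| <= s -> `|b| <= s -> `|c| <= s -> `|d| <= s ->
  circ a b c d = 0.
Proof.
wlog ab : a b / a <= b.
  move=> H; have [/H//|/ltW/H {}H] := leP a b => ha hb hc hd.
  by have := H hb ha hc hd; rewrite /circ; lra.
wlog cd : c d / c <= d.
  move=> H; have [/H//|/ltW/H {}H] := leP c d => ha hb hc hd.
  by have := H ha hb hd hc; rewrite /circ; lra.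
rewrite !ler_norml => /andP[h1 h2] /andP[h3 h4] /andP[h5 h6] /andP[h7 h8].
apply/eqP; rewrite -normr_le0; apply/ler_addgt0Pl => e e0; rewrite addr0.
(* The added [1] keeps [L] positive for a degenerate rectangle. *)
pose L := ((b - a) + (d - c)) ^+ 2 + 1.
have L0 : 0 < L by rewrite /L ltr_wpDl ?sqr_ge0.
apply: le_trans (circulation_bound (e := e / L) _ _ _ _ _ _ _) _ => //.
  by rewrite divr_gt0.
rewrite mulrAC ler_pdivrMr// ler_pM2l// /L; lra.
Qed.

End Circulation.

(** The potential is the integral along a two-edge path from the origin. The path ending vertically
    shows the derivative in [y], the one ending horizontally the derivative in [x], and
    [circulation0] identifies the two. *)
Lemma closed_form_exact (P Q : R -> R -> R) (r s : R) : 0 < s -> s < r ->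
  (forall x0 y0, `|x0| < r -> `|y0| < r -> exists p1 p2 q2,
     affine_approx P x0 y0 p1 p2 /\ affine_approx Q x0 y0 p2 q2) ->
  exists F : R -> R -> R, forall x y, `|x| < s -> `|y| < s ->
    is_derive (x : R) (1 : R) (F ^~ y : R -> R) (P x y) /\ is_derive (y : R) (1 : R)
      (F x : R -> R) (Q x y).
Proof.
(* [continuous_primitive] differentiates at interior points only, so the antiderivatives are taken
   on a larger segment, of half-length [s'], on which [P] and [Q] are still continuous. *)
move=> s0 sr cl; pose s' := (s + r) / 2.
have [Phi dPhi] : exists Phi : R -> R -> R, forall y x, `|x| <= s -> `|y| <= s ->
    is_derive (x : R) (1 : R) (Phi y : R -> R) (P x y).
  suff /boolp.choice [Phi HPhi] : forall y : R, exists Phi : R -> R, forall x : R,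
      `|x| <= s -> `|y| <= s -> is_derive (x : R) (1 : R) (Phi : R -> R) (P x y).
    by exists Phi.
  move=> y.
  have [ys|ys] := leP `|y| s; last by exists id.
  have [|F HF] := @continuous_primitive (P ^~ y) (- s') s'.
    move=> x xs; have [||p1 [p2 [q2 [aP _]]]] := cl x y.
    - by rewrite ltr_norml; rewrite /s' in xs; lra.
    - lra.
    apply/cvgrPdist_le => e e0.
    have [d d0 Hd] := affine_approx_cont aP e0.
    apply/nbhs_ballP; exists d => //= z; rewrite /ball /= => xz.
    by rewrite distrC; apply: Hd; rewrite ?subrr ?normr0// distrC.
  by exists F => x xs _; apply: HF; move: xs; rewrite ler_norml /s'; lra.
have [Psi dPsi] : exists Psi : R -> R -> R, forall x y, `|x| <= s -> `|y| <= s ->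
    is_derive (y : R) (1 : R) (Psi x : R -> R) (Q x y).
  suff /boolp.choice [Psi HPsi] : forall x : R, exists Psi : R -> R, forall y : R,
      `|x| <= s -> `|y| <= s -> is_derive (y : R) (1 : R) (Psi : R -> R) (Q x y).
    by exists Psi.
  move=> x.
  have [xs|xs] := leP `|x| s; last by exists id => y; lra.
  have [|F HF] := @continuous_primitive (Q x) (- s') s'.
    move=> y ys; have [||p1 [p2 [q2 [_ aQ]]]] := cl x y.
    - lra.
    - by rewrite ltr_norml; rewrite /s' in ys; lra.
    apply/cvgrPdist_le => e e0.
    have [d d0 Hd] := affine_approx_cont aQ e0.
    apply/nbhs_ballP; exists d => //= z; rewrite /ball /= => xz.
    by rewrite distrC; apply: Hd; rewrite ?subrr ?normr0// distrC.
  by exists F => y _ ys; apply: HF; move: ys; rewrite ler_norml /s'; lra.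
have c0 x y : `|x| <= s -> `|y| <= s ->
    (Phi 0 x - Phi 0 0) + (Psi x y - Psi x 0) = (Phi y x - Phi y 0) + (Psi 0 y - Psi 0 0).
  move=> xs ys.
  have /= := @circulation0 P Q (fun x y => Phi y x) Psi s (fun x y hx hy => dPhi y x hx hy)
    dPsi _ 0 x 0 y; rewrite normr0 => H.
  have {H} := H (fun x0 y0 h1 h2 => cl x0 y0 (le_lt_trans h1 sr) (le_lt_trans h2 sr))
    (ltW s0) xs (ltW s0) ys.
  lra.
exists (fun x y => (Phi 0 x - Phi 0 0) + (Psi x y - Psi x 0)) => x y xs ys; split.
  apply: (@near_eq_is_derive _ _ _ (fun x => (Phi y x - Phi y 0) + (Psi 0 y - Psi 0 0))).
    apply/nbhs_ballP; exists (s - `|x|); first by rewrite /= subr_gt0.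
    move=> z; rewrite /ball /= => xz; rewrite c0// ltW//.
    have := ler_normB x (x - z); rewrite opprB addrC subrK; lra.
  have dx := dPhi y x (ltW xs) (ltW ys).
  by apply: is_derive_eq; rewrite subr0 addr0.
have dy := dPsi x y (ltW xs) (ltW ys).
by apply: is_derive_eq; rewrite add0r mul1r subr0.
Qed.

End ClosedForms.

(** * Complex derivatives as pairs of real differentials; primitives *)

Section ComplexDerivative.
Context {R : realType}.
Local Open Scope complex_scope.
Local Notation Re := complex.Re.
Local Notation Im := complex.Im.

Lemma normc_ge_Im (z : R[i]) : `|Im z|%:C <= `|z|.
Proof. by rewrite normc_def lecR -sqrtr_sqr ler_wsqrtr// lerDr sqr_ge0. Qed.

Lemma normc_le_ReIm (z : R[i]) : `|z| <= (`|Re z| + `|Im z|)%:C.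
Proof.
rewrite normc_def lecR -[leRHS]ger0_norm ?addr_ge0// -sqrtr_sqr ler_wsqrtr//.
by rewrite sqrrD !real_normK ?num_real// addrAC lerDl mulrn_wge0// mulr_ge0.
Qed.

Lemma gt0_complexE (e : R[i]) : 0 < e -> exists2 r : R, 0 < r & e = r%:C.
Proof.
by case: e => a b; rewrite ltcE /= => /andP[/eqP -> a0]; exists a.
Qed.

Lemma normcE (z : R[i]) : `|z| = (Re `|z|)%:C.
Proof. by rewrite normc_def. Qed.

Lemma is_derive1_epsC (f : R[i]^o -> R[i]^o) (z l : R[i]^o) :
  is_derive z 1 f l <->
  (forall e : R, 0 < e -> exists2 d : R, 0 < d & forall h : R[i], `|h| < d%:C ->
     `|f (z + h) - f z - l * h| <= e%:C * `|h|).
Proof.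
rewrite is_derive1_epsP; split=> H e e0.
  have [|d /gt0_complexE[r r0 ->] Hd] := H e%:C; first by rewrite ltcR.
  by exists r.
have [r r0 ->] := gt0_complexE e0; have [d d0 Hd] := H _ r0.
by exists d%:C; first rewrite ltcR.
Qed.

(** The Cauchy-Riemann equations: multiplication by [l] is the real matrix with rows
    [(Re l, - Im l)] and [(Im l, Re l)]. *)
Lemma affine_approx_Re (f : R[i]^o -> R[i]^o) (x y : R) (l : R[i]^o) :
  is_derive (x +i* y : R[i]^o) 1 f l ->
  affine_approx (fun x y => Re (f (x +i* y))) x y (Re l) (- Im l) /\
  affine_approx (fun x y => Im (f (x +i* y))) x y (Im l) (Re l).
Proof.
move=> /is_derive1_epsC H.
have key e : 0 < e -> exists2 d : R, 0 < d & forall x' y',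
    `|x' - x| < d -> `|y' - y| < d ->
    `|f (x' +i* y') - f (x +i* y) - l * ((x' - x) +i* (y' - y))|
      <= (e * (`|x' - x| + `|y' - y|))%:C.
  move=> e0; have [d d0 Hd] := H e e0.
  exists (d / 2); first by rewrite divr_gt0.
  move=> x' y' hx hy.
  have hle := normc_le_ReIm ((x' - x) +i* (y' - y)).
  have := Hd ((x' - x) +i* (y' - y)).
  have -> : (x +i* y) + ((x' - x) +i* (y' - y)) = x' +i* y'.
    by apply/eqP; rewrite eq_complex /= !addrA !(addrC _ x') !(addrC _ y') !addrK !eqxx.
  move=> H1; apply: le_trans (H1 _) _.
    by apply: le_lt_trans hle _; rewrite ltcR /=; lra.
  by rewrite rmorphM /= ler_wpM2l// lecR ltW.
split=> e e0; have [d d0 Hd] := key e e0; exists d => // x' y' hx hy.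
  rewrite -lecR; apply: le_trans (Hd _ _ hx hy); apply: le_trans (normc_ge_Re _).
  rewrite lecR; case: (f _) => a b; case: (f _) => a' b'; case: l {H key Hd} => p q /=.
  by rewrite le_eqVlt; apply/orP; left; apply/eqP; congr `|_|; ring.
rewrite -lecR; apply: le_trans (Hd _ _ hx hy); apply: le_trans (normc_ge_Im _).
rewrite lecR; case: (f _) => a b; case: (f _) => a' b'; case: l {H key Hd} => p q /=.
by rewrite le_eqVlt; apply/orP; left; apply/eqP; congr `|_|; ring.
Qed.

Lemma affine_approx_is_derive (F1 F2 : R -> R -> R) (x y p q : R) :
  affine_approx F1 x y p (- q) -> affine_approx F2 x y q p ->
  is_derive (x +i* y : R[i]^o) 1
    (fun z : R[i]^o => F1 (Re z) (Im z) +i* F2 (Re z) (Im z) : R[i]^o) (p +i* q : R[i]^o).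
Proof.
move=> H1 H2; apply/is_derive1_epsC => e e0.
(* Each of the two components may use half of [e], and [|Re h| + |Im h| <= 2 * |h|] costs another
   factor [2]. *)
have e40 : 0 < e / 4 by rewrite divr_gt0.
have [d1 d10 Hd1] := H1 _ e40; have [d2 d20 Hd2] := H2 _ e40.
exists (Num.min d1 d2); first by rewrite lt_min d10.
move=> h; rewrite normcE ltcR lt_min => /andP[h1 h2].
have hr : `|Re h| <= Re `|h| by rewrite -lecR -normcE normc_ge_Re.
have hi : `|Im h| <= Re `|h| by rewrite -lecR -normcE normc_ge_Im.
apply: le_trans (normc_le_ReIm _) _; rewrite -rmorphM /= lecR.
have A1 := Hd1 (x + Re h) (y + Im h); have A2 := Hd2 (x + Re h) (y + Im h).
have xr : x + Re h - x = Re h by ring.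
have yr : y + Im h - y = Im h by ring.
rewrite xr yr in A1 A2.
have {}A1 := A1 (le_lt_trans hr h1) (le_lt_trans hi h1).
have {}A2 := A2 (le_lt_trans hr h2) (le_lt_trans hi h2).
have le2 : e / 4 * (`|Re h| + `|Im h|) <= e / 2 * Re `|h|.
  rewrite (_ : e / 2 * _ = e / 4 * (Re `|h| + Re `|h|)); last by field.
  by rewrite ler_wpM2l ?lerD// ltW.
rewrite (_ : e * Re `|h| = e / 2 * Re `|h| + e / 2 * Re `|h|); last by field.
apply: lerD; [apply: le_trans le2; apply: le_trans A1|apply: le_trans le2; apply: le_trans A2].
  case: h {A2 h1 h2 hr hi xr yr} => a b /=.
  by rewrite le_eqVlt; apply/orP; left; apply/eqP; congr `|_|; ring.
case: h {A1 h1 h2 hr hi xr yr} => a b /=.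
by rewrite le_eqVlt; apply/orP; left; apply/eqP; congr `|_|; ring.
Qed.

Lemma derive_increment_dist (F f : R -> R) (a b k : R) :
  (forall t, `|t - a| <= `|b - a| -> is_derive (t : R) (1 : R) F (f t)) ->
  (forall t, `|t - a| <= `|b - a| -> `|f t| <= k) -> `|F b - F a| <= k * `|b - a|.
Proof.
move=> dF fk; have [ab|/ltW ba] := leP a b.
  rewrite (ger0_norm (_ : 0 <= b - a)) ?subr_ge0//.
  by apply: derive_increment_le ab _ _ => t tab; [apply: dF|apply: fk];
    rewrite !ger0_norm; lra.
rewrite (distrC (F b)) (distrC b) (ger0_norm (_ : 0 <= a - b)) ?subr_ge0//.
by apply: derive_increment_le ba _ _ => t tab; [apply: dF|apply: fk];
  rewrite !ler0_norm; lra.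
Qed.

(** Continuity of both partial derivatives at the point gives total differentiability: go vertically
    above [x0], then horizontally at height [y], and apply the mean value inequality to each leg. *)
Lemma potential_affine_approx (F P Q : R -> R -> R) (s x0 y0 : R) :
  `|x0| < s -> `|y0| < s ->
  (forall x y, `|x| < s -> `|y| < s ->
    is_derive (x : R) (1 : R) (F ^~ y : R -> R) (P x y) /\
    is_derive (y : R) (1 : R) (F x : R -> R) (Q x y)) ->
  (forall e : R, 0 < e -> exists2 d : R, 0 < d & forall x y, `|x - x0| < d -> `|y - y0| < d ->
     `|P x y - P x0 y0| <= e) ->
  (forall e : R, 0 < e -> exists2 d : R, 0 < d & forall x y, `|x - x0| < d -> `|y - y0| < d ->
     `|Q x y - Q x0 y0| <= e) ->
  affine_approx F x0 y0 (P x0 y0) (Q x0 y0).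
Proof.
move=> x0s y0s dF cP cQ e e0.
have [d1 d10 H1] := cP e e0; have [d2 d20 H2] := cQ e e0.
pose d3 := Num.min (s - `|x0|) (s - `|y0|).
exists (Num.min d3 (Num.min d1 d2)); first by rewrite !lt_min d10 d20 !subr_gt0 x0s y0s.
move=> x y; rewrite !lt_min => /andP[/andP[xs _] /andP[xd1 xd2]].
move=> /andP[/andP[_ ys] /andP[yd1 yd2]].
have ins (t u c : R) : `|c| < s -> `|u - c| < s - `|c| -> `|t - c| <= `|u - c| -> `|t| < s.
  by move=> ? ? ?; have := ler_normD c (t - c); rewrite addrC subrK; lra.
have hx : `|(F x y - P x0 y0 * x) - (F x0 y - P x0 y0 * x0)| <= e * `|x - x0|.
  apply: (derive_increment_dist (F := fun t => F t y - P x0 y0 * t)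
    (f := fun t => P t y - P x0 y0)) => t tx.
    have [dx _] := dF t y (ins _ _ _ x0s xs tx) (ins _ _ _ y0s ys (lexx _)).
    by apply: is_derive_eq; rewrite /GRing.scale /= mulr1.
  by apply: H1 => //; apply: le_lt_trans tx xd1.
have hy : `|(F x0 y - Q x0 y0 * y) - (F x0 y0 - Q x0 y0 * y0)| <= e * `|y - y0|.
  apply: (derive_increment_dist (F := fun t => F x0 t - Q x0 y0 * t)
    (f := fun t => Q x0 t - Q x0 y0)) => t ty.
    have [_ dy] := dF x0 t x0s (ins _ _ _ y0s ys ty).
    by apply: is_derive_eq; rewrite /GRing.scale /= mulr1.
  by apply: H2; rewrite ?subrr ?normr0//; apply: le_lt_trans ty yd2.
rewrite [leRHS]mulrDr; apply: le_trans (lerD hx hy); apply: le_trans (ler_normD _ _).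
by rewrite le_eqVlt; apply/orP; left; apply/eqP; congr `|_|; ring.
Qed.

(** For f = u + iv the Cauchy-Riemann equations say that u dx - v dy and v dx + u dy are closed at
    every point; their potentials are the real and imaginary parts of the primitive. *)
Lemma holomorphic_primitive (f : R[i]^o -> R[i]^o) (r s : R) : 0 < s -> s < r ->
  (forall x y : R, `|x| < r -> `|y| < r -> derivable f (x +i* y : R[i]^o) 1) ->
  exists F : R[i]^o -> R[i]^o, forall x y : R, `|x| < s -> `|y| < s ->
    is_derive (x +i* y : R[i]^o) 1 F (f (x +i* y)).
Proof.
move=> s0 sr df.
have aff x y : `|x| < r -> `|y| < r -> exists l : R[i],
  affine_approx (fun x y => Re (f (x +i* y))) x y (Re l) (- Im l) /\
  affine_approx (fun x y => Im (f (x +i* y))) x y (Im l) (Re l).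
  move=> xr yr; exists ('D_1 f (x +i* y : R[i]^o)); apply: affine_approx_Re.
  by apply: DeriveDef => //; apply: df.
have affN (P : R -> R -> R) x y p q :
    affine_approx P x y p q -> affine_approx (fun x y => - P x y) x y (- p) (- q).
  move=> H e e0; have [d d0 Hd] := H e e0; exists d => // x' y' hx hy.
  apply: le_trans (Hd x' y' hx hy); rewrite -[leRHS]normrN.
  by rewrite le_eqVlt; apply/orP; left; apply/eqP; congr `|_|; ring.
have [F1 HF1] : exists F : R -> R -> R, forall x y, `|x| < s -> `|y| < s ->
    is_derive (x : R) (1 : R) (F ^~ y : R -> R) (Re (f (x +i* y))) /\
    is_derive (y : R) (1 : R) (F x : R -> R) (- Im (f (x +i* y))).
  apply: (@closed_form_exact _ (fun x y => Re (f (x +i* y)))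
    (fun x y => - Im (f (x +i* y))) r s) => // x y xr yr.
  have [l [H1 H2]] := aff x y xr yr.
  by exists (Re l), (- Im l), (- Re l); split => //; apply: affN.
have [F2 HF2] : exists F : R -> R -> R, forall x y, `|x| < s -> `|y| < s ->
    is_derive (x : R) (1 : R) (F ^~ y : R -> R) (Im (f (x +i* y))) /\
    is_derive (y : R) (1 : R) (F x : R -> R) (Re (f (x +i* y))).
  apply: (@closed_form_exact _ (fun x y => Im (f (x +i* y)))
    (fun x y => Re (f (x +i* y))) r s) => // x y xr yr.
  have [l [H1 H2]] := aff x y xr yr.
  by exists (Im l), (Re l), (- Im l); split.
exists (fun z => F1 (Re z) (Im z) +i* F2 (Re z) (Im z)) => x y xs ys.
have [l [H1 H2]] := aff x y (lt_trans xs sr) (lt_trans ys sr).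
rewrite [X in is_derive _ _ _ X](_ : _ = Re (f (x +i* y)) +i* Im (f (x +i* y)));
  last by case: (f _).
apply: affine_approx_is_derive.
  apply: (potential_affine_approx (P := fun x y => Re (f (x +i* y)))
    (Q := fun x y => - Im (f (x +i* y))) xs ys HF1).
    by move=> e e0; exact: (affine_approx_cont H1 e0).
  by move=> e e0; exact: (affine_approx_cont (affN _ _ _ _ _ H2) e0).
apply: (potential_affine_approx (P := fun x y => Im (f (x +i* y)))
    (Q := fun x y => Re (f (x +i* y))) xs ys HF2).
  by move=> e e0; exact: (affine_approx_cont H2 e0).
by move=> e e0; exact: (affine_approx_cont H1 e0).
Qed.

End ComplexDerivative.

(** * The identity theorem *)

Section MaximumPrinciple.
Context {R : realType}.

(** At a maximum [u'] vanishes. If [l] were positive, [u'] would be positive just to the right of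
    [x], and the mean value theorem would make [u] exceed [u x]. *)
Lemma second_derivative_le0 (u u' : R -> R) (x l d : R) : 0 < d ->
  (forall t, `|t - x| < d -> is_derive (t : R) (1 : R) u (u' t)) ->
  is_derive (x : R) (1 : R) u' l ->
  (forall t, `|t - x| < d -> u t <= u x) -> l <= 0.
Proof.
move=> d0 du du' umax; rewrite leNgt; apply/negP => l0.
have u'x : u' x = 0.
  have dx := du x; rewrite subrr normr0 in dx; have {dx} [_ <-] := dx d0.
  have inb (t : R) : t \in `]x - d, x + d[ -> `|t - x| < d.
    by rewrite in_itv /= ltr_norml => ?; lra.
  have [|||t tb|_ -> //] := @derive1_at_max R u (x - d) (x + d) x.
  - lra.
  - by move=> t /inb /du [].
  - by rewrite in_itv /=; lra.
  - exact/umax/inb.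
(* With precision [l / 2], the value [u' c] is at least [l / 2 * (c - x)], hence positive, for [c]
   slightly beyond [x]. *)
have [e e0 He] := (is_derive1_epsP (u' : R^o -> R^o) x l).1 du' (l / 2) (divr_gt0 l0
  (ltr0Sn _ 1)).
pose h := Num.min d e / 2.
have hd : h < d by rewrite /h; case: (leP d e) => ?; lra.
have he : h < e by rewrite /h; case: (leP d e) => ?; lra.
have h0 : 0 < h by rewrite /h divr_gt0// lt_min d0.
have [|||c] := @MVT R u u' x (x + h); first by lra.
- by move=> t; rewrite in_itv /= => ?; apply: du; rewrite ltr_norml; lra.
- apply: continuous_in_subspaceT => t; rewrite inE /= in_itv /= => tx.
  have [|] := du t; first by rewrite ltr_norml; lra.
  by move=> ut _; apply: differentiable_continuous; apply/derivable1_diffP.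
rewrite in_itv /= => cx uh.
have ch : `|c - x| < e by rewrite ltr_norml; lra.
have := He _ ch; rewrite (addrC x) subrK u'x subr0 => {}He.
have := umax (x + h); rewrite (addrC x h) addrK gtr0_norm// => /(_ hd).
rewrite (addrC h) -subr_le0 uh pmulr_lle0; last by lra.
rewrite (ger0_norm (_ : 0 <= c - x)) in He; last by lra.
have cx0 : 0 < l / 2 * (c - x) by rewrite mulr_gt0 ?divr_gt0; lra.
have ll : l * (c - x) = l / 2 * (c - x) + l / 2 * (c - x) by field.
move: He; rewrite ler_norml ll; lra.
Qed.

Lemma affine_approx_derive1 (P : R -> R -> R) (x y p q : R) : affine_approx P x y p q ->
  is_derive (x : R) (1 : R) (P ^~ y : R -> R) p.
Proof.
move=> H; apply/(is_derive1_epsP (P ^~ y : R^o -> R^o) x p) => e e0.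
have [d d0 Hd] := H e e0; exists d => // h hd.
have := Hd (x + h) y; rewrite subrr normr0 mulr0 subr0 addr0 addrC addKr.
by rewrite [x + h]addrC; apply.
Qed.

Lemma affine_approx_derive2 (P : R -> R -> R) (x y p q : R) : affine_approx P x y p q ->
  is_derive (y : R) (1 : R) (P x : R -> R) q.
Proof.
move=> H; apply/(is_derive1_epsP (P x : R^o -> R^o) y q) => e e0.
have [d d0 Hd] := H e e0; exists d => // h hd.
have := Hd x (y + h); rewrite subrr normr0 mulr0 subr0 add0r addrC addKr.
by rewrite [y + h]addrC; apply.
Qed.

Definition square (s : R) : set (R * R) := `[- s, s]%classic `*` `[- s, s]%classic.

Lemma squareE (s : R) (p : R * R) : square s p <-> `|p.1| <= s /\ `|p.2| <= s.
Proof. by rewrite /square /setX /= !in_itv /= !ler_norml. Qed.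

Lemma compact_square (s : R) : compact (square s).
Proof. by apply: compact_setX; exact: segment_compact. Qed.

Lemma affine_approx_continuous (U : R -> R -> R) (x y p q : R) :
  affine_approx U x y p q -> {for (x, y), continuous (fun z : R * R => U z.1 z.2)}.
Proof.
move=> H; apply/cvgrPdist_le => e e0.
have [d d0 Hd] := affine_approx_cont H e0.
exists (ball x d, ball y d) => /=; first by split; exact: nbhsx_ballx.
move=> -[a b] [/= xa yb]; rewrite /ball /= in xa yb *.
by rewrite distrC; apply: Hd; rewrite distrC.
Qed.

(** The second derivative test alone does not exclude an interior maximum of a harmonic function.
    Adding a small multiple of the squared norm makes the Laplacian positive, and then it does. *)
Lemma weak_maximum_principle (U Ux Uxx Uy Uyy : R -> R -> R) (s M : R) : 0 < s ->
  {within square s, continuous (fun z : R * R => U z.1 z.2)} ->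
  (forall x y, `|x| < s -> `|y| < s ->
    [/\ is_derive (x : R) (1 : R) (U ^~ y : R -> R) (Ux x y),
        is_derive (x : R) (1 : R) (Ux ^~ y : R -> R) (Uxx x y),
        is_derive (y : R) (1 : R) (U x : R -> R) (Uy x y),
        is_derive (y : R) (1 : R) (Uy x : R -> R) (Uyy x y)
      & Uxx x y + Uyy x y = 0]) ->
  (forall x y, `|x| <= s -> `|y| <= s -> `|x| = s \/ `|y| = s -> U x y <= M) ->
  forall x y, `|x| <= s -> `|y| <= s -> U x y <= M.
Proof.
move=> s0 cU dU bU x y xs ys; apply/ler_addgt0Pl => e e0.
(* On the square the perturbation is at most [k * (s ^+ 2 + s ^+ 2)], which is [e] for this [k]. *)
pose k := e / (2 * s ^+ 2).
have k0 : 0 < k by rewrite divr_gt0// mulr_gt0// exprn_gt0.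
pose V (z : R * R) := U z.1 z.2 + k * (z.1 ^+ 2 + z.2 ^+ 2).
have sq0 : square s (0, 0) by apply/squareE; rewrite /= normr0; split; exact: ltW.
have cq : continuous (fun z : R * R => k * (z.1 ^+ 2 + z.2 ^+ 2)).
  move=> z; apply: cvgM; first exact: cvg_cst.
  by apply: cvgD; apply: cvgM; (exact: cvg_fst || exact: cvg_snd).
have [|c /set_mem /squareE [c1 c2] Vmax] := compact_EVT_max (ex_intro _ _ sq0) (@compact_square s)
  (f := V).
  move=> z; apply: cvgD; first exact: cU.
  exact: (continuous_subspaceT (A := square s) cq).
have sqb t : `|t| <= s -> t ^+ 2 <= s ^+ 2.
  by move=> ts; rewrite -(real_normK (num_real t)) lerXn2r ?nnegrE ?(ltW s0).
have kb : k * (s ^+ 2 + s ^+ 2) = e by rewrite /k; field; rewrite gt_eqF.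
have UV : U x y <= V (x, y) by rewrite /V /= lerDl mulr_ge0 ?(ltW k0)// addr_ge0 ?sqr_ge0.
apply: le_trans UV _; apply: (le_trans (Vmax (x, y) _)).
  by rewrite inE; apply/squareE.
have Vmax' a b : `|a| <= s -> `|b| <= s -> V (a, b) <= V (c.1, c.2).
  by move=> sa sb; apply: (Vmax (a, b)); rewrite inE; apply/squareE.
have bnd : `|c.1| = s \/ `|c.2| = s.
  apply: contrapT => /not_orP [n1 n2].
  have {}c1 : `|c.1| < s by rewrite lt_neqAle c1 andbT; apply/eqP.
  have {}c2 : `|c.2| < s by rewrite lt_neqAle c2 andbT; apply/eqP.
  have [_ dxx _ dyy lap] := dU _ _ c1 c2.
  have inb (t a : R) : `|a| < s -> `|t - a| < s - `|a| -> `|t| < s.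
    by move=> ? ?; have := ler_normD a (t - a); rewrite addrC subrK; lra.
  have h1 : Uxx c.1 c.2 + k * 2 <= 0.
    apply: (@second_derivative_le0 (fun t => V (t, c.2)) (fun t => Ux t c.2 + k * (2 * t))
      c.1 _ (s - `|c.1|)); first by rewrite subr_gt0.
    - move=> t /(inb _ _ c1) ts; have [dx _ _ _ _] := dU _ _ ts c2.
      by rewrite /V /=; apply: is_derive_eq; rewrite /GRing.scale /=; ring.
    - by apply: is_derive_eq; rewrite /GRing.scale /=; ring.
    - move=> t /(inb _ _ c1) ts; apply: Vmax'; exact: ltW.
  have h2 : Uyy c.1 c.2 + k * 2 <= 0.
    apply: (@second_derivative_le0 (fun t => V (c.1, t)) (fun t => Uy c.1 t + k * (2 * t))
      c.2 _ (s - `|c.2|)); first by rewrite subr_gt0.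
    - move=> t /(inb _ _ c2) ts; have [_ _ dy _ _] := dU _ _ c1 ts.
      by rewrite /V /=; apply: is_derive_eq; rewrite /GRing.scale /=; ring.
    - by apply: is_derive_eq; rewrite /GRing.scale /=; ring.
    - move=> t /(inb _ _ c2) ts; apply: Vmax'; exact: ltW.
  lra.
rewrite /V addrC lerD//; last exact: bU.
by rewrite -kb ler_wpM2l ?(ltW k0)// lerD// sqb.
Qed.

End MaximumPrinciple.

(** * Uniqueness from vanishing near the centre of a disc *)

Section IdentityTheorem.
Context {R : realType}.
Local Open Scope complex_scope.
Local Notation Re := complex.Re.
Local Notation Im := complex.Im.

(** The bound on moduli follows from the one on real parts by a rotation: with [w] the value of [H]
    at the given point, the real part of [H] times the conjugate of [w] is [|w| ^ 2] at that point
    and at most [|w| * M] on the boundary. *)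
Lemma holomorphic_maximum (H H1 H2 : R[i]^o -> R[i]^o) (s M : R) : 0 < s ->
  (forall x y : R, `|x| <= s -> `|y| <= s ->
    is_derive (x +i* y : R[i]^o) 1 H (H1 (x +i* y)) /\
    is_derive (x +i* y : R[i]^o) 1 H1 (H2 (x +i* y))) ->
  (forall x y : R, `|x| <= s -> `|y| <= s -> `|x| = s \/ `|y| = s ->
    `|H (x +i* y)| <= M%:C) ->
  forall x y : R, `|x| <= s -> `|y| <= s -> `|H (x +i* y)| <= M%:C.
Proof.
move=> s0 dH bH x0 y0 x0s y0s.
pose w : R[i] := H (x0 +i* y0).
have M0 : 0 <= M.
  by rewrite -lecR; apply: le_trans (bH s 0 _ _ _);
    rewrite ?normr_ge0 ?normr0 ?gtr0_norm ?(ltW s0)//; left.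
have [w0|w0] := eqVneq w 0; first by rewrite -/w w0 normr0 lecR.
pose c : R[i] := w^*.
pose U x y := Re (c * H (x +i* y)).
have aff x y : `|x| <= s -> `|y| <= s ->
    affine_approx U x y (Re (c * H1 (x +i* y))) (- Im (c * H1 (x +i* y))) /\
    (affine_approx (fun x y => Re (c * H1 (x +i* y))) x y
       (Re (c * H2 (x +i* y))) (- Im (c * H2 (x +i* y))) /\
    affine_approx (fun x y => Im (c * H1 (x +i* y))) x y
       (Im (c * H2 (x +i* y))) (Re (c * H2 (x +i* y)))).
  move=> xs ys; have [d1 d2] := dH x y xs ys.
  have e1 : is_derive (x +i* y : R[i]^o) 1 (fun z : R[i]^o => (c : R[i]^o) * H z : R[i]^o)
      ((c : R[i]^o) * H1 (x +i* y) : R[i]^o) by exact: (@is_deriveZ _ _ _ H c).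
  have e2 : is_derive (x +i* y : R[i]^o) 1 (fun z : R[i]^o => (c : R[i]^o) * H1 z : R[i]^o)
      ((c : R[i]^o) * H2 (x +i* y) : R[i]^o) by exact: (@is_deriveZ _ _ _ H1 c).
  by split; [exact: (affine_approx_Re e1).1|exact: affine_approx_Re e2].
have Uw : U x0 y0 = Re `|w| * Re `|w|.
  apply: (@complexI R); rewrite rmorphM /= -!normcE -expr2 sqr_normc mulrC.
  by rewrite RRe_real // realE -/w mulrC -sqr_normc exprn_ge0.
suff : U x0 y0 <= Re `|w| * M.
  rewrite Uw ler_pM2l -/w; first by rewrite [X in _ -> X <= _]normcE lecR.
  by rewrite -ltcR -normcE normr_gt0.
apply: (@weak_maximum_principle _ U (fun x y => Re (c * H1 (x +i* y)))
    (fun x y => Re (c * H2 (x +i* y))) (fun x y => - Im (c * H1 (x +i* y)))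
    (fun x y => - Re (c * H2 (x +i* y))) s) => //.
- apply: continuous_in_subspaceT => -[x y]; rewrite inE => /squareE /= [xs ys].
  exact: (affine_approx_continuous (aff x y xs ys).1).
- move=> x y /ltW xs /ltW ys; have [A1 [A2 A3]] := aff x y xs ys.
  split.
  + exact: affine_approx_derive1 A1.
  + exact: affine_approx_derive1 A2.
  + exact: affine_approx_derive2 A1.
  + apply: is_deriveN; exact: affine_approx_derive2 A3.
  + by rewrite subrr.
- move=> x y xs ys xy; rewrite /U -lecR.
  have cw : `|c| = `|w| by rewrite normcJ.
  apply: le_trans (_ : `|c * H (x +i* y)| <= _).
    by apply: le_trans (normc_ge_Re _); rewrite lecR ler_norm.
  by rewrite normrM rmorphM /= -normcE cw ler_wpM2l// bH.
Qed.

Lemma is_derive_inv_exp (z : R[i]^o) (n : nat) : z != 0 ->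
  is_derive z 1 (fun z : R[i]^o => z^-1 ^+ n : R[i]^o) (- n%:R * z^-1 ^+ n.+1 : R[i]^o).
Proof.
move=> z0; elim: n => [|n IH].
  by rewrite mulr0n oppr0 mul0r; exact: is_derive_cst.
have dz := is_derive1_inv z0.
rewrite [X in is_derive _ _ X](_ : _ = (fun z : R[i]^o => z^-1) *
  (fun z : R[i]^o => z^-1 ^+ n)); last first.
  by apply/funext => u; rewrite exprS.
apply: is_derive_eq; rewrite /GRing.scale /= !exprS -natr1; ring.
Qed.

Lemma null_derivative (F : R[i]^o -> R[i]^o) (s x y : R) :
  (forall x y : R, `|x| < s -> `|y| < s -> is_derive (x +i* y : R[i]^o) 1 F (0 : R[i]^o)) ->
  `|x| < s -> `|y| < s -> F (x +i* y) = F 0.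
Proof.
move=> dF xs ys.
have aff a b : `|a| < s -> `|b| < s ->
    affine_approx (fun x y => Re (F (x +i* y))) a b 0 0 /\
    affine_approx (fun x y => Im (F (x +i* y))) a b 0 0.
  by move=> sa sb; have := affine_approx_Re (dF _ _ sa sb); rewrite /= oppr0.
have s0 : `|0 : R| < s by rewrite normr0; exact: le_lt_trans xs.
have hor (P : R -> R -> R) : (forall a b, `|a| < s -> `|b| < s -> affine_approx P a b 0 0) ->
    P x y = P 0 0.
  move=> aP.
  have h1 : `|P x y - P 0 y| <= 0 * `|x - 0|.
    apply: (derive_increment_dist (F := P ^~ y) (f := fun=> 0)) => t; last by rewrite normr0.
    by rewrite !subr0 => tx; apply: affine_approx_derive1 (aP t y (le_lt_trans tx xs) ys).
  have h2 : `|P 0 y - P 0 0| <= 0 * `|y - 0|.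
    apply: (derive_increment_dist (F := P 0) (f := fun=> 0)) => t; last by rewrite normr0.
    by rewrite !subr0 => ty; apply: affine_approx_derive2 (aP 0 t s0 (le_lt_trans ty ys)).
  move: h1 h2; rewrite !mul0r !normr_le0 => /eqP h1 /eqP h2; lra.
have hRe := hor _ (fun a b sa sb => (aff a b sa sb).1).
have hIm := hor _ (fun a b sa sb => (aff a b sa sb).2).
have -> : (0 : R[i]) = 0 +i* 0 by [].
by case: (F _) hRe hIm => a b; case: (F _) => a' b' /= -> ->.
Qed.

(* If [f] vanishes near [0], so does a primitive [G], and [G z / z ^ k] is
   holomorphic for every [k]; the maximum principle then bounds [G] by
   [M * (|z| / s) ^ k]. *)
Lemma identity_theorem_disc (f : R[i]^o -> R[i]^o) (r d : R) : 0 < r -> 0 < d ->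
  (forall z : R[i]^o, `|z| < r%:C -> derivable f z 1) ->
  (forall z : R[i]^o, `|z| < d%:C -> f z = 0) ->
  forall z : R[i]^o, `|z| < (r / 4)%:C -> f z = 0.
Proof.
move=> r0 d0 df f0.
(* Since [|z| <= |Re z| + |Im z|], the open square of half-side [r / 2] lies in the disc of radius
   [r]. The gap between [s] and [s1] provides derivatives of the primitive on the closed square of
   half-side [s]. *)
pose s := r / 4; pose s1 := 3 * r / 8.
have s0 : 0 < s by rewrite /s divr_gt0.
have [|||F dF] := @holomorphic_primitive R f (r / 2) s1.
- by rewrite /s1; lra.
- by rewrite /s1; lra.
- move=> x y xr yr; apply: df; apply: le_lt_trans (normc_le_ReIm _) _.
  by rewrite ltcR /=; lra.
pose G z := F z - F 0.
have dG x y : `|x| <= s -> `|y| <= s -> is_derive (x +i* y : R[i]^o) 1 G (f (x +i* y)).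
  rewrite /s => xs ys; have {}dF := dF x y; rewrite /s1 in dF.
  have {}dF := dF ltac:(lra) ltac:(lra).
  by rewrite /G; apply: is_derive_eq; rewrite subr0.
(* The half-side of a square on which [f] vanishes, again by [|z| <= |Re z| + |Im z|], and which
   lies inside the square of half-side [s]. *)
pose eta := Num.min s (d / 2).
have eta0 : 0 < eta by rewrite lt_min s0 divr_gt0.
have etas (x : R) : `|x| < eta -> `|x| <= s by rewrite lt_min => /andP[/ltW].
have fe x y : `|x| < eta -> `|y| < eta -> f (x +i* y) = 0.
  rewrite !lt_min => /andP[_ xd] /andP[_ yd]; apply: f0.
  by apply: le_lt_trans (normc_le_ReIm _) _; rewrite ltcR /=; lra.
have Ge x y : `|x| < eta -> `|y| < eta -> G (x +i* y) = 0.
  move=> xe ye; rewrite (null_derivative _ xe ye); first by rewrite /G subrr.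
  by move=> a b ae be; have := dG a b (etas _ ae) (etas _ be); rewrite fe.
have neare (g : R[i]^o -> R[i]^o) x y : (forall a b, `|a| < eta -> `|b| < eta -> g
  (a +i* b) = 0) ->
    `|x| < eta -> `|y| < eta -> is_derive (x +i* y : R[i]^o) 1 g (0 : R[i]^o).
  move=> ge xe ye; apply: (@near_eq_is_derive _ _ _ (cst 0)).
  pose e := Num.min (eta - `|x|) (eta - `|y|).
  apply/nbhs_ballP; exists e%:C => /=; first by rewrite ltcR lt_min !subr_gt0 xe ye.
  move=> [a b]; rewrite /ball /= => ab.
  have hr := le_lt_trans (normc_ge_Re _) ab; have hi := le_lt_trans (normc_ge_Im _) ab.
  move: hr hi; rewrite !ltcR /= !lt_min => /andP[h1 _] /andP[_ h2].
  rewrite ge//.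
    by have := ler_normB x (x - a); rewrite opprB addrC subrK; lra.
  by have := ler_normB y (y - b); rewrite opprB addrC subrK; lra.
pose f' z := 'D_1 f z.
have df' x y : `|x| <= s -> `|y| <= s -> is_derive (x +i* y : R[i]^o) 1 f (f' (x +i* y)).
  move=> xs ys; apply: DeriveDef => //; apply: df.
  apply: le_lt_trans (normc_le_ReIm _) _; rewrite ltcR /=.
  by rewrite /s in xs ys; lra.
have f'e x y : `|x| < eta -> `|y| < eta -> f' (x +i* y) = 0.
  by move=> xe ye; have [_] := neare f x y fe xe ye.
have [M HM] : exists M : R, forall x y : R, `|x| <= s -> `|y| <= s -> `|G (x +i* y)| <= M%:C.
  have aff x y (xs : `|x| <= s) (ys : `|y| <= s) := affine_approx_Re (dG x y xs ys).
  have sq0 : square s (0, 0) by apply/squareE; rewrite /= normr0; split; exact: ltW.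
  have [|c _ Hc] := compact_EVT_max (ex_intro _ _ sq0) (@compact_square R s)
    (f := fun z => `|Re (G (z.1 +i* z.2))| + `|Im (G (z.1 +i* z.2))|).
    apply: continuous_in_subspaceT => -[x y]; rewrite inE => /squareE /= [xs ys].
    have [A1 A2] := aff x y xs ys.
    by apply: cvgD; apply: cvg_norm;
      [exact: (affine_approx_continuous A1)|exact: (affine_approx_continuous A2)].
  exists (`|Re (G (c.1 +i* c.2))| + `|Im (G (c.1 +i* c.2))|) => x y xs ys.
  apply: le_trans (normc_le_ReIm _) _; rewrite lecR.
  by apply: (Hc (x, y)); rewrite inE; apply/squareE.
have bound k x y : `|x| <= s -> `|y| <= s ->
    `|G (x +i* y) * (x +i* y)^-1 ^+ k| <= (M * s^-1 ^+ k)%:C.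
  pose n : R[i] := k%:R.
  (* The last two functions are the first and second derivatives of the quotient, with [f] for the
     derivative of [G] and [f'] for that of [f]. *)
  apply: (@holomorphic_maximum (fun z => G z * z^-1 ^+ k)
    (fun z => f z * z^-1 ^+ k - n * (G z * z^-1 ^+ k.+1))
    (fun z => f' z * z^-1 ^+ k - n * (f z * z^-1 ^+ k.+1)
       - n * (f z * z^-1 ^+ k.+1 - (n + 1) * (G z * z^-1 ^+ k.+2)))) => // {}x {}y xs ys.
    (* On the small square all the functions involved vanish. This covers the origin, where [z^-1]
       has the default value [0]. *)
    have [xye|] := boolP ((`|x| < eta) && (`|y| < eta)).
      have /andP[xe ye] := xye.
      rewrite fe// f'e// Ge// !(mul0r, mulr0, subr0).
      by split; apply: neare => // a b ae be; rewrite ?fe ?Ge// !(mul0r, mulr0, subr0).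
    move=> xye; have z0 : (x +i* y) != 0 :> R[i].
      apply: contra xye; rewrite eq_complex /= => /andP[/eqP -> /eqP ->].
      by rewrite normr0 eta0.
    have dG' := dG x y xs ys; have df1 := df' x y xs ys.
    have dk := is_derive_inv_exp k z0; have dk1 := is_derive_inv_exp k.+1 z0.
    split.
      by apply: is_derive_eq; rewrite /GRing.scale /= /n; ring.
    rewrite [X in is_derive _ _ X _](_ : _ = (fun z => f z * z^-1 ^+ k - n *:
      (G z * z^-1 ^+ k.+1)))//.
    by apply: is_derive_eq; rewrite /GRing.scale /= -natr1 /n; ring.
  move=> bd; rewrite normrM rmorphM /= ler_pM// ?HM// normrX normfV rmorphXn /= fmorphV.
  have sz : s%:C <= `|x +i* y|.
    by case: bd => <-; [exact: (normc_ge_Re (x +i* y))|exact: (normc_ge_Im (x +i* y))].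
  rewrite lerXn2r ?nnegrE ?invr_ge0 ?normr_ge0 ?lecR ?(ltW s0)//.
  have sC0 : 0 < s%:C :> R[i] by rewrite ltcR.
  by rewrite lef_pV2 //; rewrite posrE //; exact: lt_le_trans sC0 sz.
have G0 x y : `|x +i* y| < s%:C -> G (x +i* y) = 0.
  move=> zs; have xs : `|x| <= s.
    by rewrite -lecR; apply: le_trans (normc_ge_Re (x +i* y)) (ltW zs).
  have ys : `|y| <= s.
    by rewrite -lecR; apply: le_trans (normc_ge_Im (x +i* y)) (ltW zs).
  have [z0|z0] := eqVneq (x +i* y) 0.
    by rewrite z0 /G subrr.
  pose a := Re `|x +i* y|.
  have a0 : 0 < a by rewrite -ltcR -normcE normr_gt0.
  have as' : a < s by rewrite -ltcR -normcE.
  have le k : Re `|G (x +i* y)| <= M * (a / s) ^+ k.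
    have := bound k x y xs ys; rewrite normrM normrX normfV (normcE (x +i* y)) -/a normcE.
    rewrite -fmorphV -rmorphXn -rmorphM /= lecR => h.
    rewrite exprMn mulrCA mulrC -ler_pdivrMr ?exprn_gt0//.
    by rewrite -exprVn.
  have lim : M * (a / s) ^+ k @[k --> \oo] --> (0 : R).
    rewrite -(mulr0 M); apply: cvgM; first exact: cvg_cst.
    have q1 : a / s < 1 by rewrite ltr_pdivrMr ?mul1r.
    by apply: cvg_expr; rewrite ger0_norm// ltW// divr_gt0.
  have : Re `|G (x +i* y)| <= 0.
    by apply: (cvgr_to_ge lim); exact: nearW.
  by rewrite -lecR -normcE normr_le0 => /eqP.
move=> [x y] zs.
have xs : `|x| <= s.
  by rewrite -lecR; apply: le_trans (normc_ge_Re (x +i* y)) (ltW zs).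
have ys : `|y| <= s.
  by rewrite -lecR; apply: le_trans (normc_ge_Im (x +i* y)) (ltW zs).
(* [f] is the derivative of [G], which vanishes on a neighbourhood of the point. *)
have [_ <-] := dG x y xs ys.
suff [] : is_derive (x +i* y : R[i]^o) 1 G (0 : R[i]^o) by [].
apply: (@near_eq_is_derive _ _ _ (cst 0)).
apply/nbhs_ballP; exists (s%:C - `|x +i* y|) => /=; first by rewrite subr_gt0.
move=> [a b]; rewrite /ball /= => ab; rewrite G0//.
have := ler_normB (x +i* y) (x +i* y - a +i* b).
rewrite opprB addrC subrK => h; apply: le_lt_trans h _.
by rewrite addrC -ltrBrDr.
Qed.

End IdentityTheorem.

(** * Continuation of meromorphic families *)

Section Continuation.
Context {R : realType}.
Local Open Scope complex_scope.
Local Notation C2 := (R[i]^o * R[i]^o)%type.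

(** The hypothesis makes the set of good [t] both open and closed, and the segment is connected. *)
Lemma locally_constant_segment (S : R -> Prop) :
  (forall t, exists2 d : R, 0 < d &
     forall s s', `|s - t| < d -> `|s' - t| < d -> S s -> S s') ->
  S 0 -> S 1.
Proof.
move=> loc S0.
have op : open [set t | S t].
  rewrite openE => t St; have [d d0 Hd] := loc t.
  apply/nbhs_ballP; exists d => //= s ts; apply: (Hd t); rewrite ?subrr ?normr0//.
  by rewrite distrC.
have cl : closed [set t | S t].
  move=> t; have [d d0 Hd] := loc t => /(_ (ball t d) (nbhsx_ballx _ _ d0)) [s [/= Ss ts]].
  by apply: (Hd s); rewrite ?subrr ?normr0//; rewrite distrC.
have B : `[0, 1] `&` [set t | S t] = `[0, 1]%classic.
  apply: (@segment_connected R 0 1).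
  - by exists 0; split => //=; rewrite in_itv /= lexx ler01.
  - by exists [set t | S t].
  - by exists [set t | S t].
have : (`[0, 1] `&` [set t | S t]) (1 : R) by rewrite B /= in_itv /= lexx ler01.
by case.
Qed.

Lemma ball_pairE (p q : C2) (e : R[i]) :
  ball p e q <-> `|p.1 - q.1| < e /\ `|p.2 - q.2| < e.
Proof. by []. Qed.

(** Restrict [F] to the complex line through [p] and [q], with [p] at [0] and [q] at [1]. The radius
    obtained does not depend on [d]. *)
Lemma identity_theorem_ball (F : C2 -> R[i]^o) (p : C2) (r d : R) : 0 < r -> 0 < d ->
  (forall q, ball p r%:C q -> differentiable F q) ->
  (forall q, ball p d%:C q -> F q = 0) ->
  forall q, ball p (r / 5)%:C q -> F q = 0.
Proof.
move=> r0 d0 dF F0 q /ball_pairE [q1 q2].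
pose v : C2 := q - p.
pose l (z : R[i]^o) : C2 := p + z *: v.
have l1 : l 1 = q by rewrite /l scale1r /v addrC subrK.
have v1 : `|v.1| < (r / 5)%:C by rewrite distrC.
have v2 : `|v.2| < (r / 5)%:C by rewrite distrC.
have lball z e : `|z| < e%:C -> 0 < e -> ball p (e * (r / 5))%:C (l z).
  move=> ze e0; apply/ball_pairE; rewrite /l /= !opprD !addrA !subrr !sub0r !normrN !normrM.
  have key (a : R[i]) : `|a| < (r / 5)%:C -> `|z| * `|a| < (e * (r / 5))%:C.
    move=> ha; rewrite rmorphM /= ltr_pM//.
  by split; exact: key.
(* Both coordinates of [q - p] are below [r / 5], so the disc of radius [5] is mapped into the ball
   of radius [r], and [1 < 5 / 4] puts [q] within reach of the one-variable theorem. *)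
rewrite -l1; apply: (@identity_theorem_disc R (F \o l) 5 (d / (r / 5))) => //.
- by rewrite !divr_gt0.
- move=> z z5; apply/derivable1_diffP; apply: differentiable_comp.
    apply: differentiableD; first exact: differentiable_cst.
    exact: differentiableZl.
  apply: dF; have := lball z 5 z5 ltac:(by []).
  by rewrite mulrC divfK.
- move=> z zd /=; apply: F0.
  have r50 : 0 < r / 5 by rewrite divr_gt0.
  by have := lball z _ zd (divr_gt0 d0 r50); rewrite divfK ?gt_eqF.
- by rewrite normr1 ltcR; lra.
Qed.

Lemma nbhs_neq0 (F : C2 -> R[i]^o) q : differentiable F q -> F q != 0 ->
  nbhs q [set q' | F q' != 0].
Proof. by move=> /differentiable_continuous cF; exact: cvgr_neq0 cF. Qed.

(** A whole neighbourhood of [q] is obtained rather than a single point, so that a second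
    denominator can be treated inside it. *)
Lemma denominator_dense U (h : C2 -> R[i]^o) p V : open U -> denominator U h -> U p ->
  nbhs p V -> exists q, [/\ U q, V q & nbhs q [set q' | [/\ U q', V° q' & h q' != 0]]].
Proof.
move=> oU [hh dh] Up Vp.
have Vp' : nbhs p (V° `&` U).
  apply: filterI; last by exact: open_nbhs_nbhs.
  by apply: open_nbhs_nbhs; split; [exact: open_interior|].
have [q [[Uq hq] [Vq _]]] := dh p Up _ Vp'.
exists q; split => //; first exact: interior_subset.
have : nbhs q [set q' | h q' != 0].
  exact: nbhs_neq0 (hh q Uq) hq.
move=> hq'; have UV : nbhs q (U `&` V°).
  by apply: open_nbhs_nbhs; split => //; apply: openI => //; exact: open_interior.
by near=> q'; split; [have [] : (U `&` V°) q' by near: q'| have [] :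
  (U `&` V°) q' by near: q'| near: q'].
Unshelve. all: by end_near.
Qed.

Lemma denominator_mul U (h1 h2 : C2 -> R[i]^o) : open U ->
  denominator U h1 -> denominator U h2 -> denominator U (fun p => h1 p * h2 p).
Proof.
move=> oU D1 D2; split.
  by move=> p Up; apply: differentiableM; [exact: D1.1|exact: D2.1].
move=> p Up V Vp.
have [q [Uq Vq Hq]] := denominator_dense oU D1 Up Vp.
have [q' [_ _ Hq']] := denominator_dense oU D2 Uq Hq.
have [Uq' /interior_subset [_ /interior_subset Vq' h1q'] h2q'] := nbhs_singleton Hq'.
by exists q'; split => //; split => //=; rewrite mulf_neq0.
Qed.

Lemma denominator_sub U U' (h : C2 -> R[i]^o) : open U' -> U' `<=` U ->
  denominator U h -> denominator U' h.
Proof.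
move=> oU' sU [hh dh]; split; first by move=> p /sU; exact: hh.
move=> p U'p V Vp.
have [|q [[Uq hq] [Vq U'q]]] := dh p (sU _ U'p) (V `&` U').
  by apply: filterI => //; exact: open_nbhs_nbhs.
by exists q.
Qed.

Section Families.
Context {n : nat}.
Implicit Types T : R[i] -> R[i] -> distr R n.

(* The part of [meromorphic_family] that concerns each test function separately. *)
Definition weakly_meromorphic T := forall p0 : C2,
  exists U h (G : C2 -> distr R n), [/\ open_nbhs p0 U, denominator U h,
    forall f, schwartz f -> holomorphic U (fun p => G p f) &
    forall p, U p -> h p != 0 -> forall f, schwartz f ->
      T p.1 p.2 f = (h p)^-1 * G p f].

Definition eq_meromorphic_at T1 T2 (p0 : C2) := exists U h,
  [/\ open_nbhs p0 U, denominator U h &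
     forall p, U p -> h p != 0 -> eq_distr (T1 p.1 p.2) (T2 p.1 p.2)].

Lemma meromorphic_family_weak T : meromorphic_family T -> weakly_meromorphic T.
Proof.
move=> mT p0; have [U [h [G [oU dU [_ hG] TG]]]] := mT p0.
by exists U, h, (fun p => G p.1 p.2).
Qed.

(** The radius is chosen from [p0] alone, whereas the neighbourhood of [q] where equality is known
    may be arbitrarily small. Clearing denominators gives [F f = h2 * G1 f - h1 * G2 f], holomorphic
    near [p0] for every test function [f]; it vanishes near [q], and the identity theorem carries
    this to [q']. *)
Lemma eq_meromorphic_at_local T1 T2 p0 :
  weakly_meromorphic T1 -> weakly_meromorphic T2 ->
  exists2 r : R, 0 < r & forall q q', ball p0 r%:C q -> ball p0 r%:C q' ->
    eq_meromorphic_at T1 T2 q -> eq_meromorphic_at T1 T2 q'.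
Proof.
move=> m1 m2.
have [U1 [h1 [G1 [[oU1 Up1] D1 hG1 TG1]]]] := m1 p0.
have [U2 [h2 [G2 [[oU2 Up2] D2 hG2 TG2]]]] := m2 p0.
have : nbhs p0 (U1 `&` U2) by apply: open_nbhs_nbhs; split; [exact: openI|].
move=> /nbhs_ballP [_ /= /gt0_complexE [r0 r00 ->] sub].
have sub1 q : ball p0 r0%:C q -> U1 q by move=> /sub[].
have sub2 q : ball p0 r0%:C q -> U2 q by move=> /sub[].
have trb (a b c : C2) (e1 e2 e3 : R) : e1 + e2 <= e3 ->
    ball a e1%:C b -> ball b e2%:C c -> ball a e3%:C c.
  move=> e12 ab bc; apply: le_ball (ball_triangle ab bc).
  by rewrite -rmorphD lecR.
(* The points [q] and [q'] are within [r0 / 20] of each other. The ball of radius [r0 / 2] about [q]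
   stays in the chart, the identity theorem makes [F] vanish on the ball of radius [r0 / 10] about
   [q], and this contains the ball of radius [r0 / 20] about [q']. *)
exists (r0 / 40); first by rewrite divr_gt0.
move=> q q' pq pq' [U [k [[oU Uq] Dk eqT]]].
pose B := ball q (r0 / 2)%:C.
have BU : forall z, B z -> ball p0 r0%:C z.
  by move=> z; apply: trb pq; lra.
have oB : open B by exact: ball_open.
have h0 e : 0 < e -> 0 < e%:C :> R[i] by rewrite ltcR.
have Bq : B q by apply: ballxx; apply: h0; lra.
pose F f (p : C2) : R[i]^o := h2 p * G1 p f - h1 p * G2 p f.
have dF f : schwartz f -> forall z, B z -> differentiable (F f) z.
  move=> sf z /BU pz; apply: differentiableB; apply: differentiableM.
  - exact/D2.1/sub2.
  - exact/hG1/sub1.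
  - exact/D1.1/sub1.
  - exact/hG2/sub2.
pose V := U `&` B.
have oV : open V by exact: openI.
have DV : denominator V (fun p => h1 p * h2 p * k p).
  apply: (denominator_mul oV (denominator_mul oV _ _)).
  - exact: denominator_sub oV (fun z hz => sub1 z (BU z hz.2)) D1.
  - exact: denominator_sub oV (fun z hz => sub2 z (BU z hz.2)) D2.
  - exact: denominator_sub oV (fun z hz => hz.1) Dk.
(* Off the three denominators the two quotients agree. A nonzero value of [F f] would persist on a
   neighbourhood, and this meets the dense set where no denominator vanishes. *)
have F0V f : schwartz f -> forall z, V z -> F f z = 0.
  move=> sf z Vz; apply/eqP; apply: contrapT => /negP Fz.
  have cF : nbhs z [set z' | F f z' != 0].
    exact: nbhs_neq0 (dF f sf z Vz.2) Fz.
  have [y [[Vy]]] := DV.2 z Vz _ cF.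
  rewrite /= !mulf_eq0 !negb_or -andbA => /and3P[h1y h2y ky] /negP; apply.
  have yp0 := BU y Vy.2.
  have := eqT y Vy.1 ky f sf.
  rewrite (TG1 y (sub1 _ yp0) h1y f sf) (TG2 y (sub2 _ yp0) h2y f sf) => e.
  rewrite /F subr_eq0; apply/eqP.
  transitivity (h1 y * h2 y * ((h1 y)^-1 * G1 y f)); first by field.
  by rewrite e; field.
have F0 f : schwartz f -> forall z, ball q (r0 / 10)%:C z -> F f z = 0.
  move=> sf.
  have : nbhs q V by apply: open_nbhs_nbhs; split.
  move=> /nbhs_ballP [_ /= /gt0_complexE [d d0 ->] subV].
  have -> : r0 / 10 = (r0 / 2) / 5 by field.
  have r20 : 0 < r0 / 2 by rewrite divr_gt0.
  exact: (identity_theorem_ball r20 d0 (dF f sf) (fun z hz => F0V f sf z (subV z hz))).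
exists (ball q' (r0 / 20)%:C), (fun p => h1 p * h2 p).
have q'U z : ball q' (r0 / 20)%:C z -> ball p0 r0%:C z by apply: trb pq'; lra.
have oB' : open (ball q' (r0 / 20)%:C) by exact: ball_open.
split.
- by split; [exact: oB'|apply: ballxx; apply: h0; lra].
- apply: (denominator_mul oB').
    exact: denominator_sub oB' (fun z hz => sub1 z (q'U z hz)) D1.
  exact: denominator_sub oB' (fun z hz => sub2 z (q'U z hz)) D2.
- move=> y qy; rewrite mulf_eq0 negb_or => /andP[h1y h2y] f sf.
  have yp0 := q'U y qy.
  have Fy : F f y = 0.
    apply: (F0 f sf); apply: (trb _ q' _ (r0 / 20) (r0 / 20) _ _ _ qy); first by lra.
    by apply: (trb _ p0 _ (r0 / 40) (r0 / 40) _ _ _ pq'); [lra|exact: ball_sym].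
  rewrite (TG1 y (sub1 _ yp0) h1y f sf) (TG2 y (sub2 _ yp0) h2y f sf).
  move: Fy => /eqP; rewrite /F subr_eq0 => /eqP Fy.
  have -> : G1 y f = (h2 y)^-1 * (h2 y * G1 y f) by rewrite mulKf.
  by rewrite Fy; field; rewrite h1y h2y.
Qed.

Lemma meromorphic_continuation T1 T2 (p : C2) (r : R) :
  weakly_meromorphic T1 -> weakly_meromorphic T2 -> 0 < r ->
  (forall q, ball p r%:C q -> eq_distr (T1 q.1 q.2) (T2 q.1 q.2)) ->
  eq_meromorphic T1 T2.
Proof.
move=> m1 m2 r0 eqT q.
pose v : C2 := q - p.
pose l (t : R) : C2 := p + (t%:C : R[i]^o) *: v.
suff : eq_meromorphic_at T1 T2 (l 1) by rewrite /l scale1r /v addrC subrK.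
apply: (@locally_constant_segment (fun t => eq_meromorphic_at T1 T2 (l t))).
  move=> t; have [e e0 He] := eq_meromorphic_at_local (l t) m1 m2.
  (* A bound for the speed of [l]; the [1] keeps it positive when [p = q]. *)
  pose M := complex.Re `|v.1| + complex.Re `|v.2| + 1.
  have v0 (a : R[i]) : 0 <= complex.Re `|a| by rewrite -lecR -normcE; exact: normr_ge0.
  have M0 : 0 < M by rewrite ltr_wpDl ?addr_ge0.
  exists (e / M); first by rewrite divr_gt0.
  have key s : `|s - t| < e / M -> ball (l t) e%:C (l s).
    rewrite ltr_pdivlMr// => st.
    have k (b a : R[i]) : complex.Re `|a| <= M -> `|b + t%:C * a - (b + s%:C * a)| < e%:C.
      move=> aM; rewrite opprD addrACA subrr add0r -mulrBl normrM -rmorphB /= normc_def /=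
        expr0n addr0 sqrtr_sqr.
      rewrite [`|a|]normcE -rmorphM /= ltcR distrC; apply: le_lt_trans st.
      by rewrite ler_wpM2l.
    by apply/ball_pairE; split; apply: k; rewrite /M -?addrA ?lerDl ?addr_ge0//
      addrCA lerDl addr_ge0.
  by move=> s s' /key ts /key ts'; exact: He.
rewrite /l scale0r addr0; exists (ball p r%:C), (fun=> 1); split.
- by split; [exact: ball_open|apply: ballxx; rewrite ltcR].
- split; first by move=> z _; exact: differentiable_cst.
  by move=> z pz; apply: subset_closure; split => //=; exact: oner_neq0.
- by move=> z pz _; exact: eqT.
Qed.

End Families.
End Continuation.

(** * Schwartz functions *)

Section SchwartzFunctions.
Context {R : realType} {n : nat}.
Local Open Scope complex_scope.
Local Notation Re := complex.Re.
Local Notation Im := complex.Im.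
Implicit Types (f g : 'rV[R]_n -> R[i]) (k j : 'I_n) (x : 'rV[R]_n).

Definition cdifferentiable f x :=
  differentiable (fun y => Re (f y)) x /\ differentiable (fun y => Im (f y)) x.

Lemma cdifferentiableD f g x : cdifferentiable f x -> cdifferentiable g x ->
  cdifferentiable (fun y => f y + g y) x.
Proof.
move=> [f1 f2] [g1 g2]; split.
  rewrite (_ : (fun y => _) = (fun y => Re (f y)) + (fun y => Re (g y))); last first.
    by apply/funext => y; rewrite raddfD.
  exact: differentiableD.
rewrite (_ : (fun y => _) = (fun y => Im (f y)) + (fun y => Im (g y))); last first.
  by apply/funext => y; rewrite raddfD.
exact: differentiableD.
Qed.

Lemma partialD k f g x : cdifferentiable f x -> cdifferentiable g x ->
  partial k (fun y => f y + g y) x = partial k f x + partial k g x.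
Proof.
move=> [f1 f2] [g1 g2]; rewrite /partial.
rewrite (_ : (fun y => Re _) = (fun y => Re (f y)) + (fun y => Re (g y))); last first.
  by apply/funext => y; rewrite raddfD.
rewrite (_ : (fun y => Im _) = (fun y => Im (f y)) + (fun y => Im (g y))); last first.
  by apply/funext => y; rewrite raddfD.
by rewrite !deriveD//; apply: diff_derivable.
Qed.

Lemma Re_realM (a : R) (z : R[i]) : Re (a%:C * z) = a * Re z.
Proof. by case: z => p q /=; rewrite mul0r subr0. Qed.

Lemma Im_realM (a : R) (z : R[i]) : Im (a%:C * z) = a * Im z.
Proof. by case: z => p q /=; rewrite mul0r addr0. Qed.

Definition mulx (j : 'I_n) f : 'rV[R]_n -> R[i] := fun x => (x ord0 j)%:C * f x.

Lemma cdifferentiable_mulx j f x : cdifferentiable f x -> cdifferentiable (mulx j f) x.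
Proof.
move=> [f1 f2]; split.
  rewrite (_ : (fun y => _) = (fun y : 'rV[R]_n => y ord0 j) * (fun y => Re (f y))); last first.
    by apply/funext => y; rewrite /mulx Re_realM.
  by apply: differentiableM => //; exact: differentiable_coord.
rewrite (_ : (fun y => _) = (fun y : 'rV[R]_n => y ord0 j) * (fun y => Im (f y))); last first.
  by apply/funext => y; rewrite /mulx Im_realM.
by apply: differentiableM => //; exact: differentiable_coord.
Qed.

Lemma derive_coord x (v : 'rV[R]_n) j : 'D_v (fun y : 'rV[R]_n => y ord0 j) x = v ord0 j.
Proof.
apply: cvg_lim => //; apply: cvg_near_cst.
apply/nbhs_ballP; exists 1 => //= h _ h0.
by rewrite !mxE addrK /GRing.scale /= mulKf.
Qed.

Lemma partial_mulx k j f x : cdifferentiable f x ->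
  partial k (mulx j f) x = (if j == k then f x else 0) + mulx j (partial k f) x.
Proof.
move=> [f1 f2]; rewrite /partial /mulx.
rewrite (_ : (fun y => Re _) = (fun y : 'rV[R]_n => y ord0 j) * (fun y => Re (f y))); last first.
  by apply/funext => y; rewrite Re_realM.
rewrite (_ : (fun y => Im _) = (fun y : 'rV[R]_n => y ord0 j) * (fun y => Im (f y))); last first.
  by apply/funext => y; rewrite Im_realM.
have dj := differentiable_coord x ord0 j.
rewrite !deriveM//; try exact: diff_derivable.
rewrite derive_coord mxE eqxx /= /GRing.scale /=.
move: ('D__ _ x) ('D__ _ x) => u v.
by case: eqP => _; case: (f x) => a b; apply/eqP; rewrite eq_complex /=; apply/andP;
  split; apply/eqP; ring.
Qed.

Lemma smooth_cdifferentiable s f x : smooth f -> cdifferentiable (partials s f) x.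
Proof. by move=> sf; exact: sf. Qed.

Definition sum_partials (ts : seq (seq 'I_n)) f x : R[i] := \sum_(t <- ts) partials t f x.

Lemma sum_partials_cons t ts f :
  sum_partials (t :: ts) f = fun x => partials t f x + sum_partials ts f x.
Proof. by apply/funext => x; rewrite /sum_partials big_cons. Qed.

Lemma cdifferentiable_sum ts f x : smooth f -> cdifferentiable (sum_partials ts f) x.
Proof.
move=> sf; elim: ts => [|t ts IH]; last first.
  by rewrite sum_partials_cons; apply: cdifferentiableD IH; exact: smooth_cdifferentiable.
rewrite (_ : sum_partials _ _ = fun=> 0); last first.
  by apply/funext => y; rewrite /sum_partials big_nil.
by split; exact: differentiable_cst.
Qed.

Lemma partial_sum k ts f : smooth f ->
  partial k (sum_partials ts f) = sum_partials (map (cons k) ts) f.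
Proof.
move=> sf; elim: ts => [|t ts IH].
  rewrite (_ : sum_partials _ _ = fun=> 0); last first.
    by apply/funext => y; rewrite /sum_partials big_nil.
  by apply/funext => x; rewrite /partial !derive_cst.
rewrite /= !sum_partials_cons; apply/funext => x.
by rewrite partialD ?IH//; exact: cdifferentiable_sum.
Qed.

(* The multi-indices of the lower order terms in the Leibniz formula. *)
Fixpoint leibniz (j : 'I_n) (s : seq 'I_n) : seq (seq 'I_n) :=
  if s is k :: s' then (if j == k then [:: s'] else [::]) ++ map (cons k) (leibniz j s')
  else [::].

Lemma partials_mulx s j f : smooth f ->
  partials s (mulx j f) = fun x => mulx j (partials s f) x + sum_partials (leibniz j s) f x.
Proof.
move=> sf; elim: s => [|k s IH]; apply/funext => x.
  by rewrite /sum_partials /= big_nil addr0.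
rewrite [LHS]/= IH partialD; last 2 first.
- by apply: cdifferentiable_mulx; exact: smooth_cdifferentiable.
- exact: cdifferentiable_sum.
rewrite partial_mulx; last exact: smooth_cdifferentiable.
rewrite partial_sum// /sum_partials /= big_cat /= addrCA addrA.
by case: eqP => _; rewrite ?big_seq1 ?big_nil.
Qed.

Lemma smooth_mulx j f : smooth f -> smooth (mulx j f).
Proof.
move=> sf s x; rewrite partials_mulx//.
apply: cdifferentiableD; last exact: cdifferentiable_sum.
by apply: cdifferentiable_mulx; exact: smooth_cdifferentiable.
Qed.

Lemma partials_rcons s k f : partials (rcons s k) f = partials s (partial k f).
Proof. by rewrite /partials foldr_rcons. Qed.

Lemma schwartz_partial k f : schwartz f -> schwartz (partial k f).
Proof.
move=> [sf bf]; split; first by move=> s x; rewrite -partials_rcons; exact: sf.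
move=> N; have [M HM] := bf N.+1; exists M => s sN x.
rewrite -partials_rcons; apply: le_trans (HM (rcons s k) _ x); last by rewrite size_rcons.
by rewrite ler_wpM2r// lecR exprS ler_peMl ?exprn_ge0 ?addr_ge0// lerDl.
Qed.

Lemma rV_coord_le_norm x j : `|x ord0 j| <= `|x|.
Proof.
rewrite [leRHS]mx_normrE.
exact: (le_bigmax _ (fun ij : 'I_1 * 'I_n => `|x ij.1 ij.2|) (ord0, j)).
Qed.

Lemma size_leibniz j s : (size (leibniz j s) <= size s)%N.
Proof.
elim: s => // k s IH /=; rewrite size_cat size_map; case: eqP => _ //=.
by rewrite add0n leqW.
Qed.

Lemma leibniz_size j s t : t \in leibniz j s -> (size t <= size s)%N.
Proof.
elim: s t => // k s IH t /=; rewrite mem_cat => /orP[|/mapP[u /IH us ->]]; last by [].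
by case: eqP => // _; rewrite inE => /eqP ->.
Qed.

Lemma schwartz_mulx j f : schwartz f -> schwartz (mulx j f).
Proof.
move=> [sf bf]; split; first exact: smooth_mulx.
(* The coordinate factor is absorbed by one more power of the weight. With at most [N] lower order
   terms this makes at most [N.+1] terms, each bounded by [M]. *)
move=> N; have [M HM] := bf N.+1; exists ((N.+1)%:R * M) => s sN x.
rewrite partials_mulx//.
have w0 : 0 <= 1 + `|x| by rewrite addr_ge0.
have wN : 0 <= ((1 + `|x|) ^+ N)%:C :> R[i] by rewrite lecR exprn_ge0.
have term t : (size t <= N)%N -> ((1 + `|x|) ^+ N)%:C * `|partials t f x| <= M%:C.
  move=> tN; apply: le_trans (HM t (leqW tN) x).
  by rewrite ler_wpM2r// lecR exprS ler_peMl ?exprn_ge0// lerDl.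
have M0 : 0 <= M%:C :> R[i] by apply: le_trans (term [::] _) => //; rewrite mulr_ge0.
apply: le_trans (ler_wpM2l wN (ler_normD _ _)) _; rewrite mulrDr.
rewrite -natr1 mulrDl mul1r addrC rmorphD /=; apply: lerD.
  apply: le_trans (_ : (size (leibniz j s))%:R * M%:C <= _); last first.
    rewrite rmorphM /= rmorph_nat ler_wpM2r// ler_nat.
    exact: leq_trans (size_leibniz j s) sN.
  apply: le_trans (ler_wpM2l wN (ler_norm_sum _ _ _)) _.
  rewrite mulr_sumr mulr_natl -[X in _ *+ X]/(size _) -(count_predT
    (leibniz j s)) -iter_addr_0 -big_const_seq.
  rewrite big_seq [leRHS]big_seq; apply: ler_sum => t /leibniz_size ts.
  exact: term (leq_trans ts sN).
rewrite /mulx normrM mulrA; apply: le_trans (HM s (leqW sN) x).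
rewrite ler_wpM2r// exprSr rmorphM /= ler_wpM2l//.
rewrite normc_def /= expr0n addr0 sqrtr_sqr lecR.
by apply: le_trans (rV_coord_le_norm x j) _; rewrite lerDr.
Qed.

End SchwartzFunctions.

(** * Stability of meromorphy under P and under translation of the parameters *)

Section MeromorphicOperations.
Context {R : realType}.
Local Notation C2 := (R[i]^o * R[i]^o)%type.

Lemma shiftPE d (lam : R[i]) (T : distr R d.+1) f :
  shiftP lam T f = \sum_(k < d.+1) T (partial k (partial k (mulx ord_max f)))
    + (2 * lam - d.+1%:R - 2) * T (partial ord_max f).
Proof.
rewrite /shiftP /distr_add /distr_mulx /distr_laplacian /distr_scale /distr_partial mulrNN.
by congr (_ + _); apply: eq_bigr => k _; rewrite opprK.
Qed.

(** The transpose of [P] maps Schwartz functions to Schwartz functions, so the denominators of [T]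
    serve unchanged and only the numerators are recombined. *)
Lemma weakly_meromorphic_shiftP d (mu : C2 -> R[i]^o) (T : R[i] -> R[i] -> distr R d.+1) :
  (forall p, differentiable mu p) -> weakly_meromorphic T ->
  weakly_meromorphic (fun lam nu => shiftP (mu (lam, nu)) (T lam nu)).
Proof.
move=> dmu mT p0; have [U [h [G [oU dU hG TG]]]] := mT p0.
exists U, h, (fun p => shiftP (mu p) (G p)); split; [exact: oU|exact: dU| |].
  move=> f sf p Up.
  rewrite (_ : (fun p => _) = fun p : C2 =>
    (\sum_(k < d.+1) (fun p => G p (partial k (partial k (mulx ord_max f))) : R[i]^o)) p
    + (2 * mu p - d.+1%:R - 2) * G p (partial ord_max f) : R[i]^o); last first.
    by apply/funext => q; rewrite shiftPE fct_sumE.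
  apply: differentiableD.
    apply: differentiable_sum => k; apply: hG => //.
    by do 2 apply: schwartz_partial; exact: schwartz_mulx.
  apply: differentiableM; last by apply: hG => //; exact: schwartz_partial.
  apply: differentiableB; last exact: differentiable_cst.
  apply: differentiableB; last exact: differentiable_cst.
  by apply: differentiableM => //; exact: differentiable_cst.
move=> [lam nu] Up hp f sf; rewrite !shiftPE /= mulrDr mulr_sumr; congr (_ + _).
  apply: eq_bigr => k _; apply: (TG _ Up hp).
  by do 2 apply: schwartz_partial; exact: schwartz_mulx.
by rewrite (TG _ Up hp)//; [rewrite mulrCA|exact: schwartz_partial].
Qed.

Lemma weakly_meromorphic_translate n (c : C2 -> R[i]^o) (t1 t2 : R[i])
    (T : R[i] -> R[i] -> distr R n) :
  (forall p, differentiable c p) -> weakly_meromorphic T ->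
  weakly_meromorphic (fun lam nu => distr_scale (c (lam, nu)) (T (lam + t1) (nu + t2))).
Proof.
move=> dc mT p0; pose t : C2 := (t1, t2).
have [U [h [G [[oU Up0] [dh densh] hG TG]]]] := mT (p0 + t).
have dt (p : C2) : differentiable (fun q : C2 => q + t) p.
  by apply: differentiableD => //; exact: differentiable_cst.
have ct : continuous (fun q : C2 => q + t) by move=> q; exact: differentiable_continuous.
have ct' : continuous (fun q : C2 => q - t).
  by move=> q; apply: cvgB => //; exact: cvg_cst.
exists [set p | U (p + t)], (fun p => h (p + t)), (fun p => distr_scale (c p) (G (p + t))).
split.
- by split => //; exact: open_comp.
- split.
    by move=> p /= Up; apply: (differentiable_comp (dt p)); exact: dh.
  move=> p /= Up V Vp.
  have Vp' : nbhs (p + t) [set q | V (q - t)].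
    by apply: (ct' (p + t)); rewrite /= addrK.
  have [q [[Uq hq] Vq]] := densh _ Up _ Vp'.
  by exists (q - t); split => //; split; rewrite /= subrK.
- move=> f sf p /= Up; apply: differentiableM => //.
  have dG : differentiable ((fun q : C2 => G q f : R[i]^o) \o (fun q : C2 => q + t)) p.
    by apply: (differentiable_comp (dt p)); exact: hG.
  exact: dG.
- move=> [lam nu] /= Up hp f sf.
  by rewrite /distr_scale (TG _ Up hp f sf) mulrCA.
Qed.

End MeromorphicOperations.

(** * Integration by parts on tuples *)

Section LebesgueTupleIntegral.
Context {R : realType}.
Local Notation E n := (n.-tuple (measurableTypeR R)).
Local Notation leb := (@lebesgue_measure R).

(** The decay profile of all domination arguments: it is integrable, and so are its products over
    the coordinates of a tuple. *)
Definition oneDsqrV (x : R) : R := (oneDsqr x)^-1.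

Lemma oneDsqrV_gt0 x : 0 < oneDsqrV x.
Proof. by rewrite invr_gt0 (lt_le_trans ltr01)// oneDsqr_ge1. Qed.

Lemma oneDsqrV_continuous : continuous oneDsqrV.
Proof. exact: continuous_oneDsqrV. Qed.

Lemma integral_oneDsqrV : (\int[leb]_x (oneDsqrV x)%:E)%E = (@pi R)%:E.
Proof.
rewrite ge0_symfun_integralT.
- rewrite (_ : [set x : R | 0 <= x] = `[0, +oo[%classic); last first.
    by apply/seteqP; split => x /=; rewrite in_itv /= andbT.
  by rewrite integral0y_oneDsqr -EFinM mulrC divfK.
- by move=> x; rewrite ltW// oneDsqrV_gt0.
- exact: oneDsqrV_continuous.
- by move=> x; rewrite /= /oneDsqrV /oneDsqr sqrrN.
Qed.

Lemma integrable_oneDsqrV : leb.-integrable setT (EFin \o oneDsqrV).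
Proof.
apply/integrableP; split.
  by apply/measurable_EFinP; apply: continuous_measurable_fun; exact: oneDsqrV_continuous.
under eq_integral do rewrite /= ger0_norm ?(ltW (oneDsqrV_gt0 _))//.
by rewrite integral_oneDsqrV ltry.
Qed.

Lemma cvg_oneDsqrV_nat (C : R) (u : nat -> R) :
  (forall m, `|u m| <= C * oneDsqrV m%:R) -> u m @[m --> \oo] --> (0 : R).
Proof.
move=> uC; apply/cvgr0Pnorm_le => e e0.
have C0 : 0 <= C.
  by have := uC 0%N; rewrite /oneDsqrV /oneDsqr expr0n addr0 invr1 mulr1; apply: le_trans.
near=> m; apply: (le_trans (uC m)).
rewrite ler_pdivrMr ?(lt_le_trans ltr01) ?oneDsqr_ge1//.
have mC : C / e <= m%:R by near: m; exact: nbhs_infty_ger.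
have {}mC : C <= e * m%:R by rewrite mulrC -ler_pdivrMr.
apply: (le_trans mC); rewrite ler_wpM2l ?(ltW e0)// /oneDsqr.
have m0 : 0 <= m%:R :> R by [].
have : 0 <= (m%:R - 1) ^+ 2 :> R by exact: sqr_ge0.
rewrite sqrrB; nra.
Unshelve. all: by end_near.
Qed.

(** The integral over [-m, m] is a difference of values of [F] at the end points, which tends to
    [0]; dominated convergence passes to the whole line. *)
Lemma integral_derivative0 (F G : R -> R) (C : R) :
  (forall x, is_derive (x : R) (1 : R) F (G x)) -> continuous G ->
  (forall x, `|F x| <= C * oneDsqrV x) -> (forall x, `|G x| <= C * oneDsqrV x) ->
  (\int[leb]_x (G x)%:E)%E = 0%E.
Proof.
move=> dF cG FC GC.
have cF : continuous F.
  by move=> x; apply: differentiable_continuous; apply/derivable1_diffP; case: (dF x).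
have mG : measurable_fun setT (EFin \o G).
  by apply/measurable_EFinP; exact: continuous_measurable_fun.
have mI (m : nat) : measurable (`[- m%:R, m%:R]%classic : set R) by exact: measurable_itv.
pose g (m : nat) : R -> \bar R := (EFin \o G) \_ `[- m%:R, m%:R]%classic.
have mg m : measurable_fun setT (g m).
  by apply/(measurable_restrictT _ (mI m)); exact: measurable_funTS.
have lim : (\int[leb]_x g m x)%E @[m --> \oo] --> (\int[leb]_x (G x)%:E)%E.
  have [|||_ _] := @dominated_convergence _ (measurableTypeR R) R leb setT measurableT
    g (EFin \o G) (fun x => (C * oneDsqrV x)%:E) mg mG; last exact.
  - apply: aeW => x _; apply: cvg_near_cst; near=> m; rewrite /g patchE ifT//.
    rewrite inE /= in_itv /= -ler_norml; near: m; exact: nbhs_infty_ger.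
  - rewrite (_ : (fun x => _) = (fun x => (C%:E * (EFin \o oneDsqrV) x)%E)); last first.
      by apply/funext => x; rewrite /= EFinM.
    by apply: integrableZl => //; exact: integrable_oneDsqrV.
  - apply: aeW => x m _; rewrite /g patchE; case: ifPn => _ /=.
      by rewrite lee_fin.
    by rewrite normr0 lee_fin; apply: le_trans (GC x).
apply: (cvg_unique _ lim) => //=.
rewrite (_ : (fun m => _) = (fun m => (F m%:R - F (- m%:R))%:E)); last first.
  apply/funext => m; rewrite /g -integral_mkcond.
  (* The fundamental theorem of calculus asks for a nondegenerate segment, so [m = 0] is treated
     apart. *)
  case: m => [|m].
    by rewrite oppr0 set_itv1 integral_set1 subrr.
  rewrite (@continuous_FTC2 R G F) ?EFinB//.
  - by apply: (@lt_trans _ _ 0); rewrite ?oppr_lt0 ltr0n.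
  - exact: continuous_subspaceT.
  - split.
    + by move=> x _; case: (dF x).
    + exact: cvg_at_right_filter (cF _).
    + exact: cvg_at_left_filter (cF _).
  - by move=> x _; rewrite derive1E; case: (dF x).
apply: cvg_EFin; first by near=> m.
rewrite /= -(subr0 0); apply: cvgB; apply: (@cvg_oneDsqrV_nat C) => m; first exact: FC.
by apply: (le_trans (FC _)); rewrite /oneDsqrV /oneDsqr sqrrN.
Unshelve. all: by end_near.
Qed.

End LebesgueTupleIntegral.

(** * Iterated integrals and integrals of derivatives on tuples *)

Section LebesgueTupleFubini.
Context {R : realType}.
Local Notation E n := (n.-tuple (measurableTypeR R)).
Local Notation leb := (@lebesgue_measure R).
Local Notation mu n := (lebesgue_tuple R n).

Definition tuple_cons n (p : measurableTypeR R * E n) : E n.+1 := [tuple of p.1 :: p.2].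

Lemma measurable_tuple_cons n : measurable_fun setT (@tuple_cons n).
Proof. exact: measurable_cons measurable_fst measurable_snd. Qed.

Lemma measurable_tuple_cons_r n (x : measurableTypeR R) :
  measurable_fun setT (fun t : E n => tuple_cons (x, t)).
Proof. exact: (measurable_cons (f := fun=> x) (g := id) (@measurable_cst _ _ _ _ setT _)
  (@measurable_id _ _ setT)). Qed.

Lemma ge0_integral_tupleS n (F : E n.+1 -> \bar R) : measurable_fun setT F ->
  (forall t, (0 <= F t)%E) ->
  (\int[mu n.+1]_t F t)%E = (\int[leb]_x \int[mu n]_t F (tuple_cons (x, t)))%E.
Proof.
move=> mF F0.
transitivity (\int[pushforward (leb \x mu n)%E (@tuple_cons n)]_t F t)%E => //.
rewrite (ge0_integral_pushforward (@measurable_tuple_cons n) _ measurableT)//.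
rewrite preimage_setT fubini_tonelli1//; last by move=> p; exact: F0.
exact: measurableT_comp mF (@measurable_tuple_cons n).
Qed.

Lemma integrable_tupleS n (F : E n.+1 -> \bar R) : (mu n.+1).-integrable setT F ->
  (leb \x mu n)%E.-integrable setT (F \o @tuple_cons n).
Proof.
move=> /integrableP[mF intF]; apply/integrableP; split.
  exact: measurableT_comp mF (@measurable_tuple_cons n).
apply: le_lt_trans intF.
rewrite [leRHS](_ : _ = \int[pushforward (leb \x mu n)%E (@tuple_cons n)]_t `|F t|)%E//.
rewrite (ge0_integral_pushforward (@measurable_tuple_cons n) _ measurableT)//.
exact: measurableT_comp.
Qed.

Lemma integral_tupleS_pushforward n (F : E n.+1 -> \bar R) :
  (mu n.+1).-integrable setT F ->
  (\int[mu n.+1]_t F t)%E = (\int[leb \x mu n]_p F (tuple_cons p))%E.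
Proof.
move=> iF; have mF := (integrableP _ _ _ iF).1.
transitivity (\int[pushforward (leb \x mu n)%E (@tuple_cons n)]_t F t)%E => //.
rewrite (integral_pushforward (@measurable_tuple_cons n))//.
by rewrite preimage_setT; exact: integrable_tupleS.
Qed.

Lemma integral_tupleS12 n (F : E n.+1 -> \bar R) : (mu n.+1).-integrable setT F ->
  (\int[mu n.+1]_t F t)%E = (\int[leb]_x \int[mu n]_t F (tuple_cons (x, t)))%E.
Proof.
move=> iF; rewrite integral_tupleS_pushforward//.
by rewrite -(fubini1 (integrable_tupleS iF)).
Qed.

Lemma integral_tupleS21 n (F : E n.+1 -> \bar R) : (mu n.+1).-integrable setT F ->
  (\int[mu n.+1]_t F t)%E = (\int[mu n]_t \int[leb]_x F (tuple_cons (x, t)))%E.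
Proof.
move=> iF; rewrite integral_tupleS_pushforward//.
by rewrite -(fubini2 (integrable_tupleS iF)).
Qed.

Definition weight n (t : E n) : R := \prod_(i < n) oneDsqrV (tnth t i).

Lemma weight_gt0 n (t : E n) : 0 < weight t.
Proof. by apply: prodr_gt0 => i _; exact: oneDsqrV_gt0. Qed.

Lemma weight_cons n x (t : E n) : weight (tuple_cons (x, t)) = oneDsqrV x * weight t.
Proof. by rewrite /weight big_ord_recl; congr (_ * _); apply: eq_bigr => i _; rewrite tnthS. Qed.

Lemma measurable_weight n : measurable_fun setT (@weight n).
Proof.
apply: measurable_prod => i _.
apply: (measurableT_comp (f := oneDsqrV)).
  by apply: continuous_measurable_fun; exact: oneDsqrV_continuous.
exact: measurable_tnth.
Qed.

Lemma integral_weight n : (\int[mu n]_t (weight t)%:E)%E = ((pi : R) ^+ n)%:E.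
Proof.
elim: n => [|n IH].
  rewrite integral_dirac//; last by apply/measurable_EFinP; exact: measurable_weight.
  by rewrite diracT mul1e /weight big_ord0.
rewrite ge0_integral_tupleS; last 2 first.
- by apply/measurable_EFinP; exact: measurable_weight.
- by move=> t; rewrite lee_fin ltW ?weight_gt0.
transitivity (\int[leb]_x ((pi ^+ n)%:E * (oneDsqrV x)%:E))%E.
  apply: eq_integral => x _.
  under eq_integral do rewrite weight_cons EFinM.
  rewrite ge0_integralZl//.
  - by rewrite IH muleC.
  - by apply/measurable_EFinP; exact: measurable_weight.
  - by move=> t _; rewrite lee_fin ltW ?weight_gt0.
  - by rewrite lee_fin ltW ?oneDsqrV_gt0.
rewrite ge0_integralZl//.
- by rewrite integral_oneDsqrV -EFinM exprSr.
- apply/measurable_EFinP; apply: continuous_measurable_fun; exact: oneDsqrV_continuous.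
- by move=> t _; rewrite lee_fin ltW ?oneDsqrV_gt0.
- by rewrite lee_fin exprn_ge0// pi_ge0.
Qed.

Lemma integrable_weight_bound n (F : E n -> R) (C : R) : measurable_fun setT F ->
  (forall t, `|F t| <= C * weight t) -> (mu n).-integrable setT (EFin \o F).
Proof.
move=> mF FC; apply: (@le_integrable _ _ _ _ _ measurableT _ (fun t => C%:E * (weight t)%:E)%E).
- exact/measurable_EFinP.
- move=> t _; rewrite /= lee_fin; apply: (le_trans (FC t)); exact: ler_norm.
- apply: integrableZl => //; apply/integrableP; split.
    by apply/measurable_EFinP; exact: measurable_weight.
  under eq_integral do rewrite /= ger0_norm ?(ltW (weight_gt0 _))//.
  by rewrite integral_weight ltry.
Qed.

Definition update n (t : E n) (k : 'I_n) (x : R) : E n :=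
  [tuple (if i == k then x else tnth t i) | i < n].

Lemma update_tuple_cons0 n x (t : E n) y : update (tuple_cons (x, t)) ord0 y = tuple_cons (y, t).
Proof.
apply: eq_from_tnth => i; rewrite tnth_mktuple.
by case: (unliftP ord0 i) => [j ->|->]; rewrite ?tnthS ?tnth0.
Qed.

Lemma update_tuple_consS n x (t : E n) j y :
  update (tuple_cons (x, t)) (lift ord0 j) y = tuple_cons (x, update t j y).
Proof.
apply: eq_from_tnth => i; rewrite tnth_mktuple.
case: (unliftP ord0 i) => [l ->|->]; last by rewrite !tnth0.
by rewrite !tnthS tnth_mktuple (inj_eq (@lift_inj _ ord0)).
Qed.

(** If [k] is the first coordinate, Fubini integrates it first and the one-variable lemma applies
    with constant [C * weight t]. Otherwise the first coordinate is frozen and its factor of the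
    weight joins the constant, which is why the induction generalises [C]. *)
Lemma integral_line_derivative0 n (k : 'I_n) (F G : E n -> R) (C : R) :
  measurable_fun setT G ->
  (forall t, `|F t| <= C * weight t) -> (forall t, `|G t| <= C * weight t) ->
  (forall t x, is_derive (x : R) (1 : R) (fun y => F (update t k y)) (G (update t k x))) ->
  (forall t, continuous (fun y => G (update t k y))) ->
  (\int[mu n]_t (G t)%:E)%E = 0%E.
Proof.
elim: n k F G C => [[]//|n IH] k F G C mG FC GC dF cG.
have iG := integrable_weight_bound mG GC.
have bound (H : E n.+1 -> R) x t : (forall t, `|H t| <= C * weight t) ->
    `|H (tuple_cons (x, t))| <= C * oneDsqrV x * weight t.
  by move=> HC; apply: le_trans (HC _) _; rewrite weight_cons mulrA.
case: (unliftP ord0 k) => [j kE|kE]; subst k.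
  rewrite (integral_tupleS12 iG); apply: integral0_eq => x _.
  apply: (IH j (fun t => F (tuple_cons (x, t))) (fun t => G (tuple_cons (x, t)))
    (C * oneDsqrV x)).
  - exact: measurableT_comp mG (measurable_tuple_cons_r x).
  - by move=> t; exact: bound.
  - by move=> t; exact: bound.
  - move=> t y; have := dF (tuple_cons (x, t)) y.
    by under [X in is_derive _ _ X]eq_fun do rewrite update_tuple_consS;
      rewrite update_tuple_consS.
  - move=> t; have := cG (tuple_cons (x, t)).
    by under eq_fun do rewrite update_tuple_consS.
rewrite (integral_tupleS21 iG); apply: integral0_eq => t _.
apply: (@integral_derivative0 _ (fun x => F (tuple_cons (x, t))) (fun x => G (tuple_cons
  (x, t))) (C * weight t)).
- move=> y; have := dF (tuple_cons (0, t)) y.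
  by under [X in is_derive _ _ X]eq_fun do rewrite update_tuple_cons0; rewrite update_tuple_cons0.
- have := cG (tuple_cons (0, t)).
  by under eq_fun do rewrite update_tuple_cons0.
- by move=> x; rewrite mulrAC; exact: bound.
- by move=> x; rewrite mulrAC; exact: bound.
Qed.

End LebesgueTupleFubini.

(** * Measurability of continuous functions of the coordinates *)

Section ContinuousMeasurable.
Context {R : realType}.
Local Notation E n := (n.-tuple (measurableTypeR R)).

Definition rowT n (t : E n) : 'rV[R]_n := \row_i tnth t i.

Lemma measurable_floor_fiber (c : R) (z : int) : 0 < c ->
  measurable [set x : measurableTypeR R | Num.floor (c * x) = z].
Proof.
move=> c0; rewrite (_ : [set x | _] = `[z%:~R / c, (z + 1)%:~R / c[%classic).
  exact: measurable_itv.
apply/seteqP; split => x /=; rewrite in_itv /= ler_pdivrMr// ltr_pdivlMr// mulrC.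
  by move=> <-; exact: floor_itv.
exact: floor_def.
Qed.

(* [F] is the pointwise limit of its compositions with the rounding to the grid
   of mesh [1 / (m + 1)], which take countably many values. *)
Lemma measurable_continuous_row n (F : 'rV[R]_n -> R) : continuous F ->
  measurable_fun setT (fun t : E n => F (rowT t)).
Proof.
move=> cF.
pose code m (t : E n) : n.-tuple int := [tuple Num.floor (m.+1%:R * tnth t i : R) | i < n].
pose dec m (z : n.-tuple int) : 'rV[R]_n := \row_i ((tnth z i)%:~R / m.+1%:R).
apply: (@measurable_fun_cvg _ _ _ _ (fun m t => F (dec m (code m t)))).
  move=> m _ B mB; rewrite setTI.
  rewrite (_ : _ @^-1` B = \bigcup_(z : n.-tuple int) [set t | code m t = z /\ B (F (dec m z))]).
    apply: countable_bigcupT_measurable; first exact: countableP.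
    move=> z; have [Bz|nBz] := pselect (B (F (dec m z))); last first.
      rewrite (_ : [set t | _] = set0) ?measurable0//.
      by apply/seteqP; split => t //= -[].
    rewrite (_ : [set t | _] = \bigcap_(i in [set: 'I_n])
        ((fun t : E n => tnth t i) @^-1` [set x | Num.floor (m.+1%:R * x) = tnth z i])).
      apply: fin_bigcap_measurable => // i _.
      rewrite -[X in measurable X]setTI; apply: measurable_tnth => //.
      exact: measurable_floor_fiber.
    apply/seteqP; split => t /=.
      by move=> [<- _] i _ /=; rewrite tnth_mktuple.
    move=> h; split => //; apply: eq_from_tnth => i.
    by rewrite tnth_mktuple (h i I).
  apply/seteqP; split => t /=; first by move=> Bt; exists (code m t).
  by move=> [z _ [<-]].
move=> t _; apply: (cvg_comp (fun m => dec m (code m t)) F _ (cF (rowT t))).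
move=> V /nbhs_ballP [e /= e0 sub].
near=> m; apply: sub; split => // i j; rewrite !mxE tnth_mktuple /ball /=.
have m0 : 0 < m.+1%:R :> R by [].
have /andP[h1 h2] := floor_itv (m.+1%:R * tnth t j : R).
rewrite intrD in h2.
have me : 1 < e * m.+1%:R.
  have em : e^-1 < m%:R by near: m; exact: nbhs_infty_gtr.
  rewrite -ltr_pdivrMl// mulr1; apply: (lt_trans em).
  by rewrite ltr_nat.
rewrite (_ : _ - _ = (m.+1%:R * tnth t j - (Num.floor (m.+1%:R * tnth t j))%:~R) / m.+1%:R);
  last first.
  by rewrite mulrBl mulrAC divff ?mul1r// gt_eqF.
rewrite normrM normfV (ger0_norm (ltW m0)) ltr_pdivrMr//; apply: lt_trans me.
by rewrite ger0_norm; lra.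
Unshelve. all: by end_near.
Qed.

End ContinuousMeasurable.

(** * Integration by parts between moderate and rapidly decreasing functions *)

Section RapidDecay.
Context {R : realType}.
Local Open Scope complex_scope.
Local Notation E n := (n.-tuple (measurableTypeR R)).
Local Notation mu n := (lebesgue_tuple R n).
Local Notation Re := complex.Re.
Local Notation Im := complex.Im.

Section Fixed.
Context {n : nat}.
Implicit Types (f g u v : 'rV[R]_n -> R[i]).

Definition ccontinuous f := continuous (fun x => Re (f x)) /\ continuous (fun x => Im (f x)).

Definition has_partial (k : 'I_n) f f' := forall x : 'rV[R]_n,
  is_derive x (delta_mx 0 k : 'rV[R]_n) (fun y => Re (f y)) (Re (f' x)) /\
  is_derive x (delta_mx 0 k : 'rV[R]_n) (fun y => Im (f y)) (Im (f' x)).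

(** The class of multipliers of rapid functions. Only continuity is built in, so that kernels of
    finite regularity fit; derivatives are supplied separately through [has_partial]. *)
Definition moderate u := ccontinuous u /\
  exists m (C : R), forall x, `|u x| <= (C * (1 + `|x|) ^+ m)%:C.

Definition rapid f := ccontinuous f /\
  forall N, exists M : R, forall x, ((1 + `|x|) ^+ N)%:C * `|f x| <= M%:C.

Lemma complex_ReM (a b : R[i]) : Re (a * b) = Re a * Re b - Im a * Im b.
Proof. by case: a => ? ?; case: b. Qed.

Lemma complex_ImM (a b : R[i]) : Im (a * b) = Re a * Im b + Im a * Re b.
Proof. by case: a => ? ?; case: b. Qed.

Lemma complex_ReD (a b : R[i]) : Re (a + b) = Re a + Re b.
Proof. by case: a => ? ?; case: b. Qed.

Lemma complex_ImD (a b : R[i]) : Im (a + b) = Im a + Im b.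
Proof. by case: a => ? ?; case: b. Qed.

Lemma ccontinuousM f g : ccontinuous f -> ccontinuous g -> ccontinuous (fun x => f x * g x).
Proof.
move=> [f1 f2] [g1 g2]; split => x.
  under eq_fun do rewrite complex_ReM.
  exact: (cvgB (cvgM (f1 x) (g1 x)) (cvgM (f2 x) (g2 x))).
under eq_fun do rewrite complex_ImM.
exact: (cvgD (cvgM (f1 x) (g2 x)) (cvgM (f2 x) (g1 x))).
Qed.

Lemma ccontinuousD f g : ccontinuous f -> ccontinuous g -> ccontinuous (fun x => f x + g x).
Proof.
move=> [f1 f2] [g1 g2]; split => x.
  under eq_fun do rewrite raddfD.
  exact: (cvgD (f1 x) (g1 x)).
under eq_fun do rewrite raddfD.
exact: (cvgD (f2 x) (g2 x)).
Qed.

Lemma has_partialM k f f' g g' : has_partial k f f' -> has_partial k g g' ->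
  has_partial k (fun x => f x * g x) (fun x => f' x * g x + f x * g' x).
Proof.
move=> df dg x; have [f1 f2] := df x; have [g1 g2] := dg x; split.
  under [X in is_derive _ _ X]eq_fun do rewrite complex_ReM.
  by rewrite complex_ReD !complex_ReM; apply: is_derive_eq; rewrite /GRing.scale /=; ring.
under [X in is_derive _ _ X]eq_fun do rewrite complex_ImM.
by rewrite complex_ImD !complex_ImM; apply: is_derive_eq; rewrite /GRing.scale /=; ring.
Qed.

Lemma onePnorm_gt0 (x : 'rV[R]_n) m : 0 < (1 + `|x|) ^+ m.
Proof. by rewrite exprn_gt0// ltr_pwDl. Qed.

Lemma moderate_rapid u f : moderate u -> rapid f -> rapid (fun x => u x * f x).
Proof.
move=> [cu [m [C HC]]] [cf rf]; split; first exact: ccontinuousM.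
move=> N; have [M HM] := rf (N + m)%N; exists (C * M) => x.
rewrite normrM mulrCA; have h := HC x.
apply: (@le_trans _ _ ((C * (1 + `|x|) ^+ m)%:C * (((1 + `|x|) ^+ N)%:C * `|f x|))).
  by rewrite ler_wpM2r// mulr_ge0// lecR ltW// onePnorm_gt0.
have C0 : 0 <= C.
  have := le_trans (normr_ge0 _) h; rewrite lecR pmulr_lge0//; exact: onePnorm_gt0.
rewrite [leLHS](_ : _ = C%:C * (((1 + `|x|) ^+ (N + m))%:C * `|f x|)).
  by rewrite rmorphM ler_wpM2l// lecR.
by rewrite exprD !rmorphM /=; ring.
Qed.

Lemma rapidD f g : rapid f -> rapid g -> rapid (fun x => f x + g x).
Proof.
move=> [cf rf] [cg rg]; split; first exact: ccontinuousD.
move=> N; have [M HM] := rf N; have [M' HM'] := rg N; exists (M + M') => x.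
apply: (@le_trans _ _ (((1 + `|x|) ^+ N)%:C * `|f x| + ((1 + `|x|) ^+ N)%:C * `|g x|)).
  by rewrite -mulrDr ler_wpM2l ?ler_normD// lecR ltW// onePnorm_gt0.
by rewrite rmorphD lerD.
Qed.

Lemma rowT_coord_le (t : E n) i : `|tnth t i : R| <= `|rowT t|.
Proof. by have := rV_coord_le_norm (rowT t) i; rewrite mxE. Qed.

(** Every factor [1 + x_i ^ 2] is at most [(1 + |x|) ^ 2], so that decay of order [2 * n] suffices
    for domination by [weight]. *)
Lemma weight_lower (t : E n) : 1 <= (1 + `|rowT t|) ^+ (2 * n) * weight t.
Proof.
rewrite exprM /weight.
have -> : (1 + `|rowT t|) ^+ 2 ^+ n = \prod_(i < n) (1 + `|rowT t|) ^+ 2.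
  by rewrite prodr_const card_ord.
rewrite -big_split /=.
apply: (big_ind (fun y : R => 1 <= y)) => // [x y x1 y1|i _].
  by rewrite -[leLHS]mulr1 ler_pM.
rewrite /oneDsqrV ler_pdivlMr ?mul1r; last by rewrite (lt_le_trans ltr01)// oneDsqr_ge1.
have := rowT_coord_le t i; set a := tnth t i; set b := `|rowT t| => ab.
have a0 : a ^+ 2 <= b ^+ 2.
  by rewrite -(real_normK (num_real a)) lerXn2r ?nnegrE// normr_ge0.
have b0 : 0 <= b by exact: normr_ge0.
rewrite /oneDsqr sqrrD; nra.
Qed.

Lemma rapid_weight f : rapid f -> exists C : R, forall t : E n,
  `|Re (f (rowT t))| <= C * weight t /\ `|Im (f (rowT t))| <= C * weight t.
Proof.
move=> [_ rf]; have [M HM] := rf (2 * n)%N; exists M => t.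
have key : `|f (rowT t)| <= (M * weight t)%:C.
  have := HM (rowT t); set A := (1 + _) ^+ _; set B := `|f _| => h.
  have A0 : 0 < A by exact: onePnorm_gt0.
  have w0 := weight_gt0 t.
  have B0 : 0 <= B by exact: normr_ge0.
  rewrite rmorphM /=; apply: (@le_trans _ _ (A%:C * B * (weight t)%:C)); last first.
    by rewrite ler_wpM2r// lecR ltW.
  rewrite mulrAC -rmorphM /= ler_peMl//.
  by rewrite lecR; exact: weight_lower.
by split; rewrite -lecR; apply: le_trans key; [exact: normc_ge_Re|exact: normc_ge_Im].
Qed.

Lemma rapid_integrable f : rapid f ->
  (mu n).-integrable setT (fun t : E n => (Re (f (rowT t)))%:E) /\
  (mu n).-integrable setT (fun t : E n => (Im (f (rowT t)))%:E).
Proof.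
move=> rf; have [C HC] := rapid_weight rf; have [[c1 c2] _] := rf.
split; apply: (integrable_weight_bound (C := C)).
- exact: measurable_continuous_row c1.
- by move=> t; case: (HC t).
- exact: measurable_continuous_row c2.
- by move=> t; case: (HC t).
Qed.

Lemma cintegralD f g : rapid f -> rapid g ->
  cintegral (fun x => f x + g x) = cintegral f + cintegral g.
Proof.
move=> /rapid_integrable[f1 f2] /rapid_integrable[g1 g2]; rewrite /cintegral.
under eq_Rintegral do rewrite raddfD.
rewrite RintegralD//.
under [X in _ +i* X = _]eq_Rintegral do rewrite raddfD.
by rewrite RintegralD.
Qed.

Lemma cintegralZ (a : R[i]) f : rapid f ->
  cintegral (fun x => a * f x) = a * cintegral f.
Proof.
move=> /rapid_integrable[f1 f2]; rewrite /cintegral.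
under eq_Rintegral do rewrite complex_ReM.
under [X in _ +i* X = _]eq_Rintegral do rewrite complex_ImM.
have iz (b : R) (F : E n -> R) : (mu n).-integrable setT (fun t => (F t)%:E) ->
    (mu n).-integrable setT (fun t => (b * F t)%:E).
  by move=> iF; under eq_fun do rewrite EFinM; exact: integrableZl.
rewrite RintegralB//; [|exact: iz|exact: iz].
rewrite RintegralD//; [|exact: iz|exact: iz].
by rewrite !RintegralZl//; case: a.
Qed.

Lemma is_derive_update k (F : 'rV[R]_n -> R) (F' : R) (t : E n) (y : R) :
  is_derive (rowT (update t k y)) (delta_mx 0 k : 'rV[R]_n) F F' ->
  is_derive (y : R) (1 : R) (fun y => F (rowT (update t k y))) F'.
Proof.
have eqq : (fun h : R => h^-1 *: (((fun y : R => F (rowT (update t k y))) \o shift y) (h *: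
  (1 : R))
      - F (rowT (update t k y)))) =
   (fun h : R => h^-1 *: ((F \o shift (rowT (update t k y))) (h *: (delta_mx 0 k : 'rV[R]_n))
      - F (rowT (update t k y)))).
  apply/funext => h; congr (_ *: (F _ - _)); apply/rowP => i.
  rewrite !mxE !tnth_mktuple eqxx /=; case: eqP => _; rewrite ?mulr0 ?add0r//.
move=> [d1 d2]; split; first by rewrite /derivable eqq.
by rewrite /derive eqq.
Qed.

Lemma continuous_rowT_update k (t : E n) : continuous (fun y : R => rowT (update t k y)).
Proof.
move=> y V /nbhs_ballP [e /= e0 sub]; apply/nbhs_ballP; exists e => //= z yz.
apply: sub; split => // i j; rewrite !mxE !tnth_mktuple.
by case: eqP => // _; exact: ballxx.
Qed.

Lemma cintegral_partial0 k f f' : rapid f -> rapid f' -> has_partial k f f' ->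
  cintegral f' = 0.
Proof.
move=> rf rf' df; have [C HC] := rapid_weight rf; have [C' HC'] := rapid_weight rf'.
have [[c1 c2] _] := rf'.
pose M := Num.max C C'.
have bd (a b : R) : a <= b -> forall t : E n, a * weight t <= b * weight t.
  by move=> ab t; rewrite ler_wpM2r// ltW// weight_gt0.
have hC : C <= M by rewrite le_max lexx.
have hC' : C' <= M by rewrite le_max lexx orbT.
have z (p : R[i] -> R) : continuous (fun x => p (f' x)) ->
    (forall t : E n, `|p (f (rowT t))| <= C * weight t) ->
    (forall t : E n, `|p (f' (rowT t))| <= C' * weight t) ->
    (forall x, is_derive x (delta_mx 0 k : 'rV[R]_n) (fun y => p (f y)) (p (f' x))) ->
    (\int[mu n]_t (p (f' (rowT t)))%:E = 0)%E.
  move=> c fC fC' dp.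
  apply: (@integral_line_derivative0 _ n k (fun t => p (f (rowT t))) (fun t => p (f'
    (rowT t))) M).
  - exact: measurable_continuous_row c.
  - by move=> t; exact: le_trans (bd _ _ hC t).
  - by move=> t; exact: le_trans (bd _ _ hC' t).
  - by move=> t x; apply: (is_derive_update (F := fun x => p (f x))).
  - move=> t x; apply: (cvg_comp (fun y => rowT (update t k y)) (fun x => p (f' x))).
      exact: continuous_rowT_update.
    exact: c.
rewrite /cintegral /Rintegral.
have -> : (\int[mu n]_x (Re (f' (\row_i tnth x i)))%:E = 0)%E.
  by apply: (z _ c1) => x; [case: (HC x)|case: (HC' x)|case: (df x)].
have -> : (\int[mu n]_x (Im (f' (\row_i tnth x i)))%:E = 0)%E.
  by apply: (z _ c2) => x; [case: (HC x)|case: (HC' x)|case: (df x)].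
by [].
Qed.

Lemma cintegral_by_parts k u u' f f' : moderate u -> moderate u' -> rapid f -> rapid f' ->
  has_partial k u u' -> has_partial k f f' ->
  cintegral (fun x => u x * f' x) = - cintegral (fun x => u' x * f x).
Proof.
move=> mu mu' rf rf' du df; apply/eqP; rewrite -addr_eq0 addrC; apply/eqP.
rewrite -cintegralD; try exact: moderate_rapid.
apply: cintegral_partial0 (moderate_rapid mu rf) _ (has_partialM du df).
by apply: rapidD; exact: moderate_rapid.
Qed.

Lemma schwartz_has_partial k f : schwartz f -> has_partial k f (partial k f).
Proof.
by move=> [sf _] x; have [d1 d2] := sf [::] x; split; apply: DeriveDef => //;
  exact: diff_derivable.
Qed.

Lemma schwartz_rapid f : schwartz f -> rapid f.
Proof.
move=> [sf bf]; split.
  by split => x; have [d1 d2] := sf [::] x; exact: differentiable_continuous.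
by move=> N; have [M HM] := bf N; exists M => x; exact: (HM [::]).
Qed.

End Fixed.
End RapidDecay.

(** * The kernels where they are of class C^2 *)

Section ComplexPowers.
Context {R : realType}.
Local Open Scope complex_scope.
Local Notation Re := complex.Re.
Local Notation Im := complex.Im.

Lemma cpowD (t : R) (a b : R[i]) : cpow t (a + b) = cpow t a * cpow t b.
Proof.
rewrite /cpow complex_ReD complex_ImD !mulrDl expRD cosD sinD rmorphM mulrACA; congr (_ * _).
by apply/eqP; rewrite eq_complex /= eqxx /= addrC.
Qed.

Lemma cpow1 (t : R) : 0 < t -> cpow t 1 = t%:C.
Proof.
move=> t0; rewrite /cpow /= mul1r mul0r cos0 sin0 lnK ?posrE//.
by rewrite -[X in _ * X]/(1%:C) mulr1.
Qed.

Lemma norm_cpow (t : R) (a : R[i]) : `|cpow t a| = (expR (Re a * ln t))%:C.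
Proof.
rewrite /cpow normrM !normc_def /= expr0n addr0 sqrtr_sqr gtr0_norm ?expR_gt0//.
by rewrite cos2Dsin2 sqrtr1 mulr1.
Qed.

(* The power [|t|^a] (for [true]) or [sgn t |t|^a] (for [false]), extended by
   [0] at [t = 0]. *)
Definition spow (s : bool) (a : R[i]) (t : R) : R[i] :=
  if t == 0 then 0 else (if s then 1 else (Num.sg t)%:C) * cpow `|t| a.

Lemma spow0 s a : spow s a 0 = 0.
Proof. by rewrite /spow eqxx. Qed.

Lemma spow_pos s a t : 0 < t -> spow s a t = cpow t a.
Proof. by move=> t0; rewrite /spow gt_eqF// gtr0_norm// gtr0_sg//; case: s; rewrite mul1r. Qed.

Lemma spowN s a t : spow s a (- t) = (if s then 1 else -1) * spow s a t.
Proof.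
rewrite /spow oppr_eq0 normrN sgrN; case: ifP => _; first by rewrite mulr0.
by case: s; rewrite ?mul1r// rmorphN !mulNr mul1r.
Qed.

Lemma spow_neg s a t : t < 0 -> spow s a t = (if s then 1 else -1) * cpow (- t) a.
Proof. by move=> t0; rewrite -[in LHS](opprK t) spowN spow_pos ?oppr_gt0. Qed.

(** Multiplication by [t] and differentiation both flip the parity, which is the source of the
    exchange of K^+ and K^-. The value [0] at the origin makes the rule hold there too. *)
Lemma spow_mulx s a t : t%:C * spow s a t = spow (~~ s) (a + 1) t.
Proof.
have [t0|t0|->] := ltgtP t 0.
- rewrite !spow_neg// cpowD cpow1 ?oppr_gt0// rmorphN /=.
  by case: s => /=; ring.
- by rewrite !spow_pos// cpowD cpow1// mulrC.
- by rewrite !spow0 mulr0.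
Qed.

Lemma spow_true_ge0 s a t : 0 <= t -> spow s a t = spow true a t.
Proof. by rewrite le_eqVlt => /predU1P[<-|t0]; rewrite ?spow0// !spow_pos. Qed.

Lemma norm_spow s a t : t != 0 -> `|spow s a t| = (expR (Re a * ln `|t|))%:C.
Proof.
move=> t0; rewrite /spow (negbTE t0) normrM norm_cpow.
case: s; rewrite ?normr1 ?mul1r//.
by rewrite normc_def /= expr0n addr0 sqrtr_sqr normr_sg t0 mul1r.
Qed.

Lemma norm_spow_le s (a : R[i]) t m : 0 <= Re a -> Re a <= m%:R ->
  `|spow s a t| <= ((1 + `|t|) ^+ m)%:C.
Proof.
move=> a0 am; have t1 : 1 <= 1 + `|t| by rewrite lerDl.
have [->|t0] := eqVneq t 0; first by rewrite spow0 normr0 lecR exprn_ge0// addr_ge0.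
have tp : 0 < `|t| by rewrite normr_gt0.
rewrite norm_spow// lecR -[leRHS](@lnK R) ?posrE ?exprn_gt0 ?(lt_le_trans ltr01 t1)//.
rewrite ler_expR lnXn ?(lt_le_trans ltr01 t1)// -mulr_natl.
apply: (@le_trans _ _ (Re a * ln (1 + `|t|))).
  by rewrite ler_wpM2l// ler_ln ?posrE ?(lt_le_trans ltr01 t1)// lerDr.
by rewrite ler_wpM2r// ln_ge0.
Qed.

Lemma norm_spow_near0 s (a : R[i]) t : 2 <= Re a -> `|t| <= 1 -> `|spow s a t| <= (`|t| ^+ 2)%:C.
Proof.
move=> a2 t1; have [->|t0] := eqVneq t 0; first by rewrite spow0 !normr0 lecR exprn_ge0.
have tp : 0 < `|t| by rewrite normr_gt0.
rewrite norm_spow// lecR -[leRHS](@lnK R) ?posrE ?exprn_gt0//.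
rewrite ler_expR lnXn// -mulr_natl ler_wnM2r// ln_le0//.
Qed.

Lemma is_derive_cpow a t : 0 < t ->
  is_derive (t : R) (1 : R) (fun t => Re (cpow t a)) (Re (a * cpow t (a - 1))) /\
  is_derive (t : R) (1 : R) (fun t => Im (cpow t a)) (Im (a * cpow t (a - 1))).
Proof.
move=> t0; have dl := is_derive1_ln t0.
have -> : cpow t (a - 1) = (t^-1)%:C * cpow t a.
  have h : cpow t a = t%:C * cpow t (a - 1) by rewrite -{1}(subrK 1 a) (cpowD _
    (a - 1) 1) cpow1// mulrC.
  by rewrite h mulrA -rmorphM /= mulVf ?gt_eqF// mul1r.
rewrite /cpow; case: a => p q /=.
have dA : is_derive (t : R) (1 : R) (fun t : R => p * ln t) (p * t^-1).
  by apply: is_derive_eq; rewrite /GRing.scale.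
have dB : is_derive (t : R) (1 : R) (fun t : R => q * ln t) (q * t^-1).
  by apply: is_derive_eq; rewrite /GRing.scale.
have dE := is_derive1_comp (f := expR) (g := fun t : R => p * ln t) (is_derive_expR
  (p * ln t)) dA.
have dC := is_derive1_comp (f := cos) (g := fun t : R => q * ln t) (is_derive_cos (q * ln t)) dB.
have dS := is_derive1_comp (f := sin) (g := fun t : R => q * ln t) (is_derive_sin (q * ln t)) dB.
rewrite /comp in dE dC dS.
split.
  under [X in is_derive _ _ X]eq_fun do rewrite mul0r subr0.
  by apply: is_derive_eq; rewrite /GRing.scale /=; ring.
under [X in is_derive _ _ X]eq_fun do rewrite mul0r addr0.
by apply: is_derive_eq; rewrite /GRing.scale /=; ring.
Qed.

(** The half-line [t < 0] is reduced to [t > 0] by parity. At [0] the quadratic bound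
    [norm_spow_near0] gives derivative [0], in agreement with the convention for [spow] there. *)
Lemma is_derive_spow s (a : R[i]) t : 2 <= Re a ->
  is_derive (t : R) (1 : R) (fun t => Re (spow s a t)) (Re (a * spow (~~ s) (a - 1) t)) /\
  is_derive (t : R) (1 : R) (fun t => Im (spow s a t)) (Im (a * spow (~~ s) (a - 1) t)).
Proof.
move=> a2.
have pos (u : R) s' : 0 < u ->
  is_derive (u : R) (1 : R) (fun t => Re (spow s' a t)) (Re (a * cpow u (a - 1))) /\
  is_derive (u : R) (1 : R) (fun t => Im (spow s' a t)) (Im (a * cpow u (a - 1))).
  move=> u0; have [d1 d2] := is_derive_cpow a u0.
  have nr : \forall y \near u, spow s' a y = cpow y a.
    by near=> y; rewrite spow_pos//; near: y; exact: lt_nbhsr.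
  split; [apply: near_eq_is_derive d1|apply: near_eq_is_derive d2];
    by near=> y; rewrite (near nr y).
have [t0|t0|->] := ltgtP t 0.
- have [d1 d2] := pos (- t) s ltac:(by rewrite oppr_gt0).
  have dN : is_derive (t : R) (1 : R) (fun t : R => - t) (-1) by apply: is_derive_eq.
  have c1 := is_derive1_comp d1 dN; have c2 := is_derive1_comp d2 dN.
  have e y : spow s a y = (if s then 1 else -1) * spow s a (- y).
    by have := spowN s a (- y); rewrite opprK.
  have e' : spow (~~ s) (a - 1) t = (if s then -1 else 1) * cpow (- t) (a - 1).
    by rewrite spow_neg//; case: (s).
  rewrite e'; split.
    rewrite (_ : (fun t => Re _) = (fun y => (if s then 1 else -1) * ((fun t => Re
      (spow s a t)) \o (fun t => - t)) y)); last first.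
      by apply/funext => y /=; rewrite [in LHS]e; case: (s) (spow _ _ _) => -[? ?] /=; ring.
    apply: is_derive_eq; rewrite /GRing.scale /=.
    by case: (s); rewrite ?mulN1r ?mul1r ?mulrN ?mulr1 ?raddfN ?opprK.
  rewrite (_ : (fun t => Im _) = (fun y => (if s then 1 else -1) * ((fun t => Im
    (spow s a t)) \o (fun t => - t)) y)); last first.
    by apply/funext => y /=; rewrite [in LHS]e; case: (s) (spow _ _ _) => -[? ?] /=; ring.
  apply: is_derive_eq; rewrite /GRing.scale /=.
  by case: (s); rewrite ?mulN1r ?mul1r ?mulrN ?mulr1 ?raddfN ?opprK.
- by rewrite spow_pos//; exact: pos.
- rewrite spow0 mulr0 /=.
  have key (p : R[i] -> R) : p 0 = 0 -> (forall z, `|p z|%:C <= `|z|) ->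
      is_derive (0 : R) (1 : R) (fun t => p (spow s a t)) 0.
    move=> p0 pz; apply/(is_derive1_epsP (fun t : R^o => p (spow s a t) : R^o)) => e e0.
    exists (Num.min 1 e); first by rewrite lt_min ltr01.
    move=> h; rewrite lt_min => /andP[h1 he].
    rewrite add0r spow0 p0 mul0r !subr0 -lecR; apply: le_trans (pz _) _.
    apply: le_trans (norm_spow_near0 _ a2 (ltW h1)) _.
    by rewrite lecR expr2 ler_wpM2r// ltW.
  by split; apply: key => // z; [exact: normc_ge_Re|exact: normc_ge_Im].
Unshelve. all: by end_near.
Qed.

Lemma continuous_spow s (a : R[i]) : 2 <= Re a ->
  continuous (fun t : R => Re (spow s a t)) /\ continuous (fun t : R => Im (spow s a t)).
Proof.
move=> a2; split => t; have [[d1 _] [d2 _]] := is_derive_spow s t a2.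
  by apply: differentiable_continuous; exact/derivable1_diffP.
by apply: differentiable_continuous; exact/derivable1_diffP.
Qed.

End ComplexPowers.

(** * Partial derivatives and growth of powers of x_n and of |x|^2 *)

Section PartialCalculus.
Context {R : realType}.
Local Open Scope complex_scope.
Local Notation Re := complex.Re.
Local Notation Im := complex.Im.

(** Directional derivatives become derivatives in one real variable, so the scalar chain rule
    applies without total differentiability. *)
Lemma is_derive_lineP {V : normedModType R} (F : V -> R) (x v : V) (l : R) :
  is_derive x v F l <-> is_derive (0 : R) (1 : R) (fun h : R => F (h *: v + x)) l.
Proof.
have e : (fun h : R => h^-1 *: (((fun h : R => F (h *: v + x)) \o shift 0) (h *: (1 : R))
      - F ((0 : R) *: v + x))) =
   (fun h : R => h^-1 *: ((F \o shift x) (h *: v) - F x)).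
  by apply/funext => h; rewrite /= addr0 scale0r add0r /GRing.scale /= mulr1.
split=> -[d1 d2]; split.
- by rewrite /derivable e.
- by rewrite /derive e.
- by rewrite /derivable -e.
- by rewrite /derive -e.
Qed.

Lemma is_derive_comp_line {V : normedModType R} (p : R -> R) (F : V -> R) (x v : V) (p' l : R) :
  is_derive (F x) (1 : R) p p' -> is_derive x v F l ->
  is_derive x v (fun y => p (F y)) (p' * l).
Proof.
move=> dp /is_derive_lineP dF; apply/is_derive_lineP.
apply: (is_derive1_comp (f := p) (g := fun h : R => F (h *: v + x))) dF.
by rewrite scale0r add0r.
Qed.

Section Dimension.
Context {n : nat}.
Implicit Types (f g u v : 'rV[R]_n -> R[i]) (k j : 'I_n).

Lemma has_partial_eq k f f' f'' : has_partial k f f' -> f' =1 f'' -> has_partial k f f''.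
Proof. by move=> df e x; rewrite -e; exact: df. Qed.

Lemma has_partialD k f f' g g' : has_partial k f f' -> has_partial k g g' ->
  has_partial k (fun x => f x + g x) (fun x => f' x + g' x).
Proof.
move=> df dg x; have [f1 f2] := df x; have [g1 g2] := dg x; split.
  by under [X in is_derive _ _ X]eq_fun do rewrite complex_ReD; rewrite complex_ReD;
    apply: is_derive_eq.
by under [X in is_derive _ _ X]eq_fun do rewrite complex_ImD; rewrite complex_ImD;
  apply: is_derive_eq.
Qed.

Lemma has_partial_cst k (c : R[i]) : has_partial k (fun _ : 'rV[R]_n => c) (fun=> 0).
Proof. by move=> x; split; exact: is_derive_cst. Qed.

Lemma has_partialZ k (c : R[i]) f f' : has_partial k f f' ->
  has_partial k (fun x => c * f x) (fun x => c * f' x).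
Proof.
move=> df; apply: has_partial_eq (has_partialM (has_partial_cst k c) df) _ => x.
by rewrite mul0r add0r.
Qed.

Lemma is_derive_coord (x v : 'rV[R]_n) j :
  is_derive x v (fun y : 'rV[R]_n => y ord0 j : R) (v ord0 j).
Proof.
by apply: DeriveDef; [apply: diff_derivable; exact: differentiable_coord|exact: derive_coord].
Qed.

Lemma has_partial_coord k j :
  has_partial k (fun x : 'rV[R]_n => (x ord0 j)%:C) (fun=> (j == k)%:R).
Proof.
move=> x; split => /=; last by rewrite (_ : Im _ = 0); [exact: is_derive_cst|case: eqP].
apply: is_derive_eq (is_derive_coord _ _ _) _.
by rewrite mxE eqxx /=; case: eqP.
Qed.

Lemma has_partial_comp k (p p' : R -> R[i]) (F F' : 'rV[R]_n -> R) :
  (forall t, is_derive (t : R) (1 : R) (fun t => Re (p t)) (Re (p' t)) /\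
             is_derive (t : R) (1 : R) (fun t => Im (p t)) (Im (p' t))) ->
  (forall x, is_derive x (delta_mx 0 k : 'rV[R]_n) F (F' x)) ->
  has_partial k (fun x => p (F x)) (fun x => (F' x)%:C * p' (F x)).
Proof.
move=> dp dF x; have [p1 p2] := dp (F x); split.
  apply: is_derive_eq (is_derive_comp_line p1 (dF x)) _.
  by rewrite Re_realM mulrC.
apply: is_derive_eq (is_derive_comp_line p2 (dF x)) _.
by rewrite Im_realM mulrC.
Qed.

Definition sqnorm (x : 'rV[R]_n) : R := \sum_(i < n) x ord0 i ^+ 2.

Lemma sqnorm_ge0 x : 0 <= sqnorm x.
Proof. by apply: sumr_ge0 => i _; exact: sqr_ge0. Qed.

Lemma is_derive_sqnorm k (x : 'rV[R]_n) :
  is_derive x (delta_mx 0 k : 'rV[R]_n) sqnorm (2 * x ord0 k).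
Proof.
have -> : sqnorm = \sum_(i < n) (fun x : 'rV[R]_n => x ord0 i ^+ 2).
  by apply/funext => y; rewrite fct_sumE.
apply: is_derive_eq.
  apply: is_derive_sum => i.
  have dc := is_derive_coord x (delta_mx 0 k) i.
  rewrite (_ : (fun x : 'rV[R]_n => _) =
    (fun x : 'rV[R]_n => x ord0 i) * (fun x : 'rV[R]_n => x ord0 i)); last first.
    by apply/funext => y; rewrite expr2.
  exact: is_deriveM.
rewrite (bigD1 k)//= big1 => [|i ik].
  by rewrite !mxE !eqxx /= addr0 /GRing.scale /= !mulr1 mulr2n mulrDl mul1r.
by rewrite !mxE (negbTE ik) andbF /GRing.scale /= !mulr0 addr0.
Qed.

Lemma continuous_sqnorm : continuous sqnorm.
Proof.
move=> x; apply: differentiable_continuous.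
have -> : sqnorm = \sum_(i < n) (fun x : 'rV[R]_n => x ord0 i ^+ 2).
  by apply/funext => y; rewrite fct_sumE.
apply: differentiable_sum => i.
rewrite (_ : (fun x : 'rV[R]_n => _) =
    (fun x : 'rV[R]_n => x ord0 i) * (fun x : 'rV[R]_n => x ord0 i)); last first.
  by apply/funext => y; rewrite expr2.
by apply: differentiableM; exact: differentiable_coord.
Qed.

(** The norm on row vectors is the maximum norm, hence the dimension in the constant. *)
Lemma sqnorm_le x : 1 + sqnorm x <= n.+1%:R * (1 + `|x|) ^+ 2.
Proof.
have h : sqnorm x <= n%:R * (1 + `|x|) ^+ 2.
  rewrite -[n in n%:R]card_ord mulr_natl -sumr_const; apply: ler_sum => i _.
  rewrite -(real_normK (num_real _)) lerXn2r ?nnegrE ?addr_ge0//.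
  by apply: le_trans (rV_coord_le_norm x i) _; rewrite lerDr.
rewrite -natr1 mulrDl mul1r addrC lerD// exprn_ege1// lerDl//.
Qed.

Lemma moderate_ge0 u m (C : R) : (forall x, `|u x| <= (C * (1 + `|x|) ^+ m)%:C) -> 0 <= C.
Proof.
move=> /(_ 0) h; have := le_trans (normr_ge0 _) h.
by rewrite lecR pmulr_lge0//; exact: onePnorm_gt0.
Qed.

Lemma moderateM u v : moderate u -> moderate v -> moderate (fun x => u x * v x).
Proof.
move=> [cu [m [C HC]]] [cv [m' [C' HC']]]; split; first exact: ccontinuousM.
exists (m + m')%N, (C * C') => x.
rewrite normrM exprD mulrACA rmorphM /=; exact: ler_pM.
Qed.

Lemma moderateD u v : moderate u -> moderate v -> moderate (fun x => u x + v x).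
Proof.
move=> [cu [m [C HC]]] [cv [m' [C' HC']]]; split; first exact: ccontinuousD.
have C0 := moderate_ge0 HC; have C'0 := moderate_ge0 HC'.
exists (m + m')%N, (C + C') => x; apply: (le_trans (ler_normD _ _)).
apply: (le_trans (lerD (HC x) (HC' x))); rewrite -rmorphD /= lecR mulrDl.
have x1 : 1 <= 1 + `|x| by rewrite lerDl.
by apply: lerD; rewrite ler_wpM2l// ler_weXn2l// ?leq_addr ?leq_addl.
Qed.

Lemma moderate_cst (c : R[i]) : moderate (fun _ : 'rV[R]_n => c).
Proof.
split; first by split; exact: cst_continuous.
by exists 0%N, (Re `|c|) => x; rewrite expr0 mulr1 -normcE.
Qed.

Lemma moderate_coord j : moderate (fun x : 'rV[R]_n => (x ord0 j)%:C).
Proof.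
split; first by split; [exact: coord_continuous|exact: cst_continuous].
exists 1%N, 1 => x; rewrite expr1 mul1r normc_def /= expr0n addr0 sqrtr_sqr lecR.
by apply: le_trans (rV_coord_le_norm x j) _; rewrite lerDr.
Qed.

Lemma truncn_bound (t : R) : 0 <= t -> exists m, t <= m%:R.
Proof. by move=> t0; exists (Num.truncn t).+1; exact/ltW/truncnS_gt. Qed.

Lemma moderate_spow_coord s (a : R[i]) j : 2 <= Re a ->
  moderate (fun x : 'rV[R]_n => spow s a (x ord0 j)).
Proof.
move=> a2; have a0 : 0 <= Re a by exact: le_trans a2.
have [c1 c2] := continuous_spow s a2; split.
  split => x.
    exact: (continuous_comp (f := fun x : 'rV[R]_n => x ord0 j) (g := fun t => Re
      (spow s a t)) (@coord_continuous _ _ _ _ _ x) (c1 _)).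
  exact: (continuous_comp (f := fun x : 'rV[R]_n => x ord0 j) (g := fun t => Im (spow s a t))
    (@coord_continuous _ _ _ _ _ x) (c2 _)).
have [m am] := truncn_bound a0; exists m, 1 => x; rewrite mul1r.
apply: le_trans (norm_spow_le _ _ a0 am) _; rewrite lecR lerXn2r ?nnegrE ?addr_ge0//.
by rewrite lerD2l rV_coord_le_norm.
Qed.

Lemma moderate_spow_sqnorm (b : R[i]) : 2 <= Re b ->
  moderate (fun x : 'rV[R]_n => spow true b (sqnorm x)).
Proof.
move=> b2; have b0 : 0 <= Re b by exact: le_trans b2.
have [c1 c2] := continuous_spow true b2; split.
  split => x.
    exact: (continuous_comp (f := sqnorm) (g := fun t => Re (spow true b t))
      (@continuous_sqnorm x) (c1 _)).
  exact: (continuous_comp (f := sqnorm) (g := fun t => Im (spow true b t))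
    (@continuous_sqnorm x) (c2 _)).
have [m bm] := truncn_bound b0; exists (2 * m)%N, (n.+1%:R ^+ m) => x.
apply: le_trans (norm_spow_le _ _ b0 bm) _; rewrite lecR exprM -exprMn.
rewrite lerXn2r ?nnegrE ?addr_ge0// ?mulr_ge0 ?exprn_ge0 ?addr_ge0//.
by rewrite ger0_norm ?sqnorm_ge0// sqnorm_le.
Qed.

Lemma has_partial_spow_coord k s (a : R[i]) j : 2 <= Re a ->
  has_partial k (fun x : 'rV[R]_n => spow s a (x ord0 j))
    (fun x => (j == k)%:R * (a * spow (~~ s) (a - 1) (x ord0 j))).
Proof.
move=> a2.
apply: has_partial_eq (has_partial_comp (fun t => is_derive_spow s t a2)
  (fun x => is_derive_coord x (delta_mx 0 k) j)) _ => x.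
by rewrite mxE eqxx /= rmorph_nat.
Qed.

Lemma has_partial_spow_sqnorm k (b : R[i]) : 2 <= Re b ->
  has_partial k (fun x : 'rV[R]_n => spow true b (sqnorm x))
    (fun x => 2 * b * ((x ord0 k)%:C * spow true (b - 1) (sqnorm x))).
Proof.
move=> b2.
apply: has_partial_eq (has_partial_comp (fun t => is_derive_spow true t b2)
  (fun x => is_derive_sqnorm k x)) _ => x.
(* Differentiation has made the power odd, but odd and even powers coincide on the nonnegative
   values of [sqnorm]. *)
rewrite (spow_true_ge0 (~~ true))// ?sqnorm_ge0//.
by rewrite rmorphM /= rmorph_nat; ring.
Qed.

End Dimension.
End PartialCalculus.

(** * The shift identity, pointwise *)

Section KernelCalculus.
Context {R : realType} {d : nat}.
Local Open Scope complex_scope.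
Local Notation Re := complex.Re.
Local Notation Im := complex.Im.
Local Notation m := (@ord_max d).
Local Notation N := (d.+1%:R : R[i]).
Implicit Types (s : bool) (a b : R[i]) (k : 'I_d.+1) (x : 'rV[R]_d.+1).

Let P s a x : R[i] := spow s a (x ord0 m).
Let Q b x : R[i] := spow true b (sqnorm x).

(* The kernel with the junk values on [x_n = 0] replaced by [0]; [a] and [b]
   stand for [lam + nu - n] and [- nu]. *)
Definition ckernel s a b x : R[i] := P s a x * Q b x.

Let dP k s a x : R[i] := (m == k)%:R * (a * P (~~ s) (a - 1) x).
Let dQ k b x : R[i] := 2 * b * ((x ord0 k)%:C * Q (b - 1) x).

Definition ckernel1 k s a b x : R[i] := dP k s a x * Q b x + P s a x * dQ k b x.

Let ddP k s a x : R[i] := (m == k)%:R * (a * ((m == k)%:R * ((a - 1) * P s (a - 2) x))).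
Let ddQ k b x : R[i] := 2 * b * (Q (b - 1) x + (x ord0 k)%:C * dQ k (b - 1) x).

(** Kept in the unsimplified form that the product rule yields; the factor [(m == k)%:R] in [dP] and
    [ddP] records that [P] depends on x_n only. *)
Definition ckernel2 k s a b x : R[i] :=
  (ddP k s a x * Q b x + dP k s a x * dQ k b x) +
  (dP k s a x * dQ k b x + P s a x * ddQ k b x).

Let sub2 a : a - 1 - 1 = a - 2.
Proof. by ring. Qed.

Let Re_sub1 a (p q : R) : p + 1 <= q -> q <= Re a -> p <= Re (a - 1).
Proof. by case: a => u v /=; lra. Qed.

Lemma has_partial_ckernel k s a b : 2 <= Re a -> 2 <= Re b ->
  has_partial k (ckernel s a b) (ckernel1 k s a b).
Proof.
move=> a2 b2; apply: has_partialM; first exact: has_partial_spow_coord.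
exact: has_partial_spow_sqnorm.
Qed.

Lemma has_partial_ckernel1 k s a b : 3 <= Re a -> 3 <= Re b ->
  has_partial k (ckernel1 k s a b) (ckernel2 k s a b).
Proof.
move=> a3 b3.
have a2 : 2 <= Re a by apply: le_trans a3; lra.
have b2 : 2 <= Re b by apply: le_trans b3; lra.
have a12 : 2 <= Re (a - 1) by apply: (Re_sub1 _ a3); lra.
have b12 : 2 <= Re (b - 1) by apply: (Re_sub1 _ b3); lra.
have hP := has_partial_spow_coord k s m a2.
have hQ := has_partial_spow_sqnorm (n := d.+1) k b2.
have hdP : has_partial k (dP k s a) (ddP k s a).
  apply: has_partialZ; apply: has_partialZ.
  apply: has_partial_eq (has_partial_spow_coord k (~~ s) m a12) _ => x.
  by rewrite negbK sub2.
have hdQ : has_partial k (dQ k b) (ddQ k b).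
  apply: has_partialZ; apply: has_partial_eq (has_partialM (has_partial_coord k k)
    (has_partial_spow_sqnorm (n := d.+1) k b12)) _ => x.
  by rewrite eqxx mul1r.
by apply: has_partialD; [exact: has_partialM|exact: has_partialM].
Qed.

Lemma moderate_ckernel s a b : 2 <= Re a -> 2 <= Re b -> moderate (ckernel s a b).
Proof.
by move=> a2 b2; apply: moderateM; [exact: moderate_spow_coord|exact: moderate_spow_sqnorm].
Qed.

Lemma moderate_ckernel1 k s a b : 3 <= Re a -> 3 <= Re b -> moderate (ckernel1 k s a b).
Proof.
move=> a3 b3.
have a2 : 2 <= Re a by apply: le_trans a3; lra.
have b2 : 2 <= Re b by apply: le_trans b3; lra.
have a12 : 2 <= Re (a - 1) by apply: (Re_sub1 _ a3); lra.
have b12 : 2 <= Re (b - 1) by apply: (Re_sub1 _ b3); lra.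
apply: moderateD; apply: moderateM.
- do 2 apply: moderateM (moderate_cst _) _; exact: moderate_spow_coord.
- exact: moderate_spow_sqnorm.
- exact: moderate_spow_coord.
- apply: moderateM (moderate_cst _) _; apply: moderateM (moderate_coord _) _.
  exact: moderate_spow_sqnorm.
Qed.

(** Second derivatives involve the exponents [a - 2] and [b - 2], for which [continuous_spow] asks a
    real part of at least [2]; hence the bound [4]. *)
Lemma moderate_ckernel2 k s a b : 4 <= Re a -> 4 <= Re b -> moderate (ckernel2 k s a b).
Proof.
move=> a4 b4.
have a2 : 2 <= Re a by apply: le_trans a4; lra.
have b2 : 2 <= Re b by apply: le_trans b4; lra.
have a12 : 2 <= Re (a - 1) by apply: (Re_sub1 _ a4); lra.
have b12 : 2 <= Re (b - 1) by apply: (Re_sub1 _ b4); lra.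
have a22 : 2 <= Re (a - 2) by rewrite -sub2; apply: (Re_sub1 (q := 3)) (Re_sub1 _ a4); lra.
have b22 : 2 <= Re (b - 1 - 1) by apply: (Re_sub1 (q := 3)) (Re_sub1 _ b4); lra.
have mP s' a' : 2 <= Re a' -> moderate (P s' a') by exact: moderate_spow_coord.
have mQ b' : 2 <= Re b' -> moderate (Q b') by exact: moderate_spow_sqnorm.
have mZ c (u : 'rV[R]_d.+1 -> R[i]) : moderate u -> moderate (fun x => c * u x).
  exact: moderateM (moderate_cst _).
have mdP : moderate (dP k s a) by apply/mZ/mZ/mP.
have mdQ b' : 2 <= Re (b' - 1) -> moderate (dQ k b').
  by move=> h; apply/mZ/(moderateM (moderate_coord _) (mQ _ h)).
have mddP : moderate (ddP k s a) by apply/mZ/mZ/mZ/mZ/mP.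
have mddQ : moderate (ddQ k b).
  exact/mZ/(moderateD (mQ _ b12))/(moderateM (moderate_coord _) (mdQ _ b22)).
by apply: moderateD; apply: moderateD; apply: moderateM; auto.
Qed.

(** For [c = 2 * mu - N - 2] the left side is [P(mu)] applied to the kernel. The cross terms survive
    only for the last coordinate. In the second derivatives of [Q], the sum of the x_k^2 turns
    [Q (b - 2)] back into [Q (b - 1)], so that just two kernels remain. *)
Lemma ckernel_shift_pointwise s a b (c : R[i]) x :
  (x ord0 m)%:C * (\sum_(k < d.+1) ckernel2 k s a b x) - c * ckernel1 m s a b x =
  a * (a - 1 - c) * ckernel (~~ s) (a - 1) b x +
  2 * b * (2 * a + N + 2 * b - 2 - c) * ckernel (~~ s) (a + 1) (b - 1) x.
Proof.
pose X : R[i] := (x ord0 m)%:C.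
have PA : P s a x = X * P (~~ s) (a - 1) x by rewrite /P /X spow_mulx negbK subrK.
have PB : X * P s (a - 2) x = P (~~ s) (a - 1) x.
  by rewrite /P /X spow_mulx; congr spow; ring.
have PC : P (~~ s) (a + 1) x = X * P s a x by rewrite /P /X spow_mulx.
have Qs b' : Q b' x = (sqnorm x)%:C * Q (b' - 1) x.
  by rewrite /Q spow_mulx subrK [RHS]spow_true_ge0 ?sqnorm_ge0.
have sumdd : \sum_(k < d.+1) ddQ k b x = 2 * b * (N + 2 * (b - 1)) * Q (b - 1) x.
  rewrite /ddQ -mulr_sumr big_split /= sumr_const card_ord /dQ.
  rewrite [X in _ + X](_ : _ = 2 * (b - 1) * Q (b - 1) x); last first.
    rewrite (Qs (b - 1)) /sqnorm rmorph_sum /= mulr_suml mulr_sumr.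
    by apply: eq_bigr => k _; rewrite expr2 rmorphM /=; ring.
  by rewrite -mulr_natl; ring.
have sum2 : \sum_(k < d.+1) ckernel2 k s a b x =
    a * (a - 1) * P s (a - 2) x * Q b x + 2 * (a * P (~~ s) (a - 1) x * dQ m b x)
    + P s a x * (\sum_(k < d.+1) ddQ k b x).
  rewrite /ckernel2 !big_split /= -mulr_sumr.
  have single (F : 'I_d.+1 -> R[i]) : \sum_(k < d.+1) (m == k)%:R * F k = F m.
    rewrite (bigD1 m)//= eqxx mul1r big1 ?addr0// => k; rewrite eq_sym => /negbTE ->.
    by rewrite mul0r.
  have -> : \sum_(k < d.+1) ddP k s a x * Q b x = a * (a - 1) * P s (a - 2) x * Q b x.
    under eq_bigr do rewrite /ddP -mulrA.
    by rewrite single eqxx mul1r; ring.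
  have -> : \sum_(k < d.+1) dP k s a x * dQ k b x = a * P (~~ s) (a - 1) x * dQ m b x.
    under eq_bigr do rewrite /dP -mulrA.
    by rewrite single.
  by ring.
rewrite sum2 sumdd /ckernel1 /ckernel /dP eqxx mul1r /dQ -/X PC PA -PB.
rewrite -/(P _ _ _) -/(Q _ _).
rewrite /X; ring.
Qed.

End KernelCalculus.

(** * The shift identity integrated against Schwartz functions *)

Section KernelIntegral.
Context {R : realType} {d : nat}.
Local Open Scope complex_scope.
Local Notation Re := complex.Re.
Local Notation Im := complex.Im.
Local Notation m := (@ord_max d).
Local Notation N := (d.+1%:R : R[i]).
Local Notation E := (d.+1.-tuple (measurableTypeR R)).
Local Notation mu := (lebesgue_tuple R d.+1).
Local Notation kernel := (@Defs.kernel R d).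
Implicit Types (s : bool) (a b : R[i]) (f g u v : 'rV[R]_d.+1 -> R[i]).

Definition cmeasurable u := measurable_fun setT (fun t : E => Re (u (rowT t))) /\
  measurable_fun setT (fun t : E => Im (u (rowT t))).

Lemma cmeasurableM u v : cmeasurable u -> cmeasurable v -> cmeasurable (fun x => u x * v x).
Proof.
move=> [u1 u2] [v1 v2]; split.
  by under eq_fun do rewrite complex_ReM; apply: measurable_funB; apply: measurable_funM.
by under eq_fun do rewrite complex_ImM; apply: measurable_funD; apply: measurable_funM.
Qed.

Lemma ccontinuous_cmeasurable u : ccontinuous u -> cmeasurable u.
Proof. by move=> [c1 c2]; split;
  [exact: (measurable_continuous_row c1)|exact: (measurable_continuous_row c2)]. Qed.

Lemma cmeasurable_cpow (F : 'rV[R]_d.+1 -> R) a : continuous F ->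
  cmeasurable (fun x => cpow (F x) a).
Proof.
move=> cF.
have mln : measurable_fun setT (fun t : E => ln (F (rowT t))).
  exact: measurableT_comp (@measurable_ln R) (measurable_continuous_row cF).
have mc (c : R) : measurable_fun setT (fun t : E => c * ln (F (rowT t))).
  by apply: measurable_funM.
have me : measurable_fun setT (fun t : E => expR (Re a * ln (F (rowT t)))).
  by apply: (measurableT_comp (f := expR)) (mc _); exact: measurable_expR.
have mcos : measurable_fun setT (fun t : E => cos (Im a * ln (F (rowT t)))).
  by apply: (measurableT_comp (f := cos)) (mc _); apply: continuous_measurable_fun;
    exact: continuous_cos.
have msin : measurable_fun setT (fun t : E => sin (Im a * ln (F (rowT t)))).
  by apply: (measurableT_comp (f := sin)) (mc _); apply: continuous_measurable_fun;
    exact: continuous_sin.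
split; rewrite /cpow.
  under eq_fun do rewrite Re_realM /=.
  exact: measurable_funM.
under eq_fun do rewrite Im_realM /=.
exact: measurable_funM.
Qed.

(** On x_n = 0 the kernel has a default value that need not continue it, so measurability is checked
    factor by factor. It serves to replace the kernel by [ckernel] almost everywhere. *)
Lemma cmeasurable_kernel s lam nu : cmeasurable (kernel s lam nu : 'rV[R]_d.+1 -> R[i]).
Proof.
apply: cmeasurableM; first apply: cmeasurableM.
- case: s; first by split; exact: measurable_cst.
  split; last exact: measurable_cst.
  have msg : measurable_fun setT (@Num.sg R).
    apply: nondecreasing_measurable => // x y xy.
    by have [x0|x0|x0] := sgrP x; have [y0|y0|y0] := sgrP y; lra.
  apply: (measurableT_comp (f := @Num.sg R) (g := fun t : E => rowT t ord0 m)) => //.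
  exact: (measurable_continuous_row (@coord_continuous _ _ _ _ _)).
- apply: (cmeasurable_cpow (F := fun x => `|x ord0 m|)) => x.
  exact: (cvg_norm (@coord_continuous _ _ _ _ _ x)).
- apply: cmeasurable_cpow; exact: continuous_sqnorm.
Qed.

Lemma hyperplane_null : measurable [set t : E | tnth t m = 0] /\
  mu [set t : E | tnth t m = 0] = 0%E.
Proof.
pose A (i : 'I_d.+1) : set (measurableTypeR R) := if i == m then [set 0] else setT.
have mA i : measurable (A i) by rewrite /A; case: ifP => // _; exact: measurable_set1.
have e : [set t : E | tnth t m = 0] = [set t | forall i, A i (tnth t i)].
  apply/seteqP; split => t /= h; last by have := h m; rewrite /A eqxx.
  by move=> i; rewrite /A; case: eqP => [->|].
split.
  rewrite -[X in measurable X]setTI.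
  exact: (measurable_tnth m measurableT (measurable_set1 (0 : measurableTypeR R))).
by rewrite e lebesgue_tuple_box// (bigD1 m)//= /A eqxx lebesgue_measure_set1 mul0e.
Qed.

Lemma kernel_ckernel s lam nu (x : 'rV[R]_d.+1) : x ord0 m != 0 ->
  kernel s lam nu x = ckernel s (lam + nu - N) (- nu) x.
Proof.
move=> x0; rewrite /kernel /ckernel /spow (negbTE x0) gt_eqF ?mul1r.
  by rewrite (ger0_norm (sqnorm_ge0 x)).
rewrite /sqnorm (bigD1 m)//= ltr_pwDl//.
  by rewrite exprn_even_gt0.
by apply: sumr_ge0 => i _; exact: sqr_ge0.
Qed.

Lemma cintegral_kernel s lam nu f : 2 <= Re (lam + nu - N) -> 2 <= Re (- nu) ->
  ccontinuous f ->
  cintegral (fun x => kernel s lam nu x * f x) =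
  cintegral (fun x => ckernel s (lam + nu - N) (- nu) x * f x).
Proof.
move=> a2 b2 cf.
have [m1 m2] := cmeasurableM (cmeasurable_kernel s lam nu) (ccontinuous_cmeasurable cf).
have [m3 m4] := ccontinuous_cmeasurable (ccontinuousM (moderate_ckernel s a2 b2).1 cf).
have [mN N0] := hyperplane_null.
have ae (p : R[i] -> R) : measurable_fun setT (fun t : E => p (kernel s lam nu (rowT t) * f
  (rowT t))) ->
    measurable_fun setT (fun t : E => p (ckernel s (lam + nu - N) (- nu) (rowT t) * f
      (rowT t))) ->
    (\int[mu]_t p (kernel s lam nu (rowT t) * f (rowT t)))%R =
    (\int[mu]_t p (ckernel s (lam + nu - N) (- nu) (rowT t) * f (rowT t)))%R.
  move=> p1 p2; rewrite /Rintegral; congr fine; apply: ae_eq_integral => //.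
  - exact/measurable_EFinP.
  - exact/measurable_EFinP.
  exists [set t : E | tnth t m = 0]; split => // t /= nt; apply: contrapT => t0; apply: nt => _.
  by rewrite kernel_ckernel// mxE; exact/eqP.
rewrite /cintegral; congr (_ +i* _).
  exact: (ae (@complex.Re R) m1 m3).
exact: (ae (@complex.Im R) m2 m4).
Qed.

Lemma cintegral_sum (I : Type) (r : seq I) (F : I -> 'rV[R]_d.+1 -> R[i]) :
  (forall i, rapid (F i)) ->
  rapid (fun x => \sum_(i <- r) F i x) /\
  cintegral (fun x => \sum_(i <- r) F i x) = \sum_(i <- r) cintegral (F i).
Proof.
move=> rF; elim: r => [|i r [IH1 IH2]].
  have r0 : rapid (fun x : 'rV[R]_d.+1 => \sum_(i <- [::]) F i x).
    under eq_fun do rewrite big_nil.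
    split; first by split; exact: cst_continuous.
    by move=> k; exists 0 => x; rewrite normr0 mulr0.
  split => //; rewrite big_nil.
  (* The empty sum is its own multiple by [0], so its integral vanishes by linearity. *)
  have := cintegralZ 0 r0; rewrite mul0r => e; rewrite -[RHS]e; congr cintegral.
  by apply/funext => x; rewrite big_nil mul0r.
rewrite big_cons -IH2.
have -> : (fun x => \sum_(j <- i :: r) F j x) = fun x => F i x + \sum_(j <- r) F j x.
  by apply/funext => x; rewrite big_cons.
by split; [exact: rapidD|exact: cintegralD].
Qed.

(** Two integrations by parts for each second derivative and one for the first derivative leave the
    pointwise identity under the integral. *)
Lemma ckernel_shift s a b (c : R[i]) f : 4 <= Re a -> 4 <= Re b -> schwartz f ->
  \sum_(k < d.+1) cintegral (fun x => ckernel s a b x * partial k (partial k (mulx m f)) x)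
  + c * cintegral (fun x => ckernel s a b x * partial m f x) =
  a * (a - 1 - c) * cintegral (fun x => ckernel (~~ s) (a - 1) b x * f x)
  + 2 * b * (2 * a + N + 2 * b - 2 - c)
    * cintegral (fun x => ckernel (~~ s) (a + 1) (b - 1) x * f x).
Proof.
move=> a4 b4 sf.
have a3 : 3 <= Re a by apply: le_trans a4; lra.
have b3 : 3 <= Re b by apply: le_trans b4; lra.
have a2 : 2 <= Re a by apply: le_trans a4; lra.
have b2 : 2 <= Re b by apply: le_trans b4; lra.
have am : 2 <= Re (a - 1) by case: (a) a4 => p q /=; lra.
have ap : 2 <= Re (a + 1) by case: (a) a4 => p q /=; lra.
have bm : 2 <= Re (b - 1) by case: (b) b4 => p q /=; lra.
have sg := schwartz_mulx m sf; have rf := schwartz_rapid sf.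
have rg := schwartz_rapid sg.
have m0 := moderate_ckernel (d := d) s a2 b2.
have m1 (k : 'I_d.+1) := moderate_ckernel1 k s a3 b3.
have m2 (k : 'I_d.+1) := moderate_ckernel2 k s a4 b4.
have parts2 (k : 'I_d.+1) : cintegral (fun x => ckernel s a b x * partial k (partial k
  (mulx m f)) x) =
    cintegral (fun x => ckernel2 k s a b x * mulx m f x).
  have sk := schwartz_partial k sg.
  rewrite (cintegral_by_parts m0 (m1 k) (schwartz_rapid sk)
    (schwartz_rapid (schwartz_partial k sk)) (has_partial_ckernel k s a2 b2)
    (schwartz_has_partial k sk)).
  rewrite (cintegral_by_parts (m1 k) (m2 k) rg (schwartz_rapid sk)
    (has_partial_ckernel1 k s a3 b3) (schwartz_has_partial k sg)).
  by rewrite opprK.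
have parts1 : cintegral (fun x => ckernel s a b x * partial m f x) =
    - cintegral (fun x => ckernel1 m s a b x * f x).
  exact: (cintegral_by_parts m0 (m1 m) rf (schwartz_rapid (schwartz_partial m sf))
    (has_partial_ckernel m s a2 b2) (schwartz_has_partial m sf)).
rewrite parts1 mulrN -mulNr.
under eq_bigr do rewrite parts2.
have [rS <-] := cintegral_sum (index_enum 'I_d.+1) (fun k => moderate_rapid (m2 k) rg).
have r1 := moderate_rapid (m1 m) rf.
have rA := moderate_rapid (moderate_ckernel (d := d) (~~ s) am b2) rf.
have rB := moderate_rapid (moderate_ckernel (d := d) (~~ s) ap bm) rf.
rewrite -!cintegralZ// -!cintegralD//; last 3 first.
- exact: moderate_rapid (moderate_cst _) rA.
- exact: moderate_rapid (moderate_cst _) rB.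
- exact: moderate_rapid (moderate_cst _) r1.
congr cintegral; apply/funext => x.
rewrite -mulr_suml /mulx.
transitivity (((x ord0 m)%:C * (\sum_(k < d.+1) ckernel2 k s a b x) - c * ckernel1 m s a b x)
  * f x).
  by ring.
by rewrite ckernel_shift_pointwise; ring.
Qed.

End KernelIntegral.

Section Projections.
Context {K : numFieldType} {V W : normedModType K}.

Lemma differentiable_fst (p : V * W) : differentiable (fun q : V * W => q.1) p.
Proof.
pose L := GRing.isLinear.Build K (V * W)%type V *:%R (@fst V W) (fun _ _ _ => erefl).
pose f : {linear (V * W)%type -> V} := HB.pack (@fst V W) L.
by apply: (@linear_differentiable _ _ _ f) => q; exact: cvg_fst.
Qed.

Lemma differentiable_snd (p : V * W) : differentiable (fun q : V * W => q.2) p.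
Proof.
pose L := GRing.isLinear.Build K (V * W)%type W *:%R (@snd V W) (fun _ _ _ => erefl).
pose f : {linear (V * W)%type -> W} := HB.pack (@snd V W) L.
by apply: (@linear_differentiable _ _ _ f) => q; exact: cvg_snd.
Qed.

End Projections.

(** * The region of convergence and the conclusion *)

Section ConvergenceRegion.
Context {R : realType} {d : nat}.
Local Open Scope complex_scope.
Local Notation Re := complex.Re.
Local Notation N := (d.+1%:R : R[i]).
Local Notation C2 := (R[i]^o * R[i]^o)%type.

Lemma complex_ReN (z : R[i]) : Re (- z) = - Re z.
Proof. by case: z. Qed.

Lemma Re_natr (k : nat) : Re (k%:R : R[i]) = k%:R.
Proof. by rewrite -(rmorph_nat (@real_complex R)). Qed.

Lemma shiftP_kernel (K : bool -> R[i] -> R[i] -> distr R d.+1)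
    (HK : forall s, kernel_family s (K s)) s (lam nu mu : R[i]) f :
  d.+1%:R + 4 <= Re (lam + nu) -> 4 <= Re (- nu) -> schwartz f ->
  shiftP mu (K s lam nu) f =
  (lam + nu - N) * (lam + nu - 2 * mu + 1) * K (~~ s) (lam - 1) nu f +
  2 * nu * (2 * mu - 2 * lam) * K (~~ s) lam (nu + 1) f.
Proof.
move=> hl hn sf.
pose a := lam + nu - N.
have KE s' l v g : 2 <= Re (l + v - N) -> 2 <= Re (- v) -> schwartz g ->
    K s' l v g = cintegral (fun x => ckernel s' (l + v - N) (- v) x * g x).
  move=> h1 h2 sg; rewrite -cintegral_kernel//; last exact: (schwartz_rapid sg).1.
  (* Both convergence conditions follow, the second one because [l - v] is [(l + v) + 2 * (- v)]. *)
  have [_ /(_ l v) H] := HK s'; apply: H => //.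
    by move: h1; rewrite !(complex_ReD, complex_ReN) Re_natr -natr1; lra.
  move: h1 h2; rewrite !(complex_ReD, complex_ReN) Re_natr.
  have : 0 <= d.+1%:R :> R by [].
  lra.
have a4 : 4 <= Re a by move: hl; rewrite /a !(complex_ReD, complex_ReN) Re_natr; lra.
have a2 : 2 <= Re (lam + nu - N) by rewrite /a in a4; lra.
rewrite shiftPE.
have b2 : 2 <= Re (- nu) by lra.
rewrite (eq_bigr _ (fun k _ => KE s lam nu _ a2 b2
  (schwartz_partial k (schwartz_partial k (schwartz_mulx ord_max sf))))).
rewrite (KE s lam nu _ a2 b2 (schwartz_partial ord_max sf)) ckernel_shift//.
rewrite (KE (~~ s) (lam - 1) nu)//; last first.
  have -> : lam - 1 + nu - N = a - 1 by rewrite /a; ring.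
  by move: a4; rewrite !(complex_ReD, complex_ReN) /=; lra.
rewrite (KE (~~ s) lam (nu + 1))//; last 2 first.
- have -> : lam + (nu + 1) - N = a + 1 by rewrite /a; ring.
  by move: a4; rewrite !complex_ReD /=; lra.
- by move: hn; rewrite !(complex_ReN, complex_ReD) /=; lra.
have -> : lam - 1 + nu - N = lam + nu - N - 1 by ring.
have -> : lam + (nu + 1) - N = lam + nu - N + 1 by ring.
have -> : - (nu + 1) = - nu - 1 by ring.
by congr (_ * _ + _ * _); ring.
Qed.

(** Here Re(lam + nu) = n + 6 and Re(- nu) = 6. In the unit ball the former changes by less than [2]
    and the latter by less than [1], which keeps the bounds asked by [shiftP_kernel]. *)
Definition base_point : C2 := ((d.+1 + 12)%:R : R[i], - 6%:R : R[i]).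

Lemma base_point_ball (q : C2) : ball base_point 1%:C q ->
  d.+1%:R + 4 <= Re (q.1 + q.2) /\ 4 <= Re (- q.2).
Proof.
move=> [q1 q2].
have h1 := le_lt_trans (normc_ge_Re _) q1; have h2 := le_lt_trans (normc_ge_Re _) q2.
move: h1 h2; rewrite /base_point /= !ltcR !(complex_ReD, complex_ReN) /= !Re_natr natrD.
by rewrite !ltr_norml => h1 h2; split; lra.
Qed.

End ConvergenceRegion.

Theorem theorem3p5 (R : realType) (d : nat) (n_ge2 : (2 <= d.+1)%N)
    (K : bool -> R[i] -> R[i] -> distr R d.+1)
    (HK : forall s : bool, kernel_family s (K s)) :
  forall s : bool,
    eq_meromorphic
      (fun lam nu : R[i] => shiftP lam (K s lam nu))
      (fun lam nu : R[i] =>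
         distr_scale ((lam + nu - d.+1%:R) * (nu - lam + 1))
           (K (~~ s) (lam - 1) nu)) /\
    eq_meromorphic
      (fun lam nu : R[i] => shiftP ((lam + nu + 1) / 2) (K s lam nu))
      (fun lam nu : R[i] =>
         distr_scale (2 * nu * (nu - lam + 1)) (K (~~ s) lam (nu + 1))).
Proof.
move=> s.
have mK s' := meromorphic_family_weak (HK s').1.
have d1 (p : R[i]^o * R[i]^o) : differentiable (fun q : R[i]^o * R[i]^o => q.1) p
  by exact: differentiable_fst.
have d2 (p : R[i]^o * R[i]^o) : differentiable (fun q : R[i]^o * R[i]^o => q.2) p
  by exact: differentiable_snd.
have dc (c : R[i]^o) (p : R[i]^o * R[i]^o) : differentiable (fun=> c) p
  by exact: differentiable_cst.
split; apply: (meromorphic_continuation (p := base_point (d := d)) _ _ ltr01).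
- exact: (weakly_meromorphic_shiftP d1 (mK s)).
(* The variable that is not shifted gets [+ 0], to present the family as a translate by (-1, 0). *)
- rewrite (_ : (fun lam nu : R[i] => _) = fun lam nu : R[i] =>
    distr_scale ((lam + nu - d.+1%:R) * (nu - lam + 1)) (K (~~ s) (lam + - 1) (nu + 0))).
    apply: (weakly_meromorphic_translate (c := fun p : R[i]^o * R[i]^o =>
      (p.1 + p.2 - d.+1%:R) * (p.2 - p.1 + 1) : R[i]^o) _ _ _ (mK (~~ s))) => p.
    exact: (differentiableM (differentiableB (differentiableD (d1 p) (d2 p)) (dc _ p))
      (differentiableD (differentiableB (d2 p) (d1 p)) (dc 1 p))).
  by apply/funext => lam; apply/funext => nu; rewrite addr0.
- move=> [lam nu] /base_point_ball /= [h1 h2] f sf.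
  by rewrite (shiftP_kernel HK)// subrr mulr0 mul0r addr0 /distr_scale; congr (_ * _ * _); ring.
- apply: (weakly_meromorphic_shiftP (mu := fun p : R[i]^o * R[i]^o =>
    (p.1 + p.2 + 1) / 2 : R[i]^o) _ (mK s)) => p.
  exact: (differentiableM (differentiableD (differentiableD (d1 p) (d2 p)) (dc 1 p)) (dc _ p)).
- rewrite (_ : (fun lam nu : R[i] => _) = fun lam nu : R[i] =>
    distr_scale (2 * nu * (nu - lam + 1)) (K (~~ s) (lam + 0) (nu + 1))).
    apply: (weakly_meromorphic_translate (c := fun p : R[i]^o * R[i]^o =>
      2 * p.2 * (p.2 - p.1 + 1) : R[i]^o) _ _ _ (mK (~~ s))) => p.
    exact: (differentiableM (differentiableM (dc 2 p) (d2 p))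
      (differentiableD (differentiableB (d2 p) (d1 p)) (dc 1 p))).
  by apply/funext => lam; apply/funext => nu; rewrite addr0.
- move=> [lam nu] /base_point_ball /= [h1 h2] f sf.
  rewrite (shiftP_kernel HK)// /distr_scale.
  (* This value of [mu] annihilates the first coefficient and turns [2 * mu - 2 * lam] into
     [nu - lam + 1]. *)
  have -> : lam + nu - 2 * ((lam + nu + 1) / 2) + 1 = 0 by field.
  by rewrite mulr0 mul0r add0r; congr (_ * _ * _); field.
Qed.
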